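(* Let $q\ge 2$ be a prime power, let $N\ge 1$ be an integer, and let $k\ge 1$ be an integer with $k=o(\log N)$ as $N\to\infty$. Let $f$ be a Steinhaus random multiplicative function over $\mathbb{F}_q[t]$. Then $$\frac{1}{\sqrt{|\mathcal{A}|}}\sum_{F\in\mathcal{A}}f(F)\xrightarrow{d}\mathcal{CN}(0,1)\quad\text{as } N\to\infty$$ for each of the following choices of $\mathcal{A}$: (a) $\mathcal{A}=\mathcal{P}_k(N):=\{F\in\mathcal{M}_N:\ \Omega(F)=k\}$; (b) $\mathcal{A}=\mathcal{S}_k(N):=\{F\in\mathcal{M}_N:\ \Omega(F)=\omega(F)=k\}$; (c) $\mathcal{A}=\mathcal{D}_k(N):=\{F\in\mathcal{M}_N:\ \omega(F)=k\}$.
   Context: $\mathcal{M}$ is the set of monic polynomials in $\mathbb{F}_q[t]$ and $\mathcal{M}_N$ is the subset of those of degree $N$. For $F=P_1^{k_1}\cdots P_j^{k_j}$ with distinct monic irreducibles $P_i$ and $k_i\ge1$, $\Omega(F):=k_1+\cdots+k_j$ and $\omega(F):=j$. A Steinhaus random multiplicative function over $\mathbb{F}_q[t]$ is the random function $f:\mathcal{M}\to\mathbb{C}$ obtained from independent random variables $(f(P))_P$, indexed by the monic irreducible polynomials $P$ and each uniformly distributed on the complex unit circle, by $f(1)=1$ and $f(F)=f(P_1)^{a_1}\cdots f(P_r)^{a_r}$, where $F=P_1^{a_1}\cdots P_r^{a_r}$ is the factorization of $F$ into powers of distinct monic irreducibles. $\xrightarrow{d}$ is convergence in distribution and $\mathcal{CN}(0,1)$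 is the standard complex normal distribution (mean 0, variance 1: real and imaginary parts are independent real normals with mean $0$ and variance $1/2$). The parameters $q$ and $k$ may vary arbitrarily with $N$: the limit is along arbitrary sequences of triples $(q,N,k)$ with $N\to\infty$ and $k/\log N\to 0$. *)

(* Defs.v *)
From HB Require Import structures.
From mathcomp Require Import all_boot all_order all_algebra.
From mathcomp Require Import complex.
From mathcomp Require Import all_classical all_reals all_analysis.
Import Order.TTheory GRing.Theory Num.Theory.
Import numFieldNormedType.Exports.

Set Implicit Arguments.
Unset Strict Implicit.
Unset Printing Implicit Defensive.

Local Open Scope ring_scope.

Section Polynomials.
Variable K : finFieldType.
Implicit Types (A B Q : {poly K}) (s : seq {poly K}) (a : {poly K} -> nat).

Definition prime_poly Q : bool := (Q \is monic) && irreducibleb Q.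

(* Prime divisors of A <> 0 have size at most size A, hence the finite type. *)
Definition prime_divisors A : seq {poly K} :=
  [seq polyn Q | Q : {poly_(size A) K} <- enum {poly_(size A) K} &
    prime_poly Q && (polyn Q %| A)].

(* For Q of positive degree and A <> 0, Q ^+ e %| A forces e < size A. *)
Definition multiplicity Q A : nat :=
  \max_(e < size A | Q ^+ e %| A) (e : nat).

Definition omega A : nat := size (prime_divisors A).

Definition Omega A : nat := \sum_(Q <- prime_divisors A) multiplicity Q A.

Lemma prime_polyP Q : prime_poly Q -> Q \is monic /\ irreducible_poly Q.
Proof. by case/andP=> ? /irreducibleP. Qed.

Lemma mem_prime_divisors A Q : A != 0 ->
  (Q \in prime_divisors A) = prime_poly Q && (Q %| A).
Proof.
move=> A0; apply/mapP/idP => [[q]|QA].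
  by rewrite mem_filter => /andP[h _] ->.
have sQ : (size Q <= size A)%N by apply: dvdp_leq => //; case/andP: QA.
by exists (NPoly sQ) => //; rewrite mem_filter QA mem_enum.
Qed.

Lemma prime_divisors_uniq A : uniq (prime_divisors A).
Proof.
have inj : injective (@polyn K (size A)) by move=> x y; exact: val_inj.
by rewrite (map_inj_uniq inj) filter_uniq ?enum_uniq.
Qed.

Lemma prime_poly_coprime Q Q' :
  prime_poly Q -> prime_poly Q' -> Q != Q' -> coprimep Q Q'.
Proof.
move=> /prime_polyP[mQ iQ] /prime_polyP[mQ' iQ'] QQ'.
rewrite irreducible_poly_coprime//; apply: contra QQ' => dQ.
have sQ1 : size Q != 1%N by case: iQ => + _; rewrite neq_ltn orbC => ->.
by rewrite -eqp_monic//; case: iQ' => _; apply.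
Qed.

Lemma monic_prod_prime s a : all prime_poly s ->
  \prod_(Q <- s) Q ^+ a Q \is monic.
Proof.
move=> sp; rewrite big_seq; apply: monic_prod => Q /(allP sp)/prime_polyP[mQ _].
exact: monic_exp.
Qed.

Lemma prime_dvd_prod s a Q : all prime_poly s -> prime_poly Q ->
  Q %| \prod_(Q' <- s) Q' ^+ a Q' -> exists2 Q', Q' \in s & (Q = Q') /\ (0 < a Q')%N.
Proof.
move=> sp pQ; have [mQ iQ] := prime_polyP pQ.
have Q1 : ~~ (Q %| 1).
  by rewrite dvdp1; case: iQ => + _; rewrite neq_ltn orbC => ->.
elim: s sp => [|P s IH] /=; first by rewrite big_nil (negbTE Q1).
case/andP=> pP sp; rewrite big_cons.
have [QP|QP] := eqVneq Q P; last first.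
  rewrite Gauss_dvdpr ?coprimep_expr ?prime_poly_coprime//.
  by move/IH => /(_ sp)[Q' Q's h]; exists Q' => //; rewrite inE Q's orbT.
case: (posnP (a P)) => [->|aP]; last by exists P; rewrite ?mem_head.
rewrite expr0 mul1r => /(IH sp)[Q' Q's h].
by exists Q' => //; rewrite inE Q's orbT.
Qed.

Lemma multiplicity_prod s a Q : uniq s -> all prime_poly s -> Q \in s ->
  multiplicity Q (\prod_(Q' <- s) Q' ^+ a Q') = a Q.
Proof.
move=> us sp Qs; set A := \prod_(_ <- s) _.
have pQ : prime_poly Q := allP sp _ Qs.
have [mQ iQ] := prime_polyP pQ.
have mA : A \is monic := monic_prod_prime a sp.
have A0 := monic_neq0 mA.
have AE : A = Q ^+ a Q * \prod_(Q' <- s | Q' != Q) Q' ^+ a Q'.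
  by rewrite /A (bigD1_seq Q).
set B := \prod_(Q' <- s | _) _ in AE.
have QB : ~~ (Q %| B).
  rewrite /B -big_filter; apply/negP.
  case/prime_dvd_prod => //.
    by apply/allP => P; rewrite mem_filter => /andP[_ /(allP sp)].
  by move=> P; rewrite mem_filter => /andP[PQ _] [QP]; rewrite QP eqxx in PQ.
have dvdE e : (Q ^+ e %| A) = (e <= a Q)%N.
  rewrite AE; case: (leqP e (a Q)) => ea.
    by rewrite dvdp_mulr// dvdp_exp2l.
  apply: contraNF QB => h; rewrite -(@dvdp_mul2l _ (Q ^+ a Q)) ?expf_neq0 ?monic_neq0//.
  by rewrite -exprSr; apply: dvdp_trans h; rewrite dvdp_exp2l.
have eA e : Q ^+ e %| A -> (e < size A)%N.
  move/dvdp_leq => /(_ A0); apply: leq_trans.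
  rewrite -[size _]prednK ?size_poly_gt0 ?expf_neq0 ?monic_neq0// ltnS.
  rewrite size_exp leq_pmull//; case: iQ => + _; by case: size => [|[]].
have aA : (a Q < size A)%N by apply: eA; rewrite dvdE.
apply/eqP; rewrite eqn_leq; apply/andP; split.
  by apply/bigmax_leqP => e; rewrite dvdE.
by rewrite /multiplicity (bigD1 (Ordinal aA)) ?dvdE//= leq_maxl.
Qed.

Section Factorization.
Variables (s : seq {poly K}) (a : {poly K} -> nat).
Hypotheses (us : uniq s) (sp : all prime_poly s).
Hypothesis a_gt0 : forall Q, Q \in s -> (0 < a Q)%N.

Let A := \prod_(Q <- s) Q ^+ a Q.

Lemma prime_divisors_prod : perm_eq (prime_divisors A) s.
Proof.
have A0 : A != 0 := monic_neq0 (monic_prod_prime a sp).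
apply: uniq_perm => //; first exact: prime_divisors_uniq.
move=> Q; rewrite mem_prime_divisors//; apply/andP/idP => [[pQ]|Qs].
  by case/prime_dvd_prod => // P Ps [-> _].
split; first exact: allP sp _ Qs.
by rewrite /A (bigD1_seq Q)//= dvdp_mulr// dvdp_exp// a_gt0.
Qed.

Lemma omega_prod : omega A = size s.
Proof. exact: perm_size prime_divisors_prod. Qed.

Lemma Omega_prod : Omega A = (\sum_(Q <- s) a Q)%N.
Proof.
rewrite /Omega (perm_big _ prime_divisors_prod)/=.
by apply: eq_big_seq => Q Qs; exact: multiplicity_prod.
Qed.

End Factorization.

Definition monic_deg (N : nat) : {set {poly_N.+1 K}} :=
  [set A : {poly_N.+1 K} | (polyn A \is monic) && (size A == N.+1)].

Definition calP (k N : nat) : {set {poly_N.+1 K}} :=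
  [set A in monic_deg N | Omega A == k].

Definition calS (k N : nat) : {set {poly_N.+1 K}} :=
  [set A in monic_deg N | (Omega A == k) && (omega A == k)].

Definition calD (k N : nat) : {set {poly_N.+1 K}} :=
  [set A in monic_deg N | omega A == k].

End Polynomials.

Local Open Scope classical_set_scope.

Section Probability.
Variable R : realType.

(* The libraries give R[i] neither a sigma-algebra nor a topology over R: both
   are taken from the identification of the complex numbers with the plane.
   measurableTypeR R is R with its Borel sigma-algebra, the space on which
   normal_prob and uniform_prob are measures. *)
Definition plane := (measurableTypeR R * measurableTypeR R)%type.

Definition toR2 (z : R[i]) : plane := (complex.Re z, complex.Im z).

Lemma twopi_gt0 : (0 : R) < 2 * pi.
Proof. by rewrite mulr_gt0// pi_gt0. Qed.

(* Law of e^{i theta} for theta uniform on [0, 2 pi]. *)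
Definition uniform_circle : set plane -> \bar R :=
  pushforward (uniform_prob twopi_gt0) (fun t : R => (cos t, sin t) : plane).

(* The second parameter of normal_prob is the standard deviation. *)
Definition complex_normal : probability plane R :=
  (normal_prob 0 (Num.sqrt 2^-1) \x normal_prob 0 (Num.sqrt 2^-1))%E.

Section OneSpace.
Context (d : measure_display) (T : measurableType d) (P : probability T R).

Definition complex_RV (X : T -> R[i]) : Prop :=
  measurable_fun [set: T] (toR2 \o X).

Definition uniform_on_circle (X : T -> R[i]) : Prop :=
  forall B : set plane, measurable B ->
    P ((toR2 \o X) @^-1` B) = uniform_circle B.

Definition mutually_independent (I : eqType) (J : pred I) (X : I -> T -> R[i]) :
    Prop :=
  forall (s : seq I) (B : I -> set plane), uniq s -> all J s ->
    (forall i, measurable (B i)) ->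
    P (\big[setI/setT]_(i <- s) ((toR2 \o X i) @^-1` B i)) =
      (\prod_(i <- s) P ((toR2 \o X i) @^-1` B i))%E.

(* f is meaningful on monic polynomials only; its values elsewhere are
   irrelevant and unconstrained. *)
Record steinhaus (K : finFieldType) (f : {poly K} -> T -> R[i]) : Prop := {
  steinhaus_RV : forall Q, prime_poly Q -> complex_RV (f Q);
  steinhaus_uniform : forall Q, prime_poly Q -> uniform_on_circle (f Q);
  steinhaus_indep : mutually_independent (@prime_poly K) f;
  steinhaus_mul : forall (s : seq {poly K}) (a : {poly K} -> nat) (w : T),
    uniq s -> all (@prime_poly K) s ->
    f (\prod_(Q <- s) Q ^+ a Q) w = \prod_(Q <- s) f Q w ^+ a Q
}.

Definition normalized_sum (K : finFieldType) (N : nat)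
    (A : {set {poly_N.+1 K}}) (f : {poly K} -> T -> R[i]) : T -> R[i] :=
  fun w => ((Num.sqrt (#|A|%:R : R))^-1)%:C%C * \sum_(G in A) f (polyn G) w.

End OneSpace.

Definition cvg_in_distribution (d : nat -> measure_display)
    (T : forall n, measurableType (d n)) (P : forall n, probability (T n) R)
    (Z : forall n, T n -> R[i]) (mu : probability plane R) : Prop :=
  (forall n, complex_RV (Z n)) /\
  forall g : R * R -> R, continuous g ->
    (exists M : R, forall x, `|g x| <= M) ->
    (\int[P n]_w (g (toR2 (Z n w)))%:E @[n --> \oo] --> \int[mu]_x (g x)%:E)%E.

End Probability.

(* Main.v *)
(** The three families share a dominant part: the products [Q * G] of a prime [Q]
    of degree at least [N - 2 n], where [n] is the integer part of [(N - 1) / 4],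
    and of a squarefree [G] with [k - 1] prime factors.  Given the values of [f] at
    the primes of degree at most [2 n], the normalised sum over this part is a sum
    of independent variables [c_Q f(Q)], with [V = \sum_Q |c_Q|^2] of mean 1.  The
    second moment of [V] counts the solutions of [G1 G2 = G1' G2'] and is
    [1 + O((k / ln N)^2)].

    Convergence is tested against the heat kernels [heat s z = exp(-|z|^2 / s) / s]
    of the plane.  Removing one term [c f(Q)] advances the time [s] by [|c|^2], up to
    an error of third order in [c]; thus [E (heat s (y - Z))] is close to
    [E (heat (s + V) y)], hence to [heat (s + 1) y], which is the smoothed density of
    the complex normal law.  The remaining polynomials are discarded by orthogonality
    of the [f(F)]. *)
From HB Require Import structures.
Require Import Defs.
From mathcomp Require Import all_boot all_order all_algebra.
From mathcomp Require Import complex.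
From mathcomp Require Import all_classical all_reals all_analysis.
From mathcomp Require Import measurable_realfun.
From mathcomp Require Import ring lra zify.
Import Order.TTheory GRing.Theory Num.Theory.
Import numFieldNormedType.Exports.
Set Implicit Arguments.
Unset Strict Implicit.
Unset Printing Implicit Defensive.
Local Open Scope classical_set_scope.
Local Open Scope ring_scope.

(** * Factorization of monic polynomials *)

(** All estimates must be uniform in q, so polynomials are counted with weight q^(-deg). The only
    fact used about the distribution of primes is that the density of those of degree d lies between
    1/(2 d) and 1/d, over every field. The condition k = o(ln N) enters through one parameter [eps],
    four times the number of prime factors divided by the sum of the prime densities up to n, hence
    O(k / ln N). Polynomials with one prime factor fewer have total weight smaller by a factor
    [eps]. Therefore a cofactor of large degree, a repeated factor or a missing factor is rare, and
    each of the three families exceeds the dominant part by a proportion O(eps + 1/N) only. The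
    obstacle in the limit theorem is that V is random and tied to the c_Q. With heat kernels nothing
    is conditioned or divided by V: it enters as elapsed time, in which the kernel is Lipschitz, and
    the terms of order one and two that contain f(Q) or f(Q)^2 have mean exactly 0. The same kernels
    are densities, so their pointwise convergence gives convergence of smoothed laws by Scheffe's
    argument; a second moment bound then removes the smoothing. *)

Section Factorization.
Variable K : finFieldType.
Implicit Types (F G P Q : {poly K}).

Definition deg F : nat := (size F).-1.

Lemma size_deg F : F \is monic -> size F = (deg F).+1.
Proof. by move=> mF; rewrite /deg prednK// size_poly_gt0 monic_neq0. Qed.

Lemma deg1 : deg 1 = 0%N.
Proof. by rewrite /deg size_poly1. Qed.

Lemma degM F G : F \is monic -> G \is monic -> deg (F * G) = (deg F + deg G)%N.
Proof.
move=> mF mG; rewrite /deg size_monicM ?monic_neq0//.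
by rewrite (size_deg mF) (size_deg mG) /deg /=; lia.
Qed.

Lemma degX F e : F \is monic -> deg (F ^+ e) = (e * deg F)%N.
Proof.
move=> mF; elim: e => [|e IH]; first by rewrite expr0 deg1.
by rewrite exprS degM ?monic_exp// IH mulSn.
Qed.

Lemma monic_deg0 F : F \is monic -> deg F = 0%N -> F = 1.
Proof.
move=> mF F0; have sF : size F = 1%N by rewrite size_deg// F0.
move/eqP/size_poly1P: sF => [c c0 FE]; rewrite FE; congr _%:P.
by move: mF; rewrite FE monicE lead_coefC => /eqP.
Qed.

Lemma prime_monic P : prime_poly P -> P \is monic.
Proof. by case/andP. Qed.

Lemma prime_size P : prime_poly P -> (1 < size P)%N.
Proof. by case/prime_polyP => _ []. Qed.

Lemma prime_deg_gt0 P : prime_poly P -> (0 < deg P)%N.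
Proof. by move/prime_size; rewrite /deg; case: (size P) => [|[]]. Qed.

Lemma prime_dvd_deg P F : F \is monic -> prime_poly P -> P %| F -> (deg P <= deg F)%N.
Proof.
move=> mF pP /dvdp_leq => /(_ (monic_neq0 mF)).
by rewrite (size_deg mF) (size_deg (prime_monic pP)) ltnS.
Qed.

Lemma prime_dvdM P F G : prime_poly P -> (P %| F * G) = (P %| F) || (P %| G).
Proof.
move=> pP; have [mP iP] := prime_polyP pP.
case: (boolP (P %| F)) => [PF|PF]; first by rewrite dvdp_mulr.
by rewrite Gauss_dvdpr// irreducible_poly_coprime.
Qed.

Lemma prime_dvdX P F e : prime_poly P -> (P %| F ^+ e) = (P %| F) && (0 < e)%N.
Proof.
move=> pP; elim: e => [|e IH].
  by rewrite expr0 dvdp1 andbF; move: (prime_size pP); case: (size P) => [|[]].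
by rewrite exprS prime_dvdM// IH andbT; case: (P %| F).
Qed.

Lemma prime_dvd_prime P Q : prime_poly P -> prime_poly Q -> (P %| Q) = (P == Q).
Proof.
move=> pP pQ; apply/idP/eqP => [PQ|->]; last exact: dvdpp.
apply/eqP; rewrite -eqp_monic ?prime_monic//.
have [_ [_ iQ]] := prime_polyP pQ; apply: iQ => //.
by move: (prime_size pP); case: (size P) => [|[]].
Qed.

Lemma exists_prime_dvd F : F \is monic -> (0 < deg F)%N -> exists2 P, prime_poly P & P %| F.
Proof.
have [n] := ubnP (deg F); elim: n F => // n IH F Fn mF F0.
case: (boolP (irreducibleb F)) => [iF|iF].
  by exists F; rewrite ?dvdpp// /prime_poly mF.
have nI : ~ irreducible_poly F by move/irreducibleP; apply/negP.
have sF : (1 < size F)%N by rewrite size_deg.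
have [G [G1 GF nGF]] : exists G, [/\ size G != 1%N, G %| F & ~~ (G %= F)].
  apply: contrapT => /forallNP H; apply: nI; split => // G G1 GF.
  by apply: contrapT => nGF; apply: (H G); split => //; apply/negP.
have F_neq0 := monic_neq0 mF.
have G0 : G != 0 by apply: contraNneq F_neq0 => G0; rewrite G0 dvd0p in GF.
have lc0 : (lead_coef G)^-1 != 0 by rewrite invr_eq0 lead_coef_eq0.
pose G' := (lead_coef G)^-1 *: G.
have mG' : G' \is monic by rewrite monicE lead_coefZ mulVf// lead_coef_eq0.
have sG' : size G' = size G by rewrite size_scale.
have sGF : (size G < size F)%N.
  by rewrite ltn_neqAle dvdp_leq// andbT dvdp_size_eqp.
have [|//||P pP PG] := IH G'.
- by rewrite /deg sG'; move: Fn sGF; rewrite (size_deg mF); lia.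
- by rewrite /deg sG'; move: G1 G0; rewrite -size_poly_eq0; case: (size G) => [|[]].
exists P => //; apply: dvdp_trans GF; move: PG.
by rewrite dvdpZr.
Qed.

Lemma factor_out P F : prime_poly P -> F \is monic ->
  exists e G, [/\ G \is monic, ~~ (P %| G) & F = P ^+ e * G].
Proof.
move=> pP; have [n] := ubnP (deg F); elim: n F => // n IH F Fn mF.
case: (boolP (P %| F)) => [PF|PF]; last by exists 0%N, F; rewrite expr0 mul1r.
have [G FE] := dvdpP _ _ PF.
have mG : G \is monic by move: mF; rewrite FE monicMr// prime_monic.
have dF : deg F = (deg G + deg P)%N by rewrite FE degM// prime_monic.
have dP := prime_deg_gt0 pP.
have [|//|e [H [mH PH GE]]] := IH G; first by lia.
by exists e.+1, H; rewrite exprSr mulrAC -GE -FE.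
Qed.

(** Any exponent can be tested, although [multiplicity] is a maximum over e < size F: comparing
    degrees puts the exact exponent below that bound. *)
Lemma dvd_multiplicity P F e : prime_poly P -> F \is monic ->
  (P ^+ e %| F) = (e <= multiplicity P F)%N.
Proof.
move=> pP mF; have [a [G [mG PG FE]]] := factor_out pP mF.
have mP := prime_monic pP.
have dvdE i : (P ^+ i %| F) = (i <= a)%N.
  rewrite FE; case: (leqP i a) => [ia|ai]; first by rewrite dvdp_mulr// dvdp_exp2l.
  apply: contraNF PG => h; rewrite -(@dvdp_mul2l _ (P ^+ a)) ?expf_neq0 ?monic_neq0//.
  by rewrite -exprSr; apply: dvdp_trans h; rewrite dvdp_exp2l.
rewrite dvdE; congr (_ <= _)%N; apply/eqP; rewrite eqn_leq; apply/andP; split.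
  have aF : (a < size F)%N.
    rewrite (size_deg mF) ltnS FE degM ?monic_exp// degX//.
    by have := prime_deg_gt0 pP; nia.
  by rewrite /multiplicity (bigD1 (Ordinal aF)) ?dvdE//= leq_maxl.
by apply/bigmax_leqP => i; rewrite dvdE.
Qed.

Lemma multiplicity_gt0 P F : prime_poly P -> F \is monic ->
  (0 < multiplicity P F)%N = (P %| F).
Proof. by move=> pP mF; rewrite -dvd_multiplicity// expr1. Qed.

Lemma multiplicity_unique P F e G : prime_poly P -> G \is monic -> ~~ (P %| G) ->
  F = P ^+ e * G -> multiplicity P F = e.
Proof.
move=> pP mG PG FE; have mP := prime_monic pP.
have mF : F \is monic by rewrite FE monicMl ?monic_exp.
apply/eqP; rewrite eqn_leq; apply/andP; split; last by rewrite -dvd_multiplicity// FE dvdp_mulr.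
have Pe0 : P ^+ e != 0 by rewrite expf_neq0 ?monic_neq0.
by rewrite leqNgt -dvd_multiplicity// FE exprSr dvdp_mul2l.
Qed.

Lemma multiplicityM P F G : prime_poly P -> F \is monic -> G \is monic ->
  multiplicity P (F * G) = (multiplicity P F + multiplicity P G)%N.
Proof.
move=> pP mF mG; have mP := prime_monic pP.
have [a [F' [mF' PF' FE]]] := factor_out pP mF.
have [b [G' [mG' PG' GE]]] := factor_out pP mG.
rewrite (multiplicity_unique pP mF' PF' FE) (multiplicity_unique pP mG' PG' GE).
apply: (@multiplicity_unique _ _ _ (F' * G')) => //.
- by rewrite monicMl.
- by rewrite prime_dvdM// negb_or PF'.
- by rewrite FE GE exprD; ring.
Qed.

Lemma multiplicity_prime P Q : prime_poly P -> prime_poly Q ->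
  multiplicity P Q = (P == Q).
Proof.
move=> pP pQ; case: eqVneq => [<-|PQ].
  apply: (@multiplicity_unique _ _ _ 1) => //; rewrite ?monic1 ?expr1 ?mulr1//.
  by rewrite dvdp1; move: (prime_size pP); case: (size P) => [|[]].
by apply/eqP; rewrite -leqn0 leqNgt multiplicity_gt0 ?prime_monic// prime_dvd_prime.
Qed.

Lemma multiplicity1 P : prime_poly P -> multiplicity P 1 = 0%N.
Proof.
move=> pP; apply/eqP; rewrite -leqn0 leqNgt multiplicity_gt0 ?monic1// dvdp1.
by move: (prime_size pP); case: (size P) => [|[]].
Qed.

Lemma multiplicityX P F e : prime_poly P -> F \is monic ->
  multiplicity P (F ^+ e) = (e * multiplicity P F)%N.
Proof.
move=> pP mF; elim: e => [|e IH]; first by rewrite expr0 multiplicity1.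
by rewrite exprS multiplicityM ?monic_exp// IH mulSn.
Qed.

Lemma prime_divisorsP P F : F \is monic ->
  (P \in prime_divisors F) = prime_poly P && (P %| F).
Proof. by move/monic_neq0/mem_prime_divisors. Qed.

Lemma all_prime_divisors F : F \is monic -> all (@prime_poly K) (prime_divisors F).
Proof. by move=> mF; apply/allP => P; rewrite prime_divisorsP// => /andP[]. Qed.

Lemma prime_divisors1 : prime_divisors (1 : {poly K}) = [::].
Proof.
apply/eqP; rewrite -size_eq0 -leqn0 leqNgt -has_predT; apply/hasP => -[P].
rewrite prime_divisorsP ?monic1// => /andP[pP]; rewrite dvdp1 => + _.
by move: (prime_size pP); case: (size P) => [|[]].
Qed.

Lemma prime_divisors_primeM P e G : prime_poly P -> G \is monic -> ~~ (P %| G) ->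
  (0 < e)%N -> perm_eq (prime_divisors (P ^+ e * G)) (P :: prime_divisors G).
Proof.
move=> pP mG PG e0; have mP := prime_monic pP.
have mPG : P ^+ e * G \is monic by rewrite monicMl ?monic_exp.
apply: uniq_perm; rewrite /= ?prime_divisors_uniq ?prime_divisorsP ?(negbTE PG) ?andbF//.
move=> Q; rewrite inE !prime_divisorsP//.
case: eqVneq => [->|QP] /=; first by rewrite pP dvdp_mulr// dvdp_exp.
case pQ: (prime_poly Q) => //=; rewrite prime_dvdM// prime_dvdX// prime_dvd_prime//.
by rewrite (negbTE QP).
Qed.

Lemma omega_primeM P e G : prime_poly P -> G \is monic -> ~~ (P %| G) ->
  (0 < e)%N -> omega (P ^+ e * G) = (omega G).+1.
Proof. by move=> *; rewrite /omega (perm_size (prime_divisors_primeM _ _ _ _)). Qed.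

Lemma sum_multiplicity_primeM (g : {poly K} -> nat) P e G : prime_poly P -> G \is monic ->
  ~~ (P %| G) -> (0 < e)%N ->
  (\sum_(Q <- prime_divisors (P ^+ e * G)) multiplicity Q (P ^+ e * G) * g Q =
   e * g P + \sum_(Q <- prime_divisors G) multiplicity Q G * g Q)%N.
Proof.
move=> pP mG PG e0; rewrite (perm_big _ (prime_divisors_primeM pP mG PG e0)) big_cons.
rewrite (multiplicity_unique pP mG PG erefl); congr (_ + _)%N.
apply: eq_big_seq => Q; rewrite prime_divisorsP// => /andP[pQ QG].
have mP := prime_monic pP; have mPe : P ^+ e \is monic by exact: monic_exp.
rewrite (multiplicityM pQ mPe mG) (multiplicityX e pQ mP) multiplicity_prime//; case: eqVneq => [QP|_]; last by rewrite muln0.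
by rewrite -QP QG in PG.
Qed.

Lemma Omega_primeM P e G : prime_poly P -> G \is monic -> ~~ (P %| G) ->
  (0 < e)%N -> Omega (P ^+ e * G) = (e + Omega G)%N.
Proof.
move=> pP mG PG e0; have := sum_multiplicity_primeM (fun=> 1%N) pP mG PG e0.
rewrite muln1 /Omega; under eq_bigr do rewrite muln1.
by under [in X in _ = X -> _]eq_bigr do rewrite muln1.
Qed.

(** Removing a full prime power at each step leaves a cofactor prime to P, so the additive functions
    of F change by an explicit amount. *)
Lemma factor_ind (H : {poly K} -> Prop) : H 1 ->
  (forall P e G, prime_poly P -> (0 < e)%N -> G \is monic -> ~~ (P %| G) -> H G ->
    H (P ^+ e * G)) ->
  forall F, F \is monic -> H F.
Proof.
move=> H1 HM F; have [n] := ubnP (deg F); elim: n F => // n IH F Fn mF.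
have [/(monic_deg0 mF)->//|F0] := posnP (deg F).
have [P pP PF] := exists_prime_dvd mF F0.
have [[|e] [G [mG PG FE]]] := factor_out pP mF.
  by rewrite FE expr0 mul1r (negbTE PG) in PF.
rewrite FE; apply: HM => //; apply: IH => //.
have mP := prime_monic pP; have := prime_deg_gt0 pP.
have mPe : P ^+ e.+1 \is monic by exact: monic_exp.
by move: Fn; rewrite FE (degM mPe mG) (degX _ mP); nia.
Qed.

Lemma deg_sum_multiplicity F : F \is monic ->
  deg F = (\sum_(Q <- prime_divisors F) multiplicity Q F * deg Q)%N.
Proof.
elim/factor_ind; first by rewrite prime_divisors1 big_nil deg1.
move=> P e G pP e0 mG PG IH.
have mP := prime_monic pP; have mPe : P ^+ e \is monic by exact: monic_exp.
by rewrite sum_multiplicity_primeM// -IH (degM mPe mG) (degX _ mP).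
Qed.

Lemma prod_multiplicity F : F \is monic ->
  F = \prod_(Q <- prime_divisors F) Q ^+ multiplicity Q F.
Proof.
elim/factor_ind; first by rewrite prime_divisors1 big_nil.
move=> P e G pP e0 mG PG IH.
rewrite (perm_big _ (prime_divisors_primeM pP mG PG e0)) big_cons /=.
rewrite (multiplicity_unique pP mG PG erefl) {1}IH; congr (_ * _).
apply: eq_big_seq => Q; rewrite prime_divisorsP// => /andP[pQ QG].
have mP := prime_monic pP; have mPe : P ^+ e \is monic by exact: monic_exp.
rewrite (multiplicityM pQ mPe mG) (multiplicityX e pQ mP) (multiplicity_prime pQ pP); case: eqVneq => [QP|_]; last by rewrite muln0.
by rewrite -QP QG in PG.
Qed.

Lemma omega_le_Omega F : F \is monic -> (omega F <= Omega F)%N.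
Proof.
elim/factor_ind; first by rewrite /omega /Omega prime_divisors1 big_nil.
by move=> P e G pP e0 mG PG IH; rewrite omega_primeM// Omega_primeM//; lia.
Qed.

Lemma omega_eq0 F : F \is monic -> omega F = 0%N -> F = 1.
Proof.
elim/factor_ind => // P e G pP e0 mG PG IH.
by rewrite omega_primeM.
Qed.

End Factorization.

(** * Lists of monic polynomials and of primes of given degree, and sums over them *)

Section Lists.
Variable K : finFieldType.
Implicit Types (F G P Q : {poly K}).

Definition mon m : seq {poly K} := [seq polyn A | A <- enum (monic_deg K m)].

Lemma mem_mon F m : (F \in mon m) = (F \is monic) && (deg F == m).
Proof.
apply/mapP/andP => [[A + ->]|[mF /eqP dF]].
  rewrite mem_enum inE => /andP[mA sA]; split => //.
  by rewrite /deg (eqP sA).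
have sF : (size F <= m.+1)%N by rewrite size_deg// dF.
by exists (NPoly sF) => //; rewrite mem_enum inE /= mF size_deg// dF eqxx.
Qed.

Lemma mon_uniq m : uniq (mon m).
Proof.
have inj : injective (@polyn K m.+1) by move=> x y; exact: val_inj.
by rewrite (map_inj_uniq inj) enum_uniq.
Qed.

(** A monic polynomial of degree m is 'X^m plus an arbitrary remainder of smaller degree. *)
Lemma size_mon m : size (mon m) = (#|K| ^ m)%N.
Proof.
rewrite -(card_npoly K m) cardE -(size_map (fun A : {poly_m K} => 'X^m + polyn A)).
apply: perm_size; apply: uniq_perm; first exact: mon_uniq.
  have inj : injective (fun A : {poly_m K} => 'X^m + polyn A).
    by move=> x y /addrI; exact: val_inj.
  by rewrite (map_inj_uniq inj) enum_uniq.
move=> F; rewrite mem_mon; apply/andP/mapP => [[mF /eqP dF]|[A _ ->]].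
  have sA : (size (F - 'X^m)%R <= m)%N.
    apply/leq_sizeP => j; rewrite leq_eqVlt => /predU1P[<-|mj].
      have := mF; rewrite monicE /lead_coef size_deg// dF /= => /eqP h.
      by rewrite coefB h coefXn eqxx subrr.
    by rewrite coefB coefXn gtn_eqF// nth_default ?subr0// size_deg// dF.
  by exists (NPoly sA); rewrite ?mem_enum//= addrC subrK.
have sA : (size (polyn A) < size ('X^m : {poly K}))%N.
  by rewrite size_polyXn ltnS; exact: size_npoly.
split; first by rewrite monicE lead_coefDl// lead_coefXn.
by rewrite /deg size_polyDl// size_polyXn.
Qed.

Definition pr d : seq {poly K} := [seq P <- mon d | prime_poly P].

Definition prs n : seq {poly K} := flatten [seq pr d | d <- index_iota 1 n.+1].

Lemma mem_pr P d : (P \in pr d) = prime_poly P && (deg P == d).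
Proof.
rewrite mem_filter mem_mon; case pP: (prime_poly P) => //=.
by rewrite prime_monic.
Qed.

Lemma pr_uniq d : uniq (pr d).
Proof. exact: filter_uniq (mon_uniq d). Qed.

Lemma mem_prs P n : (P \in prs n) = prime_poly P && (deg P <= n)%N.
Proof.
apply/flatten_mapP/andP => [[d + ]|[pP Pn]].
  by rewrite mem_index_iota mem_pr ltnS => /andP[_ dn] /andP[pP /eqP Pd]; rewrite Pd.
exists (deg P); last by rewrite mem_pr pP eqxx.
by rewrite mem_index_iota ltnS Pn prime_deg_gt0.
Qed.

Lemma prs_uniq n : uniq (prs n).
Proof.
rewrite /prs; have : uniq (index_iota 1 n.+1) by exact: iota_uniq.
elim: (index_iota _ _) => //= d s IH /andP[ds us].
rewrite cat_uniq pr_uniq IH// andbT /=; apply/hasPn => P /flatten_mapP[d' d's].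
rewrite !mem_pr => /andP[pP /eqP Pd']; rewrite pP /=.
by apply: contraNneq ds => <-; rewrite Pd'.
Qed.

Section Sums.
Variable V : nmodType.
Implicit Type phi : {poly K} -> V.

Lemma sum_prs n (A : pred {poly K}) phi :
  \sum_(P <- prs n | A P) phi P = \sum_(1 <= d < n.+1) \sum_(P <- pr d | A P) phi P.
Proof.
rewrite /prs; elim: (index_iota _ _) => [|d s IH]; first by rewrite !big_nil.
by rewrite /= big_cat big_cons IH.
Qed.

Lemma sum_prs_deg n (h : nat -> V) :
  \sum_(P <- prs n) h (deg P) = \sum_(1 <= d < n.+1) h d *+ size (pr d).
Proof.
rewrite sum_prs; apply: eq_bigr => d _.
rewrite (eq_big_seq (fun=> h d)); first by rewrite big_const_seq count_predT iter_addr_0.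
by move=> P; rewrite mem_pr => /andP[_ /eqP ->].
Qed.

Lemma sum_prime_divisors F n phi : F \is monic -> (deg F <= n)%N ->
  \sum_(P <- prime_divisors F) phi P = \sum_(P <- prs n | P %| F) phi P.
Proof.
move=> mF Fn; rewrite -[RHS]big_filter; apply: perm_big; apply: uniq_perm.
- exact: prime_divisors_uniq.
- exact: filter_uniq (prs_uniq n).
move=> P; rewrite prime_divisorsP// mem_filter mem_prs andbC.
case PF: (P %| F) => //=; case pP: (prime_poly P) => //=.
by rewrite (leq_trans (prime_dvd_deg mF pP PF)).
Qed.

(** G -> P^e G is a bijection from the cofactors of degree m - e deg P. The test on degrees guards
    against truncated subtraction. *)
Lemma sum_mon_dvd P e m phi : prime_poly P ->
  \sum_(F <- mon m | P ^+ e %| F) phi F =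
  if (e * deg P <= m)%N then \sum_(G <- mon (m - e * deg P)) phi (P ^+ e * G) else 0.
Proof.
move=> pP; have mP := prime_monic pP; have mPe : P ^+ e \is monic by exact: monic_exp.
rewrite -big_filter; case: leqP => em; last first.
  rewrite big1_seq// => F /andP[_]; rewrite mem_filter mem_mon => /and3P[PF mF /eqP dF].
  have := dvdp_leq (monic_neq0 mF) PF.
  by rewrite !size_deg// ltnS degX// dF leqNgt em.
rewrite -[RHS](big_map (fun G => P ^+ e * G) xpredT); apply: perm_big; apply: uniq_perm.
- exact: filter_uniq (mon_uniq m).
- by rewrite map_inj_uniq ?mon_uniq//; apply: mulfI; exact: monic_neq0.
move=> F; rewrite mem_filter mem_mon; apply/and3P/mapP => [[PF mF /eqP dF]|[G + ->]].
  have [G FE] := dvdpP _ _ PF.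
  have mG : G \is monic by move: mF; rewrite FE monicMr.
  exists G; last by rewrite mulrC.
  by rewrite mem_mon mG /= -dF FE degM// degX// addnK.
rewrite mem_mon => /andP[mG /eqP dG]; split; first by rewrite dvdp_mulr.
  by rewrite monicMl.
by rewrite degM// degX// dG subnKC.
Qed.

Lemma sum_mon_multiplicity P e m phi : prime_poly P ->
  \sum_(F <- mon m | multiplicity P F == e) phi F =
  if (e * deg P <= m)%N then
    \sum_(G <- mon (m - e * deg P) | ~~ (P %| G)) phi (P ^+ e * G) else 0.
Proof.
move=> pP; have mP := prime_monic pP; have mPe : P ^+ e \is monic by exact: monic_exp.
have -> : \sum_(F <- mon m | multiplicity P F == e) phi F =
    \sum_(F <- mon m | P ^+ e %| F) (if multiplicity P F == e then phi F else 0).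
  rewrite -big_mkcondr big_seq_cond [RHS]big_seq_cond; apply: eq_bigl => F.
  rewrite mem_mon; case mF: (F \is monic) => //=; case: (deg F == m) => //=.
  by rewrite dvd_multiplicity//; case: eqP => [->|]; rewrite ?leqnn ?andbF.
rewrite sum_mon_dvd//; case: ifP => // _.
rewrite [RHS]big_mkcond; apply: eq_big_seq => G; rewrite mem_mon => /andP[mG _].
rewrite multiplicityM// multiplicityX// multiplicity_prime// eqxx muln1.
by rewrite -[X in _ == X]addn0 eqn_add2l -multiplicity_gt0// lt0n negbK.
Qed.

End Sums.

Lemma card_ge2 : (1 < #|K|)%N.
Proof. exact: card_finNzRing_gt1. Qed.

End Lists.

(** * Densities of primes and of polynomials with few prime factors *)

Section PrimeDensity.
Variables (R : realFieldType) (K : finFieldType).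
Implicit Types (F G P Q : {poly K}).

Local Notation q := (#|K|%:R : R).

Lemma q_ge2 : 2 <= q.
Proof. by rewrite ler_nat card_ge2. Qed.

Lemma q_gt0 : 0 < q.
Proof. by have := q_ge2; lra. Qed.

Lemma q_neq0 : q != 0.
Proof. by rewrite gt_eqF// q_gt0. Qed.

Lemma qX_gt0 n : 0 < q ^+ n.
Proof. by rewrite exprn_gt0// q_gt0. Qed.

Lemma qX_neq0 n : q ^+ n != 0.
Proof. by rewrite expf_neq0// q_neq0. Qed.

Definition pdens d : R := (size (pr K d))%:R / q ^+ d.

Lemma pdens_ge0 d : 0 <= pdens d.
Proof. by rewrite divr_ge0// ltW// qX_gt0. Qed.

Lemma sum_prs_pdens n (h : nat -> R) :
  \sum_(P <- prs K n) h (deg P) = \sum_(1 <= d < n.+1) pdens d * q ^+ d * h d.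
Proof.
rewrite sum_prs_deg; apply: eq_bigr => d _.
by rewrite /pdens divfK ?qX_neq0// mulr_natl.
Qed.

Lemma multiplicity_sum P F n : prime_poly P -> F \is monic -> (deg F <= n)%N ->
  (multiplicity P F)%:R = \sum_(1 <= e < n.+1 | P ^+ e %| F) 1 :> R.
Proof.
move=> pP mF Fn; have mP := prime_monic pP.
have mn : (multiplicity P F <= n)%N.
  apply: leq_trans Fn; have : P ^+ multiplicity P F %| F by rewrite dvd_multiplicity.
  move/dvdp_leq => /(_ (monic_neq0 mF)).
  rewrite !size_deg ?monic_exp// ltnS degX//.
  by have := prime_deg_gt0 pP; nia.
rewrite (eq_bigl (fun e => e <= multiplicity P F)%N); last first.
  by move=> e; rewrite dvd_multiplicity.
rewrite (big_cat_nat (n := (multiplicity P F).+1))//= [X in _ + X]big_nat_cond.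
rewrite [X in _ + X]big1 ?addr0; last by move=> e /andP[/andP[? ?] ?]; lia.
rewrite big_nat_cond (eq_bigl (fun e => 1 <= e < (multiplicity P F).+1)%N); last first.
  by move=> e; lia.
by rewrite -big_nat sumr_const_nat subn1.
Qed.

Lemma deg_sum F n : F \is monic -> (deg F <= n)%N ->
  (deg F)%:R = \sum_(P <- prs K n) \sum_(1 <= e < n.+1 | P ^+ e %| F) (deg P)%:R :> R.
Proof.
move=> mF Fn; rewrite {1}(deg_sum_multiplicity mF) natr_sum.
rewrite (sum_prime_divisors _ mF Fn) big_mkcond; apply: eq_big_seq => P.
rewrite mem_prs => /andP[pP _].
have E : \sum_(1 <= e < n.+1 | P ^+ e %| F) (deg P)%:R = (multiplicity P F * deg P)%:R :> R.
  rewrite natrM (multiplicity_sum pP mF Fn) big_distrl /=.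
  by apply: eq_bigr => e _; rewrite mul1r.
rewrite E; case: ifPn => // PF; move: PF; rewrite -multiplicity_gt0// lt0n negbK => /eqP ->.
by rewrite mul0n.
Qed.

(** Both sides are the total degree of the monic polynomials of degree N divided by q^N; on the
    left, every prime power dividing F contributes the degree of its prime. The bound B is kept
    apart from N so that the identities for N and N - 1 can be subtracted term by term. *)
Lemma pdens_sum N B : (N <= B)%N ->
  \sum_(1 <= d < B.+1) \sum_(1 <= e < B.+1 | (e * d <= N)%N)
     d%:R * pdens d * q ^+ d / q ^+ (e * d) = N%:R.
Proof.
move=> NB.
have H : \sum_(F <- mon K N) (deg F)%:R = N%:R * q ^+ N :> R.
  rewrite (eq_big_seq (fun=> N%:R)); last by move=> F; rewrite mem_mon => /andP[_ /eqP ->].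
  by rewrite big_const_seq count_predT size_mon iter_addr_0 -(mulr_natr N%:R) natrX.
apply: (mulIf (qX_neq0 N)); rewrite -H.
rewrite [RHS](eq_big_seq (fun F => \sum_(P <- prs K B) \sum_(1 <= e < B.+1 | P ^+ e %| F) (deg P)%:R)); last first.
  by move=> F; rewrite mem_mon => /andP[mF /eqP dF]; apply: deg_sum; rewrite ?dF.
rewrite exchange_big /=.
rewrite [RHS](eq_big_seq (fun P => \sum_(1 <= e < B.+1 | (e * deg P <= N)%N) (deg P)%:R * q ^+ N / q ^+ (e * deg P))); last first.
  move=> P; rewrite mem_prs => /andP[pP _].
  under eq_bigr => F _ do rewrite big_mkcond.
  rewrite exchange_big /= [RHS]big_mkcond; apply: eq_bigr => e _.
  rewrite -big_mkcond sum_mon_dvd//; case: ifP => // eN.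
  rewrite big_const_seq count_predT size_mon iter_addr_0 -(mulr_natr (deg P)%:R) natrX -mulrA; congr (_ * _).
  by rewrite -[in RHS](subnK eN) exprD mulfK ?qX_neq0.
rewrite (sum_prs_pdens B (fun d => \sum_(1 <= e < B.+1 | (e * d <= N)%N) d%:R * q ^+ N / q ^+ (e * d))).
rewrite big_distrl; apply: eq_bigr => d _ /=; rewrite big_distrl big_distrr /=.
by apply: eq_bigr => e _; ring.
Qed.

End PrimeDensity.

Section PrimeDensityBounds.
Variables (R : realFieldType) (K : finFieldType).
Local Notation q := (#|K|%:R : R).
Local Notation pdens := (@pdens R K).

Let q2 : 2 <= q := q_ge2 R K.
Let qX0 n : 0 < q ^+ n := qX_gt0 R K n.
Let qXn0 n : q ^+ n != 0 := qX_neq0 R K n.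

Let term d N := d%:R * pdens d * q ^+ d / q ^+ N.

Let term_ge0 d N : 0 <= term d N.
Proof.
rewrite /term divr_ge0 ?(ltW (qX0 N))// mulr_ge0 ?(ltW (qX0 d))//.
by rewrite mulr_ge0 ?pdens_ge0.
Qed.

(** In the difference of [pdens_sum] at N and at N - 1 only the pairs with e d = N survive. This is
    Gauss's formula: the sum over d dividing N of d times the number of primes of degree d is
    q^N. *)
Let pdens_divisors N : (0 < N)%N ->
  \sum_(1 <= d < N.+1) \sum_(1 <= e < N.+1 | (e * d == N)%N) term d N = 1.
Proof.
move=> N0; have := pdens_sum R K (leqnn N).
have := pdens_sum R K (leq_pred N).
set S1 := \sum_(_ <= _ < _) _; set S2 := \sum_(_ <= _ < _) _; set S3 := \sum_(_ <= _ < _) _.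
move=> h1 h2; have : S2 = S1 + S3.
  rewrite /S1 /S2 /S3 -big_split; apply: eq_bigr => d _ /=.
  rewrite [LHS]big_mkcond [X in _ = X + _]big_mkcond [X in _ = _ + X]big_mkcond -big_split.
  apply: eq_bigr => e _ /=; rewrite /term.
  case: (ltngtP (e * d) N) => eN.
  - by rewrite ifT ?addr0//; lia.
  - by rewrite ifF ?addr0//; lia.
  - by rewrite ifF ?add0r ?eN//; lia.
rewrite h1 h2 => h; have : N%:R = N.-1%:R + 1 :> R by rewrite natr1 prednK.
by rewrite h => /addrI.
Qed.

Let pdensE N : (0 < N)%N ->
  N%:R * pdens N = 1 - \sum_(1 <= d < N) \sum_(1 <= e < N.+1 | (e * d == N)%N) term d N.
Proof.
move=> N0; have := pdens_divisors N0; rewrite big_nat_recr//=.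
rewrite [X in _ + X](_ : _ = N%:R * pdens N); first lra.
rewrite (eq_bigl (fun e => e == 1%N)); last by move=> e; rewrite -{2}(mul1n N) eqn_pmul2r.
by rewrite big_nat1_eq; case: ifP => [_|]; [rewrite /term mulfK|lia].
Qed.

Lemma pdens_le d : (0 < d)%N -> d%:R * pdens d <= 1.
Proof.
move=> d0; rewrite pdensE// lerBlDr lerDl sumr_ge0// => i _.
by apply: sumr_ge0 => e _.
Qed.

Let geometric h : (0 < h)%N -> \sum_(1 <= d < h.+1) q ^+ d <= 2 * q ^+ h - 2.
Proof.
elim: h => // h IH _; rewrite big_nat_recr//=.
case: h IH => [_|h /(_ isT)]; first by rewrite big_geq// add0r expr1; move: q2; lra.
have := ler_wpM2r (ltW (qX0 h.+1)) q2; rewrite -exprS; lra.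
Qed.

Lemma pdens_ge d : (0 < d)%N -> 2^-1 <= d%:R * pdens d.
Proof.
move=> d0; rewrite pdensE//.
suff : \sum_(1 <= i < d) \sum_(1 <= e < d.+1 | (e * i == d)%N) term i d <= 2^-1 by lra.
have [d1|d2] := leqP d 1; first by rewrite big_geq//; lra.
have h0 : (0 < d./2)%N by lia.
apply: (@le_trans _ _ (\sum_(1 <= i < d./2.+1) q ^+ i / q ^+ d)).
  rewrite (big_cat_nat (n := d./2.+1)) /=; [|lia|lia].
  rewrite [X in _ + X]big_nat [X in _ + X]big1 ?addr0.
    rewrite big_nat [leRHS]big_nat; apply: ler_sum => i /andP[i0 ih].
    have ti : term i d <= q ^+ i / q ^+ d.
      rewrite /term ler_wpM2r ?invr_ge0 ?(ltW (qX0 _))// ler_piMl ?(ltW (qX0 _))//.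
      exact: pdens_le.
    rewrite big_mkcond /=.
    case: (boolP (i %| d)%N) => [/dvdnP[e de]|nid].
      have e0 : (0 < e)%N by case: e de d0 => // ->.
      rewrite -big_mkcond (eq_bigl (fun e' => e' == e)).
        by rewrite big_nat1_eq /=; case: ifP => // _; exact: le_trans (term_ge0 i d) ti.
      by move=> e'; rewrite de eqn_pmul2r.
    rewrite big1 ?divr_ge0 ?(ltW (qX0 _))// => e _; case: eqP => // eid.
    by move: nid; rewrite -eid dvdn_mull.
  move=> i /andP[i0 id]; rewrite big_nat_cond big1// => e /andP[/andP[e0 _] /eqP eid].
  exfalso; move: eid; have : (e >= 2)%N \/ e = 1%N by lia.
  by case=> [e2|->]; nia.
rewrite -big_distrl /= ler_pdivrMr//.
apply: le_trans (geometric h0) _.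
(* For d = 2 the claim is (q - 2)^2 >= 0, an equality at q = 2, so the term - 2 in [geometric]
   cannot be dropped. *)
have [->|d3] := eqVneq d 2%N.
  by rewrite /= expr1 expr2; have := sqr_ge0 (q - 2); lra.
have : q ^+ d./2.+1 <= q ^+ d.-1.
  by apply: ler_weXn2l; [move: q2; lra|lia].
have := ler_wpM2r (ltW (qX0 d./2)) q2; rewrite -exprS.
have := ler_wpM2r (ltW (qX0 d.-1)) q2; rewrite -exprS prednK//.
lra.
Qed.

End PrimeDensityBounds.

(** * Elementary comparisons of finite sums *)

Section SumLemmas.
Variable R : realFieldType.

Lemma sum_le_sub (I : eqType) (s t : seq I) (g : I -> R) : uniq s -> {subset s <= t} ->
  (forall i, 0 <= g i) -> \sum_(i <- s) g i <= \sum_(i <- t) g i.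
Proof.
move=> + + g0; elim: s t => [|i s IH] t us st.
  by rewrite big_nil sumr_ge0.
have it : i \in t by apply: st; rewrite mem_head.
case/andP: us => is_ us; rewrite big_cons (big_rem i it) /= lerD2l; apply: IH => // j js.
have jt : j \in t by apply: st; rewrite inE js orbT.
have := perm_mem (perm_to_rem it) j; rewrite jt inE => /esym/orP[/eqP ji|//].
by rewrite -ji js in is_.
Qed.

Lemma sum_mulSn_le (m e : nat) (g : nat -> R) : (0 < e)%N -> (forall i, 0 <= g i) ->
  \sum_(1 <= d < m.+1 | (e * d <= m)%N) g (m - e * d)%N <= \sum_(0 <= i < m) g i.
Proof.
move=> e0 g0; rewrite -big_filter -(big_map (fun d => m - e * d)%N xpredT).
apply: sum_le_sub => //.
  rewrite map_inj_in_uniq ?filter_uniq ?iota_uniq// => x y.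
  by rewrite !mem_filter !mem_index_iota => /andP[? ?] /andP[? ?]; nia.
move=> i /mapP[d]; rewrite mem_filter !mem_index_iota => /andP[? /andP[? ?]] ->.
by nia.
Qed.

Lemma sum_shift_le (x d : nat) (c : nat -> R) : (d <= x)%N -> (forall i, 0 <= c i) ->
  \sum_(0 <= i < x.+1) c (i + d)%N <= \sum_(0 <= m < (2 * x).+1 | (d <= m)%N) c m.
Proof.
move=> dx c0; rewrite -(big_map (fun i => i + d)%N xpredT) -[leRHS]big_filter.
apply: sum_le_sub => //.
  by rewrite map_inj_uniq ?iota_uniq// => a b; lia.
move=> i /mapP[a]; rewrite mem_filter !mem_index_iota => /andP[? ?] ->.
by lia.
Qed.

Lemma sum_arith_geom m : \sum_(1 <= e < m.+1) e%:R * (2 ^+ e.-1)^-1 <= 4 :> R.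
Proof.
(* The subtracted term is the exact tail of the series, whose sum is 4. *)
suff : \sum_(1 <= e < m.+1) e%:R * (2 ^+ e.-1)^-1 <= 4 - (2 * m%:R + 4) / 2 ^+ m :> R.
  move=> h; apply: le_trans h _; rewrite lerBlDr lerDl; apply: divr_ge0; last exact: exprn_ge0.
  by have := ler0n R m; lra.
elim: m => [|m IH]; first by rewrite big_geq// expr0; lra.
rewrite big_nat_recr//=; apply: le_trans (lerD IH (lexx _)) _.
rewrite exprS invfM -natr1; have : 0 < (2 ^+ m)^-1 :> R by rewrite invr_gt0 exprn_gt0.
by move: (2 ^+ m)^-1 => t t0; lra.
Qed.

End SumLemmas.

Lemma multiplicity_le_deg (K : finFieldType) (P F : {poly K}) : prime_poly P -> F \is monic ->
  (multiplicity P F <= deg F)%N.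
Proof.
move=> pP mF; have mP := prime_monic pP.
have : P ^+ multiplicity P F %| F by rewrite dvd_multiplicity.
move/dvdp_leq => /(_ (monic_neq0 mF)).
rewrite !size_deg ?monic_exp// ltnS degX//.
by have := prime_deg_gt0 pP; nia.
Qed.

Lemma mon0 (K : finFieldType) : mon K 0 = [:: 1].
Proof.
have : size (mon K 0) = 1%N by rewrite size_mon.
case E: (mon K 0) => [//|F [|//]] _; congr [:: _].
have : F \in mon K 0 by rewrite E mem_head.
by rewrite mem_mon => /andP[mF /eqP /(monic_deg0 mF)].
Qed.

Lemma omega1 (K : finFieldType) : omega (1 : {poly K}) = 0%N.
Proof. by rewrite /omega prime_divisors1. Qed.

(** * Densities of the polynomials with a given number of prime factors *)

Section Weights.
Variables (R : realFieldType) (K : finFieldType).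
Implicit Types (F G P Q : {poly K}).
Local Notation q := (#|K|%:R : R).
Local Notation pdens := (@pdens R K).

Let q2 : 2 <= q := q_ge2 R K.
Let q0 : 0 <= q. Proof. by move: q2; lra. Qed.
Let q1 : 1 <= q. Proof. by move: q2; lra. Qed.
Let qX0 n : 0 < q ^+ n := qX_gt0 R K n.
Let qXn0 n : q ^+ n != 0 := qX_neq0 R K n.

Definition wt j m : R := (\sum_(F <- mon K m | omega F == j) 1) / q ^+ m.

Lemma wt_ge0 j m : 0 <= wt j m.
Proof. by rewrite divr_ge0 ?sumr_ge0// ltW. Qed.

Lemma wtE0 j : wt j 0 = (j == 0%N)%:R.
Proof.
rewrite /wt mon0 expr0 divr1 big_cons big_nil omega1 eq_sym.
by case: eqP => _; rewrite ?addr0.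
Qed.

Lemma wt0E m : wt 0 m = (m == 0%N)%:R.
Proof.
have [->|m0] := eqVneq m 0%N; first by rewrite wtE0.
rewrite /wt big1_seq ?mul0r// => F /andP[/eqP oF]; rewrite mem_mon => /andP[mF dF].
by move: dF; rewrite (omega_eq0 mF oF) deg1 eq_sym (negbTE m0).
Qed.

Lemma deg_sum_exact F n : F \is monic -> (deg F <= n)%N ->
  (deg F)%:R = \sum_(P <- prs K n) \sum_(1 <= e < n.+1 | multiplicity P F == e)
     (e * deg P)%:R :> R.
Proof.
move=> mF Fn; rewrite {1}(deg_sum_multiplicity mF) natr_sum.
rewrite (sum_prime_divisors _ mF Fn) big_mkcond; apply: eq_big_seq => P.
rewrite mem_prs => /andP[pP _].
rewrite (eq_bigl (fun e => e == multiplicity P F)); last by move=> e; rewrite eq_sym.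
rewrite big_nat1_eq ltnS (leq_trans (multiplicity_le_deg pP mF) Fn) andbT.
by rewrite multiplicity_gt0.
Qed.

(** Exact multiplicity makes the cofactor prime to P, so it has exactly one prime factor fewer. *)
Lemma sum_omega_multiplicity P e j m : prime_poly P -> (0 < e)%N ->
  \sum_(F <- mon K m | (omega F == j.+1) && (multiplicity P F == e)) 1 =
  if (e * deg P <= m)%N then
    \sum_(G <- mon K (m - e * deg P) | (omega G == j) && ~~ (P %| G)) 1 else 0 :> R.
Proof.
move=> pP e0; rewrite big_mkcondl /= sum_mon_multiplicity//; case: ifP => // em.
rewrite [RHS]big_mkcondl /= big_seq_cond [RHS]big_seq_cond; apply: eq_bigr => G.
by rewrite mem_mon => /andP[/andP[mG _] PG]; rewrite omega_primeM.
Qed.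

(* Expand [m = deg F] over the prime power factors of [F]. *)
Lemma wt_recursion j m :
  m%:R * wt j.+1 m <= 4 * \sum_(0 <= i < m) wt j i.
Proof.
rewrite /wt mulrA ler_pdivrMr//.
have -> : m%:R * (\sum_(F <- mon K m | omega F == j.+1) 1) =
    \sum_(F <- mon K m | omega F == j.+1) (deg F)%:R :> R.
  rewrite big_distrr /= big_seq_cond [RHS]big_seq_cond; apply: eq_bigr => F.
  by rewrite mem_mon => /andP[/andP[_ /eqP ->] _]; rewrite mulr1.
have -> : \sum_(F <- mon K m | omega F == j.+1) (deg F)%:R =
   \sum_(P <- prs K m) \sum_(1 <= e < m.+1) (e * deg P)%:R *
     \sum_(F <- mon K m | (omega F == j.+1) && (multiplicity P F == e)) 1 :> R.
  rewrite big_seq_cond (eq_bigr (fun F => \sum_(P <- prs K m)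
     \sum_(1 <= e < m.+1 | multiplicity P F == e) (e * deg P)%:R)); last first.
    move=> F; rewrite mem_mon => /andP[/andP[mF /eqP dF] _].
    by apply: deg_sum_exact; rewrite ?dF.
  rewrite -big_seq_cond exchange_big; apply: eq_bigr => P _ /=.
  under eq_bigr => F _ do rewrite big_mkcond.
  rewrite exchange_big; apply: eq_bigr => e _ /=.
  rewrite -big_mkcondr big_distrr /=; apply: eq_bigr => F _; by rewrite mulr1.
apply: (@le_trans _ _ (\sum_(P <- prs K m) \sum_(1 <= e < m.+1 | (e * deg P <= m)%N)
    (e * deg P)%:R * (wt j (m - e * deg P) * q ^+ (m - e * deg P)))).
  rewrite big_seq [leRHS]big_seq; apply: ler_sum => P.
  rewrite mem_prs => /andP[pP _].
  rewrite [leRHS]big_mkcond /= big_nat [leRHS]big_nat; apply: ler_sum => e /andP[e0 _].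
  rewrite sum_omega_multiplicity//; case: ifP => _; last by rewrite mulr0.
  rewrite ler_wpM2l// /wt divfK// big_mkcondr /=; apply: ler_sum => G _.
  by case: ifP.
rewrite (sum_prs_pdens K m (fun d => \sum_(1 <= e < m.+1 | (e * d <= m)%N)
    (e * d)%:R * (wt j (m - e * d) * q ^+ (m - e * d)))).
(* Since d [pdens] d <= 1 and q^((e-1) d) >= 2^(e-1), an e-th power of a prime costs at most e /
   2^(e-1); the sum of these over e is the constant 4. *)
apply: (@le_trans _ _ (\sum_(1 <= d < m.+1) \sum_(1 <= e < m.+1 | (e * d <= m)%N)
    e%:R * (2 ^+ e.-1)^-1 * wt j (m - e * d) * q ^+ m)).
  rewrite big_nat [leRHS]big_nat; apply: ler_sum => d /andP[d0 _].
  rewrite big_distrr /= big_nat_cond [leRHS]big_nat_cond; apply: ler_sum.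
  move=> e /andP[/andP[e0 _] em].
  have qm : q ^+ d * q ^+ (m - e * d) * q ^+ (e.-1 * d) = q ^+ m.
    by rewrite -!exprD; congr (_ ^+ _); nia.
  have qe : (2 : R) ^+ e.-1 <= q ^+ (e.-1 * d).
    apply: (@le_trans _ _ (q ^+ e.-1)); first by rewrite lerXn2r ?nnegrE ?q0.
    by apply: ler_weXn2l; [exact: q1|nia].
  have pe : 0 < (2 : R) ^+ e.-1 by rewrite exprn_gt0.
  have dp := pdens_le R K d0.
  have w0 := wt_ge0 j (m - e * d).
  rewrite -qm natrM.
  have -> : pdens d * q ^+ d * (e%:R * d%:R * (wt j (m - e * d) * q ^+ (m - e * d))) =
     (e%:R * wt j (m - e * d) * q ^+ d * q ^+ (m - e * d)) * (d%:R * pdens d) by ring.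
  have -> : e%:R * (2 ^+ e.-1)^-1 * wt j (m - e * d) *
      (q ^+ d * q ^+ (m - e * d) * q ^+ (e.-1 * d)) =
    (e%:R * wt j (m - e * d) * q ^+ d * q ^+ (m - e * d)) * (q ^+ (e.-1 * d) / 2 ^+ e.-1) by ring.
  apply: ler_wpM2l.
    by rewrite mulr_ge0 ?(ltW (qX0 _))// mulr_ge0 ?(ltW (qX0 _))// mulr_ge0.
  by apply: le_trans dp _; rewrite ler_pdivlMr// mul1r.
under eq_bigr do rewrite big_mkcond.
rewrite exchange_big /=.
set W := \sum_(0 <= i < m) wt j i.
have W0 : 0 <= W by apply: sumr_ge0 => i _; exact: wt_ge0.
apply: (@le_trans _ _ (\sum_(1 <= e < m.+1) e%:R * (2 ^+ e.-1)^-1 * (W * q ^+ m))).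
  rewrite big_nat [leRHS]big_nat; apply: ler_sum => e /andP[e0 _].
  rewrite -big_mkcond /=.
  under eq_bigr do rewrite -mulrA.
  rewrite -big_distrr /= ler_wpM2l ?mulr_ge0 ?invr_ge0 ?exprn_ge0//.
  rewrite -big_distrl /= ler_wpM2r ?(ltW (qX0 m))//.
  by apply: sum_mulSn_le => //; exact: wt_ge0.
rewrite -big_distrl /= mulrA ler_wpM2r ?(ltW (qX0 m))// ler_wpM2r//.
exact: sum_arith_geom.
Qed.

Definition cumwt j n : R := \sum_(0 <= i < n.+1) wt j i.

(** The analogue of the Mertens sum of 1/|P| over the primes of degree at most n; it lies between
    half the harmonic sum and the harmonic sum. *)
Definition cumpdens n : R := \sum_(1 <= d < n.+1) pdens d.

Lemma omega_sum F n : F \is monic -> (deg F <= n)%N ->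
  (omega F)%:R = \sum_(P <- prs K n | P %| F) 1 :> R.
Proof.
move=> mF Fn; rewrite -(sum_prime_divisors _ mF Fn).
by rewrite big_const_seq count_predT iter_addr_0.
Qed.

Lemma omega_sum_ge F n : F \is monic ->
  \sum_(P <- prs K n | P %| F) 1 <= (omega F)%:R :> R.
Proof.
move=> mF; rewrite (omega_sum mF (leq_maxr n (deg F))) -big_filter -[leRHS]big_filter.
apply: sum_le_sub => //; first by rewrite filter_uniq// prs_uniq.
move=> P; rewrite !mem_filter !mem_prs => /and3P[-> -> Pn] /=.
by rewrite leq_max Pn.
Qed.

Lemma sum_prs_inv n : \sum_(P <- prs K n) (q ^+ deg P)^-1 = cumpdens n.
Proof.
rewrite (sum_prs_pdens K n (fun d => (q ^+ d)^-1)); apply: eq_bigr => d _.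
by rewrite mulfK.
Qed.

(* Multiply polynomials with [j] prime factors by a new prime of degree at most [x]. *)
Lemma cumwt_lower j x :
  (cumpdens x - j%:R) * cumwt j x <= j.+1%:R * cumwt j.+1 (2 * x).
Proof.
pose A P i : R := \sum_(G <- mon K i | (omega G == j) && ~~ (P %| G)) 1.
have A0 P i : 0 <= A P i by exact: sumr_ge0.
apply: (@le_trans _ _ (\sum_(0 <= i < x.+1) \sum_(P <- prs K x) A P i / q ^+ (i + deg P))).
  rewrite big_distrr /=; apply: ler_sum => i _.
  have -> : \sum_(P <- prs K x) A P i / q ^+ (i + deg P) =
     \sum_(G <- mon K i | omega G == j) \sum_(P <- prs K x | ~~ (P %| G)) (q ^+ (i + deg P))^-1.
    under eq_bigr do rewrite /A big_mkcondr big_distrl /=.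
    rewrite exchange_big; apply: eq_bigr => G _ /=; rewrite [RHS]big_mkcond.
    by apply: eq_bigr => P _; case: ifP; rewrite ?mul0r ?mul1r.
  rewrite /wt mulrA mulrC big_distrr /= big_distrr /= big_seq_cond [leRHS]big_seq_cond.
  apply: ler_sum => G; rewrite mem_mon mulr1 => /andP[/andP[mG _] /eqP oG].
  have -> : \sum_(P <- prs K x | ~~ (P %| G)) (q ^+ (i + deg P))^-1 =
      (q ^+ i)^-1 * \sum_(P <- prs K x | ~~ (P %| G)) (q ^+ deg P)^-1.
    by rewrite big_distrr; apply: eq_bigr => P _; rewrite exprD invfM.
  (* The primes dividing G are lost. There are at most j of them, each of weight q^(- deg P) <=
     1. *)
  rewrite ler_wpM2l ?invr_ge0 ?(ltW (qX0 _))// -sum_prs_inv (bigID (fun P => P %| G)) /=.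
  rewrite lerBlDr addrC lerD2l -oG; apply: le_trans (omega_sum_ge x mG).
  apply: ler_sum => P _; by rewrite invf_le1// exprn_ege1 ?q1.
rewrite exchange_big /=.
apply: (@le_trans _ _ (\sum_(P <- prs K x) \sum_(0 <= m < (2 * x).+1 | (deg P <= m)%N)
    A P (m - deg P)%N / q ^+ m)).
  rewrite big_seq [leRHS]big_seq; apply: ler_sum => P; rewrite mem_prs => /andP[pP Px].
  have c0 i : 0 <= A P (i - deg P)%N / q ^+ i by rewrite divr_ge0 ?(ltW (qX0 _)).
  apply: le_trans _ (sum_shift_le Px c0) => /=.
  by under [leRHS]eq_bigr do rewrite addnK.
under eq_bigr do rewrite big_mkcond.
rewrite exchange_big /= /cumwt [leRHS]big_distrr /=; apply: ler_sum => m _.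
rewrite -natr1 /wt mulrA ler_pdivlMr// big_distrl /=.
(* A given F = P G arises at most once for each of its j + 1 prime factors. *)
apply: (@le_trans _ _ (\sum_(P <- prs K x) \sum_(F <- mon K m | (omega F == j.+1) && (multiplicity P F == 1%N)) 1)).
  rewrite big_seq [leRHS]big_seq; apply: ler_sum => P; rewrite mem_prs => /andP[pP _].
  rewrite sum_omega_multiplicity// mul1n; case: ifP => _; last by rewrite mul0r.
  by rewrite divfK.
under [leLHS]eq_bigr do rewrite big_mkcondr.
rewrite exchange_big big_distrr /= big_seq_cond [leRHS]big_seq_cond; apply: ler_sum => F.
rewrite mem_mon mulr1 => /andP[/andP[mF _] /eqP oF].
rewrite natr1 -oF; apply: le_trans (omega_sum_ge x mF).
rewrite [leRHS]big_mkcond big_seq [leRHS]big_seq; apply: ler_sum => P.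
rewrite mem_prs => /andP[pP _]; case: eqP => [m1|_]; last by case: ifP.
by rewrite -multiplicity_gt0// m1.
Qed.

End Weights.

(** * Growth of abstract sequences that satisfy the recursion and the lower bound of the weights *)

Section WeightSequences.
Variable R : realFieldType.

Lemma geometric_le (x : R) m : 0 <= x -> x <= 2^-1 -> \sum_(1 <= i < m.+1) x ^+ i <= 2 * x.
Proof.
move=> x0 x2; suff : \sum_(1 <= i < m.+1) x ^+ i <= 2 * x - 2 * (x * x ^+ m).
  move=> h; apply: le_trans h _; rewrite lerBlDr lerDl mulr_ge0// mulr_ge0// exprn_ge0//.
elim: m => [|m IH]; first by rewrite big_geq// expr0 mulr1; lra.
rewrite big_nat_recr//=; apply: le_trans (lerD IH (lexx _)) _.
by rewrite exprS; have := ler_wpM2l (mulr_ge0 x0 (exprn_ge0 m x0)) x2; lra.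
Qed.

Variables (w : nat -> nat -> R).
Hypothesis w_ge0 : forall j m, 0 <= w j m.
Hypothesis w0E : forall m, w 0 m = (m == 0%N)%:R.
Hypothesis wE0 : forall j, w j 0 = (j == 0%N)%:R.
Hypothesis w_rec : forall j m, m%:R * w j.+1 m <= 4 * \sum_(0 <= i < m) w j i.

Local Notation W j n := (\sum_(0 <= i < n.+1) w j i).

Lemma W_ge0 j n : 0 <= W j n.
Proof. exact: sumr_ge0. Qed.

Lemma W_mono j m n : (m <= n)%N -> W j m <= W j n.
Proof.
move=> mn; rewrite (@big_cat_nat _ _ _ m.+1 0 n.+1)//= lerDl.
by rewrite big_seq; apply: sumr_ge0.
Qed.

Lemma W0E n : W 0 n = 1.
Proof.
rewrite big_nat_recl//= w0E eqxx big1 ?addr0// => i _; by rewrite w0E.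
Qed.

Lemma w_rec_W j m n : (m <= n.+1)%N -> m%:R * w j.+1 m <= 4 * W j n.
Proof.
case: m => [|m] mn; first by rewrite mul0r mulr_ge0// W_ge0.
by apply: le_trans (w_rec j m.+1) _; rewrite ler_wpM2l//; exact: W_mono.
Qed.

(** By the recursion each of the 7 n terms with n < m <= 8 n is at most 4 / n times the last sum,
    and 28 = 7 * 4. *)
Lemma W_increment j n : (0 < n)%N -> W j.+1 (8 * n) <= W j.+1 n + 28 * W j (8 * n).
Proof.
move=> n0; rewrite (@big_cat_nat _ _ _ n.+1 0 (8 * n).+1)//=; last by lia.
rewrite lerD2l.
apply: (@le_trans _ _ (\sum_(n.+1 <= m < (8 * n).+1) 4 * W j (8 * n) / n%:R)).
  rewrite big_nat [leRHS]big_nat; apply: ler_sum => m /andP[nm m8].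
  rewrite ler_pdivlMr ?ltr0n// mulrC; apply: (@le_trans _ _ (m%:R * w j.+1 m)).
    by rewrite ler_wpM2r// ler_nat ltnW.
  by apply: w_rec_W; lia.
rewrite sumr_const_nat (_ : ((8 * n).+1 - n.+1 = 7 * n)%N); last by lia.
rewrite -[leLHS]mulr_natr natrM mulrCA mulrAC; set v := W j (8 * n).
have n0' : n%:R != 0 :> R by rewrite pnatr_eq0 -lt0n.
by rewrite -mulrA mulfV// ; lra.
Qed.

(* [tilt m] is of order [m ^ (1/3)], as in Rankin's method. *)
Fixpoint tilt (m : nat) : R :=
  if m is m'.+1 then tilt m' * (1 + (3 * m'.+1%:R)^-1) else 1.

Lemma tilt_gt0 m : 0 < tilt m.
Proof.
elim: m => //= m IH; rewrite mulr_gt0// addr_gt0// invr_gt0 mulr_gt0// ltr0n.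
Qed.

(** With 12 = 4 * 3 the recursion reproduces exactly the factor 1 + 1/(3 (m + 1)) by which [tilt]
    grows. *)
Lemma W_le_tilt j m : W j m <= 12 ^+ j * tilt m.
Proof.
elim: j m => [|j IH] m.
  rewrite W0E expr0 mul1r; elim: m => //= m IHm.
  rewrite (le_trans IHm)// ler_peMr ?(ltW (tilt_gt0 _))// lerDl invr_ge0.
  by rewrite mulr_ge0.
elim: m => [|m IHm].
  by rewrite big_nat1 wE0 /= mulr1 exprn_ge0.
rewrite big_nat_recr//=; apply: le_trans (lerD IHm (lexx _)) _.
have m0 : 0 < m.+1%:R :> R by rewrite ltr0n.
have : w j.+1 m.+1 <= 4 * (12 ^+ j * tilt m) / m.+1%:R.
  rewrite ler_pdivlMr// mulrC; apply: le_trans (w_rec j m.+1) _.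
  by rewrite ler_wpM2l.
move=> h; apply: le_trans (lerD (lexx _) h) _.
rewrite exprS invfM; set a := 12 ^+ j; set t := tilt m; set y := m.+1%:R^-1.
by rewrite le_eqVlt; apply/orP; left; apply/eqP; field.
Qed.

(** The terms decay like m^(-4/3): the exponent 1/3 of [tilt] is below 1/2, which makes the squares
    summable. The proof telescopes against 9 tilt(M)^2 / (M + 1). *)
Lemma sum_tilt M : \sum_(1 <= m < M.+1) tilt m.-1 ^+ 2 / m%:R ^+ 2 <= 9.
Proof.
suff : \sum_(1 <= m < M.+1) tilt m.-1 ^+ 2 / m%:R ^+ 2 <= 9 - 9 * tilt M ^+ 2 / M.+1%:R.
  move=> h; apply: le_trans h _; rewrite lerBlDr lerDl divr_ge0//.
  by rewrite mulr_ge0// sqr_ge0.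
elim: M => [|M IH]; first by rewrite big_geq// /= expr1n mulr1 divr1 subrr.
rewrite big_nat_recr//=; apply: le_trans (lerD IH (lexx _)) _.
set t := tilt M; set x := M.+1%:R : R.
have x1 : 1 <= x by rewrite /x ler1n.
have -> : M.+2%:R = x + 1 :> R by rewrite /x -natr1.
clearbody x t.
have x0 : x != 0 by rewrite gt_eqF//; lra.
have x10 : x + 1 != 0 by rewrite gt_eqF//; lra.
rewrite -subr_ge0.
have -> : 9 - 9 * (t * (1 + (3 * x)^-1)) ^+ 2 / (x + 1) - (9 - 9 * t ^+ 2 / x + t ^+ 2 / x ^+ 2) =
  t ^+ 2 * (2 * x - 2) / (x ^+ 2 * (x + 1)).
  by field; rewrite x0 x10.
rewrite divr_ge0//.
  by rewrite mulr_ge0 ?sqr_ge0//; lra.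
by rewrite mulr_ge0 ?sqr_ge0//; lra.
Qed.

(** The recursion gives w (i + 1) m <= 4 * 12^i tilt(m - 1) / m, and 16 * 9 = 144. Uniformity in M
    is the point: these squares count the pairs of equal degree in the second moment of V. *)
Lemma sum_w_sqr i M : \sum_(0 <= m < M.+1) w i.+1 m ^+ 2 <= 144 ^+ i.+1.
Proof.
rewrite big_nat_recl//= wE0 /= expr0n add0r.
rewrite -(big_add1 _ _ 0 M.+1 xpredT (fun m => w i.+1 m ^+ 2)).
have aa : 0 <= 16 * (12 ^+ i) ^+ 2 :> R by rewrite mulr_ge0 ?sqr_ge0.
apply: (@le_trans _ _ (\sum_(1 <= m < M.+1) 16 * (12 ^+ i) ^+ 2 * (tilt m.-1 ^+ 2 / m%:R ^+ 2))).
  rewrite big_nat [leRHS]big_nat; apply: ler_sum => -[//|m] /andP[_ _] /=.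
  have m0 : 0 < m.+1%:R :> R by rewrite ltr0n.
  have h : w i.+1 m.+1 <= 4 * (12 ^+ i * tilt m) / m.+1%:R.
    rewrite ler_pdivlMr// mulrC; apply: le_trans (w_rec i m.+1) _.
    by rewrite ler_wpM2l// W_le_tilt.
  have E (a t x : R) : 16 * a ^+ 2 * (t ^+ 2 / x ^+ 2) = (4 * (a * t) / x) ^+ 2.
    by rewrite !exprMn exprVn; ring.
  rewrite E.
  by apply: lerXn2r => //; rewrite nnegrE ?w_ge0// (le_trans _ h).
rewrite -big_distrr /=; apply: le_trans (ler_wpM2l aa (sum_tilt M)) _.
have -> : 144 ^+ i.+1 = 144 * (12 ^+ i) ^+ 2 :> R.
  by rewrite exprS -exprM mulnC exprM; congr (_ * _ ^+ _); ring.
by have := sqr_ge0 ((12 : R) ^+ i); lra.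
Qed.

Variables (h : R) (n : nat).
Hypothesis n_gt0 : (0 < n)%N.
Hypothesis W_low : forall j, (h - j%:R) * W j n <= j.+1%:R * W j.+1 (2 * n).

(** If W j at most doubles from n to 8 n, then [W_low] and h - j >= 112 (j + 1) give W (j + 1) (8 n)
    >= 56 W j (8 n). The increment 28 W j (8 n) is then at most half of W (j + 1) (8 n), which
    therefore at most doubles too. This is the origin of 113 = 2 * 56 + 1. *)
Lemma W_doubling j : 113 * j%:R <= h -> W j (8 * n) <= 2 * W j n.
Proof.
elim: j => [|j IH] jh; first by rewrite !W0E; lra.
have jR : j.+1%:R = j%:R + 1 :> R by rewrite -natr1.
have j0 : 0 <= j%:R :> R by [].
have H1 : W j (8 * n) <= 2 * W j n by apply: IH; rewrite jR in jh; lra.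
have H2 := W_increment j n_gt0.
have H3 := W_low j.
have H4 : W j.+1 (2 * n) <= W j.+1 (8 * n) by apply: W_mono; lia.
move: H1 H2 H3 H4; rewrite jR in jh *.
move: (W_ge0 j (8 * n)) (W_ge0 j.+1 (8 * n)).
move: (W j (8 * n)) (W j n) (W j.+1 (8 * n)) (W j.+1 n) (W j.+1 (2 * n)) => a b c d e a0 c0 H1 H2 H3 H4.
have H5 : (h - j%:R) * a <= 2 * (j%:R + 1) * c.
  have hj : 0 <= h - j%:R by lra.
  have := ler_wpM2l hj H1.
  have j10 : 0 <= j%:R + 1 :> R by lra.
  have := ler_wpM2l j10 H4; lra.
have H6 : 112 * (j%:R + 1) * a <= (h - j%:R) * a by rewrite ler_wpM2r//; lra.
have H7 : 56 * a <= c.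
  have jp : 0 < 2 * (j%:R + 1) :> R by lra.
  by rewrite -(ler_pM2l jp); lra.
lra.
Qed.

(** One factor 2 comes from lowering 8 n to n, where [W_low] applies, another from h - j >= h /
    2. *)
Lemma W_step j : 113 * j.+1%:R <= h -> W j (8 * n) <= 4 * j.+1%:R / h * W j.+1 (2 * n).
Proof.
move=> jh; have jR : j.+1%:R = j%:R + 1 :> R by rewrite -natr1.
have j0 : 0 <= j%:R :> R by [].
have H1 : W j (8 * n) <= 2 * W j n by apply: W_doubling; rewrite jR in jh; lra.
have H3 := W_low j; rewrite jR in jh H3 *.
have h0 : 0 < h by lra.
rewrite mulrAC ler_pdivlMr//; move: H1 H3 (W_ge0 j n).
move: (W j (8 * n)) (W j n) (W j.+1 (2 * n)) => a b c H1 H3 b0.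
have : h * b <= 2 * ((h - j%:R) * b).
  rewrite mulrA ler_wpM2r//; lra.
have := ler_wpM2l (ltW h0) H1; lra.
Qed.

Variables (k : nat) (eps : R).
Hypothesis kh : 113 * k.+1%:R <= h.
Hypothesis epsE : eps = 4 * k.+1%:R / h.

Let h_gt0 : 0 < h.
Proof. by apply: lt_le_trans kh; rewrite mulr_gt0// ltr0n. Qed.

Lemma eps_ge0 : 0 <= eps.
Proof. by rewrite epsE divr_ge0 ?mulr_ge0// ltW. Qed.

Lemma eps_le : eps <= 4 / 113.
Proof. by rewrite epsE ler_pdivrMr//; move: kh; lra. Qed.

Lemma W_chain8 i : (i < k)%N -> W (k - i.+1) (8 * n) <= eps ^+ i.+1 * W k (2 * n).
Proof.
have step a : (a.+1 <= k)%N -> W a (8 * n) <= eps * W a.+1 (2 * n).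
  move=> ak; apply: le_trans (W_step _) _.
    by apply: le_trans kh; rewrite ler_wpM2l// ler_nat; lia.
  rewrite epsE ler_wpM2r ?W_ge0// ler_wpM2r ?invr_ge0 ?(ltW h_gt0)//.
  by rewrite ler_wpM2l// ler_nat ltnS ltnW.
elim: i => [|i IH] ik.
  rewrite expr1; have := step (k - 1)%N; rewrite (_ : (k - 1).+1 = k); last by lia.
  by apply; lia.
apply: le_trans (step (k - i.+2)%N _) _; first by lia.
rewrite (_ : (k - i.+2).+1 = k - i.+1)%N; last by lia.
rewrite [eps ^+ i.+2]exprS -[leRHS]mulrA; apply: ler_wpM2l; first exact: eps_ge0.
apply: le_trans (IH _); last by lia.
by apply: W_mono; lia.
Qed.

Lemma W_chain2 i : (i <= k)%N -> W (k - i) (2 * n) <= eps ^+ i * W k (2 * n).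
Proof.
case: i => [|i] ik; first by rewrite subn0 expr0 mul1r.
by apply: le_trans (W_chain8 ik); apply: W_mono; lia.
Qed.

Lemma W_ge1 : 1 <= W k (2 * n).
Proof.
have := W_chain2 (leqnn k); rewrite subnn W0E => h1; apply: le_trans h1 _.
rewrite ler_piMl ?W_ge0// exprn_ile1 ?eps_ge0//.
by apply: le_trans eps_le _; lra.
Qed.

(** Cofactors of degree above n are rare: their weight is bounded by that of polynomials with one
    prime factor fewer, which is smaller by a factor [eps]. *)
Lemma W_middle : W k (8 * n) - W k n <= 28 * eps * W k (2 * n).
Proof.
case: (posnP k) => [->|k0]; first by rewrite !W0E subrr mulr1 mulr_ge0 ?eps_ge0.
have := W_increment k.-1 n_gt0; rewrite prednK//.
have := W_chain8 k0; rewrite expr1 subn1; lra.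
Qed.

(** This bounds the polynomials of degree N with at most k prime factors, where k + 1 are wanted.
    The recursion passes from w j to W (j - 1), which is [eps]^(k + 1 - j) times W k at most; the
    series is geometric. *)
Lemma sum_w_lower N : (N <= 8 * n)%N -> 
  N%:R * \sum_(1 <= j < k.+1) w j N <= 8 * eps * W k (2 * n).
Proof.
move=> N8; rewrite big_distrr /=.
apply: (@le_trans _ _ (\sum_(1 <= j < k.+1) 4 * (eps ^+ (k.+1 - j) * W k (2 * n)))).
  rewrite big_nat [leRHS]big_nat; apply: ler_sum => -[//|j] /andP[_ jk].
  apply: (@le_trans _ _ (4 * W j (8 * n))); first by apply: w_rec_W; lia.
  rewrite ler_wpM2l//; have ik : (k - j.+1 < k)%N by lia.
  have := W_chain8 ik; rewrite (_ : k - (k - j.+1).+1 = j)%N; last by lia.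
  by rewrite (_ : (k - j.+1).+1 = k.+1 - j.+1)%N; last by lia.
rewrite -big_distrr /= -big_distrl /= mulrA; apply: ler_wpM2r; first exact: W_ge0.
rewrite big_nat_rev /= add1n.
rewrite (eq_big_nat _ _ (F2 := fun i => eps ^+ i)); last first.
  by move=> i /andP[i0 ik]; congr (_ ^+ _); lia.
have := geometric_le k eps_ge0 (le_trans eps_le _); move/(_ ltac:(lra)); lra.
Qed.

(** Giving up i prime factors in two of the polynomials costs [eps]^(2 i), and [sum_w_sqr] returns
    144^i; the hypothesis bounds the ratio of the geometric series by 1/2. *)
Lemma sum_quadruple_weight : 144 * eps ^+ 2 <= 2^-1 ->
  \sum_(1 <= i < k.+1) W (k - i) (2 * n) ^+ 2 * \sum_(0 <= m < (2 * n).+1) w i m ^+ 2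
  <= 288 * eps ^+ 2 * W k (2 * n) ^+ 2.
Proof.
move=> e2.
apply: (@le_trans _ _ (\sum_(1 <= i < k.+1) (144 * eps ^+ 2) ^+ i * W k (2 * n) ^+ 2)).
  rewrite big_nat [leRHS]big_nat; apply: ler_sum => -[//|i] /andP[_ ik].
  have -> : (144 * eps ^+ 2) ^+ i.+1 * W k (2 * n) ^+ 2 =
      (eps ^+ i.+1 * W k (2 * n)) ^+ 2 * 144 ^+ i.+1.
    by rewrite [in LHS]exprMn [in RHS]exprMn -!exprM (mulnC 2); ring.
  apply: ler_pM; first exact: sqr_ge0.
  - by apply: sumr_ge0 => m _; exact: sqr_ge0.
  - apply: lerXn2r; rewrite ?nnegrE ?W_ge0//.
      by rewrite mulr_ge0 ?W_ge0// exprn_ge0// eps_ge0.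
    exact: W_chain2.
  - exact: sum_w_sqr.
rewrite -big_distrl /= ler_wpM2r ?sqr_ge0//.
have e0 : 0 <= 144 * eps ^+ 2 by rewrite mulr_ge0 ?sqr_ge0.
by apply: le_trans (geometric_le k e0 e2) _; lra.
Qed.

End WeightSequences.

(** * The dominant part of the sums *)

Lemma quartic_le_exp2 m : (m ^ 4 <= 32 * 2 ^ m)%N.
Proof.
have [m3|] := leqP m 6; first by case: m m3 => [|[|[|[|[|[|[|]]]]]]].
elim: m => // m IH; rewrite ltnS => m3.
have [m4|m4] := leqP m 6; first by have -> : m = 6%N by lia.
have {}IH := IH m4; rewrite [(2 ^ m.+1)%N]expnS.
suff : (m.+1 ^ 4 <= 2 * m ^ 4)%N by lia.
(* (8/7)^2 < 1.33 and 1.33^2 < 2, so the induction runs from m = 7 on. *)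
have h : (m.+1 ^ 2 * 100 <= 133 * m ^ 2)%N by nia.
have : ((m.+1 ^ 2 * 100) ^ 2 <= (133 * m ^ 2) ^ 2)%N by rewrite leq_exp2r.
have sq a : ((a ^ 2) ^ 2 = a ^ 4)%N by rewrite -expnM.
rewrite [((_ * 100) ^ 2)%N]expnMn [((133 * _) ^ 2)%N]expnMn !sq => h2; lia.
Qed.

(** The difference of the two sides is a (N - a - 1). *)
Lemma leq_mul_sub a N : (a < N)%N -> (N <= (1 + a) * (N - a))%N.
Proof. by move=> aN; rewrite mulnDl mul1n -leq_subLR subKn ?leq_pmulr ?subn_gt0// ltnW. Qed.

Lemma sub_mul_pred e d N : (0 < e)%N -> (e * d <= N)%N -> (N - e * d + e.-1 * d + d = N)%N.
Proof. by case: e => // e _ edN; rewrite -addnA [(_ * d + d)%N]addnC -mulSn subnK. Qed.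

Lemma uphalf_le_mul_pred e d N : (1 < e)%N -> (e * d = N)%N -> (uphalf N <= e.-1 * d)%N.
Proof.
case: e => [|[|e]] // _ <-; rewrite leq_uphalf_double /= -muln2 mulnAC leq_mul2r.
by apply/orP; right; lia.
Qed.

(** * Primes of degree above N / 2 and sums over their multiples of degree N *)

Section LargePrimes.
Variables (K : finFieldType) (N M : nat).
Hypothesis MN : (2 * M < N)%N.
Implicit Types (F G P Q : {poly K}).

Definition large_primes : seq {poly K} := [seq P <- prs K N | (N - M <= deg P)%N].

Lemma mem_large_primes P : (P \in large_primes) =
  [&& prime_poly P, (N - M <= deg P)%N & (deg P <= N)%N].
Proof. by rewrite mem_filter mem_prs andbCA. Qed.

Lemma large_primes_uniq : uniq large_primes.
Proof. exact: filter_uniq (prs_uniq K N). Qed.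

Lemma large_prime_ndvd P G : P \in large_primes -> G \in mon K (N - deg P) -> ~~ (P %| G).
Proof.
rewrite mem_large_primes mem_mon => /and3P[pP P1 P2] /andP[mG /eqP dG].
by apply/negP => /(prime_dvd_deg mG pP); lia.
Qed.

Lemma sum_large_primes (V : nmodType) (phi : {poly K} -> V) :
  \sum_(F <- mon K N) \sum_(P <- large_primes | P %| F) phi F =
  \sum_(P <- large_primes) \sum_(G <- mon K (N - deg P)) phi (P * G).
Proof.
under eq_bigr do rewrite big_mkcond; rewrite exchange_big; apply: eq_big_seq => P /=.
rewrite mem_large_primes => /and3P[pP _ PN].
have := sum_mon_dvd 1 N phi pP; rewrite mul1n PN expr1 => <-.
by rewrite -big_mkcond.
Qed.

(** Two distinct large primes would have a product of degree at least 2 (N - M) > N. *)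
Lemma large_prime_unique F P Q : F \in mon K N -> P \in large_primes -> Q \in large_primes ->
  P %| F -> Q %| F -> P = Q.
Proof.
rewrite mem_mon !mem_large_primes => /andP[mF /eqP dF] /and3P[pP P1 _] /and3P[pQ Q1 _] PF QF.
apply/eqP; apply: contraPT (dF) => PQ.
have cPQ : coprimep P Q by exact: prime_poly_coprime.
have : P * Q %| F by rewrite Gauss_dvdp// PF.
have mPQ : P * Q \is monic by rewrite monicMl ?prime_monic.
move/dvdp_leq => /(_ (monic_neq0 mF)); rewrite !size_deg// ltnS degM ?prime_monic//.
by move=> h1 h2; lia.
Qed.

Lemma sum_large_prime_dvd (V : nmodType) (phi : {poly K} -> V) F : F \in mon K N ->
  \sum_(P <- large_primes | P %| F) phi F =
  if has (fun P => P %| F) large_primes then phi F else 0.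
Proof.
move=> FN; case: hasP => [[P PL PF]|nP].
  rewrite (big_rem P PL)/= PF big1_seq ?addr0// => Q /andP[QF].
  rewrite mem_rem_uniq ?large_primes_uniq// inE => /andP[QP QL].
  by rewrite (large_prime_unique FN QL PL QF PF) eqxx in QP.
by rewrite big1_seq// => P /andP[PF PL]; case: nP; exists P.
Qed.

Lemma sum_large_primes_pdens (R : realFieldType) (h : nat -> R) :
  \sum_(P <- large_primes) h (N - deg P)%N =
  \sum_(0 <= m < M.+1) pdens R K (N - m) * #|K|%:R ^+ (N - m) * h m.
Proof.
rewrite big_filter big_mkcond.
rewrite (sum_prs_pdens K N (fun d => if (N - M <= d)%N then h (N - d)%N else 0)).
under eq_bigr do rewrite (fun_if (fun x => _ * x)) mulr0.
rewrite -big_mkcond (@big_cat_nat _ _ _ (N - M)%N 1 N.+1)/=; [|lia|lia].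
rewrite big_nat_cond big1 ?add0r; last by move=> i /andP[/andP[_ ?] ?]; lia.
rewrite -{1}(add0n (N - M)%N) big_addn (_ : N.+1 - (N - M) = M.+1)%N; last by lia.
rewrite big_nat_rev /= big_nat_cond [RHS]big_nat; apply: eq_big.
  by move=> i; lia.
move=> i /andP[/andP[_ iM] _].
rewrite (_ : (0 + M.+1 - i.+1 + (N - M) = N - i)%N); last by lia.
by congr (_ * h _); lia.
Qed.

End LargePrimes.

(** * Size of the core and of the exceptional sets around it *)

Section Core.
Variables (R : realFieldType) (K : finFieldType) (n N k : nat).
Hypotheses (n_gt0 : (0 < n)%N) (nN : (2 * (2 * n) < N)%N) (Nn : (N <= 8 * n)%N).
Implicit Types (F G P Q : {poly K}).
Local Notation q := (#|K|%:R : R).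
Local Notation pdens := (@pdens R K).
Local Notation wt := (@wt R K).
Local Notation W j m := (\sum_(0 <= i < m.+1) wt j i).
Local Notation large := (large_primes K N (2 * n)).

Let q2 : 2 <= q := q_ge2 R K.
Let q0 : 0 <= q. Proof. by move: q2; lra. Qed.
Let qX0 m : 0 < q ^+ m := qX_gt0 R K m.
Let qXn0 m : q ^+ m != 0 := qX_neq0 R K m.
Let N_gt0 : (0 < N)%N. Proof. by lia. Qed.
Let NR : 0 < N%:R :> R. Proof. by rewrite ltr0n. Qed.

Lemma sum_omega_large_prime P : P \in large ->
  \sum_(G <- mon K (N - deg P)) (omega (P * G) == k.+1)%:R =
  wt k (N - deg P) * q ^+ (N - deg P) :> R.
Proof.
move=> PL; rewrite /wt divfK// [RHS]big_mkcond; apply: eq_big_seq => G GN.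
have := GN; rewrite mem_mon => /andP[mG _].
have := PL; rewrite mem_large_primes => /and3P[pP _ _].
have := omega_primeM pP mG (large_prime_ndvd nN PL GN) (isT : 0 < 1)%N.
by rewrite expr1 => ->; rewrite eqSS; case: eqP.
Qed.

(** Products of a large prime with a cofactor of degree m <= 2 n are pairwise distinct, and the
    primes of degree N - m have density at least 1/(2 N). *)
Lemma wt_lower : W k (2 * n) <= 2 * N%:R * wt k.+1 N.
Proof.
have H : \sum_(P <- large) wt k (N - deg P) * q ^+ (N - deg P) <= wt k.+1 N * q ^+ N.
  rewrite -(eq_big_seq _ sum_omega_large_prime).
  rewrite -(sum_large_primes N (2 * n) (fun F => (omega F == k.+1)%:R : R)).
  rewrite /wt divfK// [leRHS]big_mkcond big_seq [leRHS]big_seq; apply: ler_sum => F FN.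
  by rewrite (sum_large_prime_dvd nN (fun F => (omega F == k.+1)%:R : R) FN); case: ifP; case: eqP.
move: H; rewrite (sum_large_primes_pdens K nN (fun m => wt k m * q ^+ m)) => H.
 rewrite -(ler_pM2r (qX0 N)).
have N20 : 0 < 2 * N%:R :> R by move: NR; lra.
rewrite -[leRHS]mulrA; apply: le_trans (ler_wpM2l (ltW N20) H).
rewrite big_distrl /= big_distrr /= big_nat [leRHS]big_nat; apply: ler_sum => m /andP[_ mn].
have dN : (0 < N - m)%N by lia.
have p1 := pdens_ge R K dN.
have p2 : 1 <= 2 * N%:R * pdens (N - m).
  have : (N - m)%:R * pdens (N - m) <= N%:R * pdens (N - m).
    by rewrite ler_wpM2r ?pdens_ge0// ler_nat leq_subr.
  lra.
have w0 : 0 <= wt k m * q ^+ N by rewrite mulr_ge0 ?wt_ge0// ltW.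
have -> : 2 * N%:R * (pdens (N - m) * q ^+ (N - m) * (wt k m * q ^+ m)) =
   2 * N%:R * pdens (N - m) * (wt k m * q ^+ N).
  have -> : q ^+ N = q ^+ (N - m) * q ^+ m by rewrite -exprD subnK//; lia.
  by ring.
by rewrite ler_peMl.
Qed.

(* [k] is one less than the number of prime factors. *)
Definition core : seq {poly K} :=
  [seq F <- mon K N | [&& omega F == k.+1, Omega F == k.+1 & has (fun P => P %| F) large]].

(** The number of primes that divide F at least twice, spread over the exponents so that it can be
    averaged by exact multiplicity. *)
Definition squarefull_part F : R :=
  \sum_(P <- prs K N) \sum_(2 <= e < N.+1 | multiplicity P F == e) 1.

Definition small_part F : R :=
  \sum_(P <- prs K N | (deg P < N - 2 * n)%N) (multiplicity P F == 1%N)%:R * (deg P)%:R.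

Lemma squarefull_part_ge0 F : 0 <= squarefull_part F.
Proof. by apply: sumr_ge0 => P _; exact: sumr_ge0. Qed.

Lemma small_part_ge0 F : 0 <= small_part F.
Proof. by apply: sumr_ge0 => P _; rewrite mulr_ge0. Qed.

(* [N = \sum_(P %| F) multiplicity P F * deg P]: outside the core either some
   multiplicity exceeds 1 or all the prime factors are small. *)
Lemma not_core F : F \in mon K N -> omega F = k.+1 -> F \notin core ->
  N%:R <= N%:R * squarefull_part F + small_part F.
Proof.
move=> FN oF; have := FN; rewrite mem_mon => /andP[mF /eqP dF].
rewrite mem_filter FN andbT oF eqxx /= => nc.
case: (boolP (all (fun P => multiplicity P F <= 1)%N (prs K N))) => [/allP m1|].
  have m1' P : P \in prs K N -> \sum_(1 <= e < N.+1 | multiplicity P F == e) (e * deg P)%:R =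
      (multiplicity P F == 1%N)%:R * (deg P)%:R :> R.
    move=> PN; have := m1 P PN; rewrite (eq_bigl (fun e => e == multiplicity P F)).
      rewrite big_nat1_eq; case: (multiplicity P F) => [_|[_|//]] /=.
        by rewrite mul0r.
      by rewrite ltnS N_gt0 mul1n mul1r.
    by move=> e; rewrite eq_sym.
  have OF : Omega F = k.+1.
    rewrite -oF /Omega /omega -sum1_size; apply: eq_big_seq => P.
    rewrite prime_divisorsP// => /andP[pP PF].
    have PN : P \in prs K N by rewrite mem_prs pP -dF prime_dvd_deg.
    have := m1 P PN; have := multiplicity_gt0 pP mF; rewrite PF.
    by case: (multiplicity P F) => [|[]].
  have nL P : P \in large -> ~~ (P %| F).
    by move=> PL; apply: contra nc => PF; rewrite OF eqxx /=; apply/hasP; exists P.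
  have := deg_sum_exact R mF (eq_leq dF); rewrite dF (eq_big_seq _ m1') => NE.
  apply: (@le_trans _ _ (small_part F)); last first.
    by rewrite lerDr mulr_ge0 ?squarefull_part_ge0.
  rewrite NE /small_part (bigID (fun P => deg P < N - 2 * n)%N) /=.
  rewrite [X in _ + X]big1_seq ?addr0// => P /andP[]; rewrite -leqNgt mem_prs => dP /andP[pP PN].
  have PL : P \in large by rewrite mem_large_primes pP dP.
  have := multiplicity_gt0 pP mF; rewrite (negbTE (nL P PL)).
  by case: (multiplicity P F) => [_|//]; rewrite mul0r.
rewrite -has_predC => /hasP[P PN /=]; rewrite -ltnNge => m2.
have h : 1 <= squarefull_part F.
  rewrite /squarefull_part (big_rem P PN) /= (eq_bigl (fun e => e == multiplicity P F)).
    rewrite big_nat1_eq m2 ltnS.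
    have := PN; rewrite mem_prs => /andP[pP _].
    have := multiplicity_le_deg pP mF; rewrite dF => -> /=.
    by rewrite lerDl; apply: sumr_ge0 => ? _; exact: sumr_ge0.
  by move=> e; rewrite eq_sym.
have := small_part_ge0 F; have := ler_wpM2l (ltW NR) h; lra.
Qed.


Hypothesis Wh : 113 * k.+1%:R <= cumpdens R K n.
Variable eps : R.
Hypothesis epsE : eps = 4 * k.+1%:R / cumpdens R K n.

Let w_ge0 := @wt_ge0 R K.
Let w0E := @wt0E R K.
Let w_rec := @wt_recursion R K.
Let W_low j := @cumwt_lower R K j n.

Let eps_pos : 0 <= eps.
Proof. exact: (eps_ge0 Wh epsE). Qed.

Let W1 : 1 <= W k (2 * n).
Proof. exact: (W_ge1 w_ge0 w0E w_rec n_gt0 W_low Wh epsE). Qed.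

(** A factor of degree d < N - 2 n leaves a cofactor of degree above 2 n, rare by [W_middle]. The
    weight d of the prime is cancelled by its density, at most 1/d. *)
Lemma sum_small_part :
  \sum_(F <- mon K N | omega F == k.+1) small_part F <= 28 * eps * W k (2 * n) * q ^+ N.
Proof.
apply: (@le_trans _ _ (\sum_(P <- prs K N | (deg P < N - 2 * n)%N)
    (deg P)%:R * (wt k (N - deg P) * q ^+ (N - deg P)))).
  rewrite /small_part exchange_big /= big_seq_cond [leRHS]big_seq_cond.
  apply: ler_sum => P /andP[]; rewrite mem_prs => /andP[pP PN] _.
  have -> : \sum_(F <- mon K N | omega F == k.+1) (multiplicity P F == 1%N)%:R * (deg P)%:R =
     (deg P)%:R * \sum_(F <- mon K N | (omega F == k.+1) && (multiplicity P F == 1%N)) 1 :> R.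
    rewrite [in RHS]big_mkcondr big_distrr; apply: eq_bigr => F _ /=.
    by case: ifP => _; rewrite mulrC.
  rewrite sum_omega_multiplicity// mul1n PN ler_wpM2l// /wt divfK// big_mkcondr /=.
  by apply: ler_sum => G _; case: ifP.
rewrite big_mkcond (sum_prs_pdens K N (fun d => if (d < N - 2 * n)%N then
   d%:R * (wt k (N - d) * q ^+ (N - d)) else 0)).
apply: (@le_trans _ _ ((W k (8 * n) - W k n) * q ^+ N)); last first.
  rewrite ler_wpM2r ?(ltW (qX0 _))//.
  exact: (W_middle w_ge0 w0E w_rec n_gt0 W_low Wh epsE).
have -> : W k (8 * n) - W k n = \sum_(n.+1 <= m < (8 * n).+1) wt k m.
  rewrite (@big_cat_nat _ _ _ n.+1 0 (8 * n).+1)//=; last by lia.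
  by rewrite addrAC subrr add0r.
apply: (@le_trans _ _ (\sum_(1 <= d < N.+1) if (d < N - 2 * n)%N then wt k (N - d) * q ^+ N else 0)).
  rewrite big_nat [leRHS]big_nat; apply: ler_sum => d /andP[d0 dN].
  case: ifP => _; last by rewrite mulr0.
  have -> : pdens d * q ^+ d * (d%:R * (wt k (N - d) * q ^+ (N - d))) =
     d%:R * pdens d * (wt k (N - d) * q ^+ N).
    have -> : q ^+ N = q ^+ d * q ^+ (N - d) by rewrite -exprD subnKC.
    by ring.
  by rewrite ler_piMl ?pdens_le// mulr_ge0 ?wt_ge0// ltW.
rewrite -big_mkcond /= -big_distrl /= ler_wpM2r ?(ltW (qX0 _))//.
rewrite -big_filter -(big_map (fun d => N - d)%N xpredT).
apply: sum_le_sub.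
- rewrite map_inj_in_uniq ?filter_uniq ?iota_uniq// => x y.
  by rewrite !mem_filter !mem_index_iota => /andP[? ?] /andP[? ?]; lia.
- move=> i /mapP[d]; rewrite mem_filter !mem_index_iota => /andP[? /andP[? ?]] ->.
  by lia.
- exact: wt_ge0.
Qed.


(** The last term accounts for pure prime powers F = P^e, which occur only for k = 0. *)
Lemma squarefull_weight d e : (0 < d)%N -> (1 < e)%N -> (e * d <= N)%N ->
  N%:R * (pdens d * (q ^+ (e.-1 * d))^-1 * wt k (N - e * d)) <=
  e%:R * (2 ^+ (e.-1 * d))^-1 * (8 * eps * W k (2 * n))
    + (k == 0%N)%:R * (e * d == N)%N%:R * N%:R / 2 ^+ (e.-1 * d).
Proof.
move=> d0 e1 edN.
set x := (2 ^+ (e.-1 * d))^-1.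
have x0 : 0 <= x by rewrite invr_ge0 exprn_ge0.
have qx : (q ^+ (e.-1 * d))^-1 <= x.
  by rewrite lef_pV2 ?posrE ?qX0 ?exprn_gt0// lerXn2r ?nnegrE.
have p0 := pdens_ge0 R K d.
have p1 : pdens d * d%:R <= 1 by rewrite mulrC pdens_le.
have px : pdens d * (q ^+ (e.-1 * d))^-1 <= pdens d * x by rewrite ler_wpM2l.
apply: (@le_trans _ _ (N%:R * (pdens d * x * wt k (N - e * d)))).
  by rewrite ler_wpM2l// ler_wpM2r ?wt_ge0.
have dR : 1 <= d%:R :> R by rewrite ler1n.
have p2 : pdens d <= 1 by apply: le_trans p1; rewrite ler_peMr.
have W0 : 0 <= W k (2 * n) by apply: le_trans W1.
have [k0|k0] := posnP k.
  have -> : wt k (N - e * d) = (e * d == N)%N%:R by rewrite k0 wt0E subn_eq0 eqn_leq edN.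
  rewrite (_ : true%:R = 1 :> R)// mul1r.
  apply: (@le_trans _ _ ((e * d == N)%N%:R * N%:R * x)); last first.
    by rewrite lerDr (mulr_ge0 (mulr_ge0 _ x0) (mulr_ge0 (mulr_ge0 _ eps_pos) W0)).
  rewrite (_ : N%:R * _ = (e * d == N)%N%:R * N%:R * (pdens d * x)); last by ring.
  by rewrite ler_wpM2l ?mulr_ge0// ler_piMl.
rewrite (_ : false%:R = 0 :> R)// !mul0r addr0.
have [NE|Ned] := eqVneq (e * d)%N N.
  rewrite NE subnn wtE0 (gtn_eqF k0) !mulr0 !mulr_ge0//.
(* The recursion controls (N - e d) [wt] k (N - e d). The ratio N / (N - e d) is at most 1 + e d,
   and the factor d is absorbed by [pdens] d below. *)
have h : N%:R * wt k (N - e * d) <= 4 * (1 + e%:R * d%:R) * (eps * W k (2 * n)).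
  apply: (@le_trans _ _ ((1 + e%:R * d%:R) * ((N - e * d)%:R * wt k (N - e * d)))).
    rewrite mulrA ler_wpM2r ?wt_ge0// -natrM -(natrD _ 1) -natrM ler_nat.
    by apply: leq_mul_sub; rewrite ltn_neqAle Ned.
  rewrite (mulrC 4) -[leRHS]mulrA; apply: ler_wpM2l.
    by rewrite addr_ge0// mulr_ge0.
  have := W_chain8 w_ge0 w0E w_rec n_gt0 W_low Wh epsE k0; rewrite expr1 => h1.
  have : (N - e * d)%:R * wt k (N - e * d) <= 4 * W (k - 1)%N (8 * n).
    have {1}-> : k = (k - 1).+1 by rewrite subn1 prednK.
    by apply: (w_rec_W w_ge0 w_rec); rewrite (leq_trans (leq_subr _ _)) ?(leq_trans Nn).
  by move=> h2; apply: le_trans h2 _; rewrite ler_wpM2l.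
rewrite (_ : N%:R * _ = pdens d * x * (N%:R * wt k (N - e * d))); last by ring.
apply: le_trans (ler_wpM2l (mulr_ge0 p0 x0) h) _.
rewrite [leLHS](_ : _ = (pdens d * (1 + e%:R * d%:R)) * (4 * x * (eps * W k (2 * n)))); last by ring.
rewrite [leRHS](_ : _ = (2 * e%:R) * (4 * x * (eps * W k (2 * n)))); last by ring.
apply: ler_wpM2r; first by rewrite !mulr_ge0.
rewrite mulrDr mulr1 (_ : pdens d * (e%:R * d%:R) = e%:R * (pdens d * d%:R)); last by ring.
have eR : 1 <= e%:R :> R by rewrite ler1n ltnW.
have : e%:R * (pdens d * d%:R) <= e%:R by rewrite ler_piMr.
lra.
Qed.

Lemma sum_geometric_weight :
  \sum_(1 <= d < N.+1) \sum_(2 <= e < N.+1) e%:R * (2 ^+ (e.-1 * d))^-1 <= 8 :> R.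
Proof.
rewrite exchange_big /=.
apply: (@le_trans _ _ (\sum_(2 <= e < N.+1) 2 * (e%:R * (2 ^+ e.-1)^-1))); last first.
  have := sum_arith_geom R N; rewrite -big_distrr /=; case: N N_gt0 => // m _.
  rewrite [X in X <= _ -> _]big_ltn// expr0 invr1 mulr1; lra.
rewrite big_nat [leRHS]big_nat; apply: ler_sum => e /andP[e1 _].
rewrite -big_distrr /= mulrCA ler_wpM2l//.
have x0 : 0 < 2 ^+ e.-1 :> R by rewrite exprn_gt0.
have := @geometric_le R (2 ^+ e.-1)^-1 N; rewrite invr_ge0 ltW// => /(_ isT) h.
under eq_bigr do rewrite exprM -exprVn.
apply: h; rewrite lef_pV2 ?posrE//.
by case: e e1 x0 => [|[|e]] // _ _; rewrite exprS ler_peMr// exprn_ege1// ler1n.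
Qed.

(** e d = N with e >= 2 forces (e - 1) d >= N / 2, so each of the at most N^2 terms is at most N /
    2^m with m = N / 2 rounded up. Then N^4 <= 16 m^4 <= 16 * 32 * 2^m, whence 512. *)
Lemma sum_exact_weight :
  \sum_(1 <= d < N.+1) \sum_(2 <= e < N.+1)
    (e * d == N)%N%:R * N%:R / 2 ^+ (e.-1 * d) <= 512 / N%:R :> R.
Proof.
pose m := uphalf N.
have m0 : (0 < m)%N by rewrite /m; lia.
have Nm : (N <= 2 * m)%N by rewrite /m; lia.
apply: (@le_trans _ _ (\sum_(1 <= d < N.+1) \sum_(2 <= e < N.+1) N%:R / 2 ^+ m)).
  apply: ler_sum => d _; rewrite big_nat [leRHS]big_nat; apply: ler_sum => e /andP[e1 _].
  case: eqP => edN; last by rewrite !mul0r divr_ge0 ?exprn_ge0.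
  rewrite mul1r ler_wpM2l// lef_pV2 ?posrE ?exprn_gt0//.
  by apply: ler_weXn2l; [rewrite ler1n|exact: uphalf_le_mul_pred].
rewrite !sumr_const_nat subn1 -mulrnA -[leLHS]mulr_natr.
apply: (@le_trans _ _ (N%:R / 2 ^+ m * (N * N)%:R)).
  by rewrite ler_wpM2l ?divr_ge0 ?exprn_ge0// ler_nat; apply: leq_mul; lia.
rewrite mulrAC ler_pdivrMr ?exprn_gt0// mulrAC ler_pdivlMr//.
rewrite -natrX -!natrM ler_nat.
have := quartic_le_exp2 m.
have : (N ^ 4 <= (2 * m) ^ 4)%N by rewrite leq_exp2r.
rewrite expnMn; have -> : (N * (N * N) * N = N ^ 4)%N by rewrite !expnS; lia.
lia.
Qed.

Lemma sum_squarefull_part :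
  N%:R * \sum_(F <- mon K N | omega F == k.+1) squarefull_part F <=
  (64 * eps + 512 / N%:R) * W k (2 * n) * q ^+ N.
Proof.
apply: (@le_trans _ _ (N%:R * \sum_(P <- prs K N) \sum_(2 <= e < N.+1 | (e * deg P <= N)%N)
    (wt k (N - e * deg P) * q ^+ (N - e * deg P)))).
  rewrite ler_wpM2l// /squarefull_part exchange_big /= big_seq [leRHS]big_seq.
  apply: ler_sum => P; rewrite mem_prs => /andP[pP PN].
  under eq_bigr do rewrite big_mkcond.
  rewrite exchange_big /= [leRHS]big_mkcond big_nat [leRHS]big_nat; apply: ler_sum => e /andP[e1 _].
  rewrite -big_mkcondr sum_omega_multiplicity//; last by lia.
  case: ifP => // _; rewrite /wt divfK// big_mkcondr /=.
  by apply: ler_sum => G _; case: ifP.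
rewrite (sum_prs_pdens K N (fun d => \sum_(2 <= e < N.+1 | (e * d <= N)%N)
    (wt k (N - e * d) * q ^+ (N - e * d)))).
apply: (@le_trans _ _ (\sum_(1 <= d < N.+1) \sum_(2 <= e < N.+1)
   (e%:R * (2 ^+ (e.-1 * d))^-1 * (8 * eps * W k (2 * n))
    + (k == 0%N)%:R * (e * d == N)%N%:R * N%:R / 2 ^+ (e.-1 * d)) * q ^+ N)).
  rewrite big_distrr big_nat [leRHS]big_nat; apply: ler_sum => d /andP[d0 _] /=.
  rewrite mulrA big_distrr big_mkcond /= big_nat [leRHS]big_nat; apply: ler_sum => e /andP[e1 _].
  case: ifP => ed; last first.
    rewrite mulr_ge0 ?(ltW (qX0 _))// addr_ge0// !mulr_ge0 ?invr_ge0 ?exprn_ge0 //.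
    by apply: le_trans W1.
  apply: le_trans (ler_wpM2r (ltW (qX0 N)) (squarefull_weight d0 e1 ed)).
  have -> : q ^+ N = q ^+ (N - e * d) * q ^+ (e.-1 * d) * q ^+ d.
    by rewrite -!exprD sub_mul_pred// ltnW.
  move: (qXn0 (e.-1 * d)); move: (q ^+ (e.-1 * d)) => y y0.
  by rewrite le_eqVlt; apply/orP; left; apply/eqP; field.
under eq_bigr do rewrite -big_distrl big_split /=.
rewrite -big_distrl big_split /= ler_wpM2r ?(ltW (qX0 _))//.
rewrite [leRHS]mulrDl.
have W0 : 0 <= W k (2 * n) by apply: le_trans W1.
apply: lerD.
  under eq_bigr do rewrite -big_distrl /=.
  rewrite -big_distrl /=.
  apply: le_trans (ler_wpM2r _ sum_geometric_weight) _; first by rewrite !mulr_ge0.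
  by rewrite !mulrA (_ : 8 * 8 = 64); last by ring.
apply: (@le_trans _ _ (512 / N%:R)); last first.
  by apply: ler_peMr; [exact: divr_ge0 (ler0n _ _) (ler0n _ _)|exact: W1].
apply: le_trans sum_exact_weight; apply: ler_sum => d _; apply: ler_sum => e _.
by rewrite -!mulrA ler_piMl ?mulr_ge0 ?invr_ge0 ?exprn_ge0//; case: eqP.
Qed.


(** Proportion of exceptional polynomials: 184 [eps] + 1024 / N for those with k + 1 distinct primes
    outside the core, and 16 [eps] for those with Omega = k + 1 but fewer distinct primes. *)
Let rho : R := 200 * eps + 1024 / N%:R.
Let D : R := \sum_(F <- mon K N | omega F == k.+1) 1.

Let D_ge0 : 0 <= D.
Proof. exact: sumr_ge0. Qed.

Let W_le_D : W k (2 * n) * q ^+ N <= 2 * N%:R * D.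
Proof.
have <- : wt k.+1 N * q ^+ N = D by rewrite /wt divfK.
by rewrite mulrA ler_wpM2r ?(ltW (qX0 _))// wt_lower.
Qed.

(** Markov's inequality: by [not_core] the averaged quantity is at least N on every exceptional F.
    The averages add up to 64 + 28 = 92 times [eps], doubled when W k is compared with D. *)
Lemma sum_not_core :
  \sum_(F <- mon K N | (omega F == k.+1) && (F \notin core)) 1 <=
  (184 * eps + 1024 / N%:R) * D.
Proof.
have h : N%:R * \sum_(F <- mon K N | (omega F == k.+1) && (F \notin core)) 1 <=
    (92 * eps + 512 / N%:R) * (W k (2 * n) * q ^+ N).
  rewrite [leRHS](_ : _ = (64 * eps + 512 / N%:R) * W k (2 * n) * q ^+ N
     + 28 * eps * W k (2 * n) * q ^+ N); last by ring.
  apply: le_trans (lerD sum_squarefull_part sum_small_part).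
  rewrite !big_distrr -big_split /= big_mkcondr big_seq_cond [leRHS]big_seq_cond.
  apply: ler_sum => F /andP[FN /eqP oF].
  rewrite mulr1; case: ifP => Fc; first exact: not_core.
  by rewrite addr_ge0 ?small_part_ge0// mulr_ge0 ?squarefull_part_ge0.
rewrite -(ler_pM2l NR); apply: le_trans h _.
apply: le_trans (ler_wpM2l _ W_le_D) _; first by apply: addr_ge0; [exact: mulr_ge0 (ler0n _ _) eps_pos|exact: divr_ge0 (ler0n _ _) (ler0n _ _)].
by rewrite le_eqVlt; apply/orP; left; apply/eqP; field; rewrite gt_eqF.
Qed.

Lemma sum_low_omega :
  \sum_(F <- mon K N | (Omega F == k.+1) && (omega F != k.+1)) 1 <= 16 * eps * D.
Proof.
have h : N%:R * \sum_(F <- mon K N | (Omega F == k.+1) && (omega F != k.+1)) 1 <=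
    8 * eps * W k (2 * n) * q ^+ N.
  have := sum_w_lower w_ge0 w0E w_rec n_gt0 W_low Wh epsE Nn.
  move=> /(ler_wpM2r (ltW (qX0 N))); apply: le_trans.
  rewrite -mulrA ler_wpM2l// big_distrl /=.
  under [leRHS]eq_bigr do rewrite /wt divfK// big_mkcond.
  rewrite exchange_big /= big_mkcond big_seq [leRHS]big_seq; apply: ler_sum => F.
  rewrite mem_mon => /andP[mF /eqP dF]; rewrite -big_mkcond /=.
  case: ifP => [/andP[/eqP OF oF]|_]; last exact: sumr_ge0.
  rewrite (eq_bigl (fun j => j == omega F)); last by move=> j; rewrite eq_sym.
  rewrite big_nat1_eq; have := omega_le_Omega mF; rewrite OF => o1.
  rewrite lt0n ifT// ltn_neqAle o1 oF !andbT.
  by apply: contraTneq N_gt0 => /(omega_eq0 mF) F1; rewrite -dF F1 deg1.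
rewrite -(ler_pM2l NR); apply: le_trans h _.
rewrite -mulrA; apply: le_trans (ler_wpM2l _ W_le_D) _; first by rewrite mulr_ge0.
by rewrite le_eqVlt; apply/orP; left; apply/eqP; ring.
Qed.

Hypothesis rho_le : rho <= 2^-1.

Let CE : (size core)%:R = \sum_(F <- mon K N | F \in core) 1 :> R.
Proof.
rewrite -sum1_size natr_sum -[RHS]big_filter; apply: perm_big; apply: uniq_perm.
- by rewrite filter_uniq// mon_uniq.
- by rewrite filter_uniq// mon_uniq.
move=> F; rewrite [RHS]mem_filter; case Fc: (F \in core) => //=.
by move: Fc; rewrite mem_filter => /andP[_ ->].
Qed.

Let D_le : D <= (size core)%:R + rho * D.
Proof.
apply: (@le_trans _ _ ((size core)%:R + (184 * eps + 1024 / N%:R) * D)); last first.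
  by rewrite lerD2l ler_wpM2r// lerD2r ler_wpM2r//; lra.
apply: le_trans (lerD (lexx _) sum_not_core).
rewrite /D (bigID (fun F => F \in core)) /= lerD2r CE [leRHS]big_mkcond [leLHS]big_mkcond.
by apply: ler_sum => F _; case: (F \in core); rewrite ?andbF ?andbT//; case: ifP.
Qed.

Let D_le2 : D <= 2 * (size core)%:R.
Proof. by have := ler_wpM2r D_ge0 rho_le; move: D_le; lra. Qed.

Lemma weight_le_core : W k (2 * n) * q ^+ N <= 4 * N%:R * (size core)%:R.
Proof.
apply: le_trans W_le_D _; rewrite [leRHS](_ : _ = 2 * N%:R * (2 * (size core)%:R)); last by ring.
by rewrite ler_wpM2l// mulr_ge0.
Qed.

(** Used to know that the core is not empty. *)
Lemma expn_le_core : q ^+ N <= 4 * N%:R * (size core)%:R.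
Proof. by apply: le_trans weight_le_core; rewrite ler_peMl// ltW. Qed.

Lemma card_le_core :
  \sum_(F <- mon K N | (omega F == k.+1) || (Omega F == k.+1)) 1 <=
  (1 + 2 * rho) * (size core)%:R.
Proof.
apply: (@le_trans _ _ ((size core)%:R + rho * D)); last first.
  rewrite [leRHS]mulrDl mul1r lerD2l (mulrC 2) -[leRHS]mulrA; apply: ler_wpM2l => [|//].
  by apply: addr_ge0; [exact: mulr_ge0 (ler0n _ _) eps_pos|exact: divr_ge0 (ler0n _ _) (ler0n _ _)].
have -> : rho * D = (184 * eps + 1024 / N%:R) * D + 16 * eps * D by rewrite /rho; ring.
rewrite addrA; apply: le_trans (lerD (lerD (lexx _) sum_not_core) sum_low_omega).
rewrite CE [leLHS]big_mkcond [X in _ <= X + _ + _]big_mkcond [X in _ <= _ + X + _]big_mkcond.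
rewrite [X in _ <= _ + _ + X]big_mkcond -!big_split; apply: ler_sum => F _ /=.
case: (F \in core); case: (omega F == k.+1); case: (Omega F == k.+1) => /=; lra.
Qed.

End Core.

(** Choosing one preimage for each i is enough: [psi] recovers i, so the chosen preimages are
    distinct. *)
Lemma sum_le_map (R : realFieldType) (I J : eqType) (s : seq I) (t : seq J)
    (psi : J -> I) (g : I -> R) (h : J -> R) :
  uniq s -> (forall j, 0 <= h j) ->
  (forall i, i \in s -> exists2 j, j \in t & psi j = i /\ g i <= h j) ->
  \sum_(i <- s) g i <= \sum_(j <- t) h j.
Proof.
move=> us h0 st.
have [j0|s0] : J + (s = [::]).
  case: t st => [st|j t _]; last by left.
  right; case: s st {us} => // i s /(_ i); rewrite mem_head => /(_ isT) E.
  by exfalso; case: E.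
- pose phi i := nth j0 t (find (fun j => (psi j == i) && (g i <= h j)) t).
  have phiP i : i \in s -> [/\ phi i \in t, psi (phi i) = i & g i <= h (phi i)].
    move=> /st[j jt [ji gh]].
    have hh : has (fun j => (psi j == i) && (g i <= h j)) t.
      by apply/hasP; exists j => //; rewrite ji eqxx.
    have := nth_find j0 hh; rewrite -/(phi i) => /andP[/eqP ? ?]; split => //.
    by rewrite mem_nth// -has_find.
  apply: (@le_trans _ _ (\sum_(j <- map phi s) h j)).
    by rewrite big_map [leLHS]big_seq [leRHS]big_seq; apply: ler_sum => i /phiP[].
  apply: sum_le_sub => //.
    rewrite map_inj_in_uniq// => x y /phiP[_ xE _] /phiP[_ yE _] xy.
    by rewrite -xE -yE xy.
  by move=> j /mapP[i /phiP[? _ _] ->].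
by rewrite s0 big_nil sumr_ge0.
Qed.

(** * Squarefree products and the equation G1 G2 = G1' G2' *)

Section Squarefree.
Variable K : finFieldType.
Implicit Types (F G P Q : {poly K}).

Lemma Omega_sum F n : F \is monic -> (deg F <= n)%N ->
  Omega F = (\sum_(P <- prs K n) multiplicity P F)%N.
Proof.
move=> mF Fn; rewrite /Omega (sum_prime_divisors _ mF Fn) big_mkcond.
apply: eq_big_seq => P; rewrite mem_prs => /andP[pP _].
by have := multiplicity_gt0 pP mF; case: ifP => _; lia.
Qed.

Lemma OmegaM F G : F \is monic -> G \is monic -> Omega (F * G) = (Omega F + Omega G)%N.
Proof.
move=> mF mG; have mFG : F * G \is monic by rewrite monicMl.
rewrite (Omega_sum mFG (leqnn _)) degM// (Omega_sum mF (leq_addr (deg G) _)).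
rewrite (Omega_sum mG (leq_addl (deg F) _)) -big_split; apply: eq_big_seq => P.
by rewrite mem_prs => /andP[pP _]; rewrite multiplicityM.
Qed.

Lemma omegaM_le F G : F \is monic -> G \is monic -> (omega (F * G) <= omega F + omega G)%N.
Proof.
move=> mF mG; have mFG : F * G \is monic by rewrite monicMl.
rewrite /omega -size_cat; apply: uniq_leq_size; first exact: prime_divisors_uniq.
move=> P; rewrite prime_divisorsP// mem_cat !prime_divisorsP// => /andP[pP].
by rewrite prime_dvdM// pP.
Qed.

Definition sqf j G := (omega G == j) && (Omega G == j).

(** [omega] is subadditive, [Omega] is additive and omega <= Omega, so equality for the product
    forces equality throughout. *)
Lemma sqfM j F G : F \is monic -> G \is monic -> sqf j (F * G) ->
  (omega F + omega G = j)%N.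
Proof.
move=> mF mG /andP[/eqP o1 /eqP o2].
have := omegaM_le mF mG; have := omega_le_Omega mF; have := omega_le_Omega mG.
have := OmegaM mF mG; lia.
Qed.

(** a is the monic gcd of G1 and G1'. The quotients b and c are then coprime, and b G2 = c G2' makes
    c divide G2. *)
Lemma mon_rect G1 G1' G2 G2' : G1 \is monic -> G1' \is monic -> G2 \is monic ->
  G2' \is monic -> G1 * G2 = G1' * G2' ->
  exists a b c d, [/\ [&& a \is monic, b \is monic, c \is monic & d \is monic],
    G1 = a * b, G1' = a * c, G2 = c * d & G2' = b * d].
Proof.
move=> m1 m1' m2 m2' E.
set g := gcdp G1 G1'.
have g0 : g != 0 by rewrite gcdp_eq0 negb_and monic_neq0.
pose a := (lead_coef g)^-1 *: g.
have l0 : (lead_coef g)^-1 != 0 by rewrite invr_eq0 lead_coef_eq0.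
have ma : a \is monic by rewrite monicE lead_coefZ mulVf// lead_coef_eq0.
have a1 : a %| G1 by rewrite dvdpZl// dvdp_gcdl.
have a1' : a %| G1' by rewrite dvdpZl// dvdp_gcdr.
pose b := G1 %/ a; pose c := G1' %/ a.
have Eb : G1 = a * b by rewrite mulrC divpK.
have Ec : G1' = a * c by rewrite mulrC divpK.
have mb : b \is monic by rewrite -(monicMl _ ma) -Eb.
have mc : c \is monic by rewrite -(monicMl _ ma) -Ec.
have cbc : coprimep c b.
  rewrite coprimep_sym /b /c /a !divpZr// coprimepZl ?coprimepZr ?invr_eq0 ?lead_coef_eq0//.
  by apply: coprimep_div_gcd; rewrite monic_neq0.
have bd : b * G2 = c * G2'.
  by apply: (mulfI (monic_neq0 ma)); rewrite !mulrA -Eb -Ec.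
have cG : c %| G2 by rewrite -(Gauss_dvdpr _ cbc) bd dvdp_mulr.
pose d := G2 %/ c.
have Ed : G2 = c * d by rewrite mulrC divpK.
exists a, b, c, d; split => //.
  by rewrite ma mb mc -(monicMl _ mc) -Ed.
by apply: (mulfI (monic_neq0 mc)); rewrite -bd Ed; ring.
Qed.

Definition monle M : seq {poly K} := flatten [seq mon K m | m <- index_iota 0 M.+1].

Lemma mem_monle F M : (F \in monle M) = (F \is monic) && (deg F <= M)%N.
Proof.
apply/flatten_mapP/andP => [[m + ]|[mF FM]].
  by rewrite mem_index_iota mem_mon => /andP[_ mM] /andP[mF /eqP Fm]; rewrite Fm.
by exists (deg F); rewrite ?mem_index_iota// mem_mon mF eqxx.
Qed.

Lemma monle_uniq M : uniq (monle M).
Proof.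
rewrite /monle; have : uniq (index_iota 0 M.+1) by exact: iota_uniq.
elim: (index_iota _ _) => //= m s IH /andP[ms us].
rewrite cat_uniq mon_uniq IH// andbT /=; apply/hasPn => F /flatten_mapP[m' m's].
rewrite !mem_mon => /andP[mF /eqP Fm']; rewrite mF /=.
by apply: contraNneq ms => <-; rewrite Fm'.
Qed.

Lemma sum_monle (V : nmodType) M (A : pred {poly K}) (phi : {poly K} -> V) :
  \sum_(F <- monle M | A F) phi F = \sum_(0 <= m < M.+1) \sum_(F <- mon K m | A F) phi F.
Proof.
rewrite /monle; elim: (index_iota _ _) => [|d s IH]; first by rewrite !big_nil.
by rewrite /= big_cat big_cons IH.
Qed.

End Squarefree.

Section Quadruples.
Variables (R : realFieldType) (K : finFieldType) (k M : nat).
Implicit Types (F G P Q : {poly K}).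
Local Notation q := (#|K|%:R : R).
Local Notation wt := (@wt R K).
Local Notation W j m := (\sum_(0 <= i < m.+1) wt j i).

Let qX0 m : 0 < q ^+ m := qX_gt0 R K m.

(** The index set of V once the squares |c_Q|^2 are expanded; both entries are cofactors of the same
    prime, hence of equal degree. *)
Definition sqf_pairs : seq ({poly K} * {poly K}) :=
  [seq x <- [seq (G, G') | G <- monle K M, G' <- monle K M] |
    [&& sqf k x.1, sqf k x.2 & deg x.1 == deg x.2]].

Lemma mem_sqf_pairs x : (x \in sqf_pairs) = [&& sqf k x.1, sqf k x.2, deg x.1 == deg x.2,
  x.1 \in monle K M & x.2 \in monle K M].
Proof.
rewrite mem_filter -!andbA; case: x => a b /=; do 5 congr (_ && _).
apply/idP/idP => [/allpairsP[[c d] /= [cM dM [-> ->]]]|/andP[aM bM]]; first by rewrite cM dM.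
by apply/allpairsP; exists (a, b).
Qed.

Lemma sqf_pairs_uniq : uniq sqf_pairs.
Proof.
by rewrite filter_uniq// allpairs_uniq ?monle_uniq// => -[a b] [c d] _ _ /= [-> ->].
Qed.

Lemma cumwtE j : \sum_(F <- monle K M | omega F == j) (q ^+ deg F)^-1 = W j M.
Proof.
rewrite sum_monle; apply: eq_bigr => m _; rewrite /wt big_distrl big_seq_cond [RHS]big_seq_cond.
by apply: eq_bigr => F; rewrite mem_mon /= mul1r => /andP[/andP[_ /eqP ->]].
Qed.

Lemma sum_equal_deg j :
  \sum_(F <- monle K M | omega F == j) \sum_(G <- monle K M | (omega G == j) && (deg F == deg G))
    (q ^+ deg F * q ^+ deg G)^-1 = \sum_(0 <= m < M.+1) wt j m ^+ 2.
Proof.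
rewrite sum_monle big_nat [RHS]big_nat; apply: eq_bigr => m /andP[_ mM].
transitivity (\sum_(F <- mon K m | omega F == j) (q ^+ m)^-1 * wt j m).
  rewrite big_seq_cond [RHS]big_seq_cond; apply: eq_bigr => F.
  rewrite mem_mon => /andP[/andP[mF /eqP dF] _].
  rewrite sum_monle (bigD1_seq m) ?mem_index_iota ?iota_uniq//= dF [X in _ + X]big1_seq ?addr0.
    rewrite /wt mulrA mulrC big_distrr /= big_distrr /=.
    rewrite big_seq_cond [RHS]big_seq_cond.
    apply: eq_big => [G|G]; rewrite mem_mon.
      by case: (deg G =P m) => [->|]; rewrite ?eqxx ?andbT ?andbF.
    by move=> /andP[/andP[_ /eqP ->] _]; rewrite invfM mulr1.
  move=> d /andP[dm _]; rewrite big1_seq// => G; rewrite mem_mon.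
  by move=> /andP[/andP[_ /eqP E] /andP[_ /eqP dG]]; rewrite -dG E eqxx in dm.
rewrite -big_distrl /= expr2; congr (_ * _).
by rewrite /wt big_distrl; apply: eq_bigr => F _; rewrite /= mul1r.
Qed.

(* Solutions are parametrised by [mon_rect]; [i] counts the prime factors of [b]. *)
Lemma sum_sqf_quadruples :
  \sum_(x <- sqf_pairs) \sum_(y <- sqf_pairs | (x.1 * y.1 == x.2 * y.2) && (x.1 != x.2))
    (q ^+ deg x.1 * q ^+ deg y.1)^-1 <=
  \sum_(1 <= i < k.+1) W (k - i)%N M ^+ 2 * \sum_(0 <= m < M.+1) wt i m ^+ 2.
Proof.
pose X := [seq z <- [seq (x, y) | x <- sqf_pairs, y <- sqf_pairs] |
   (z.1.1 * z.2.1 == z.1.2 * z.2.2) && (z.1.1 != z.1.2)].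
pose Dm j := [seq F <- monle K M | omega F == j].
pose Y i := [seq (x, y) | x <- [seq (a, d) | a <- Dm (k - i)%N, d <- Dm (k - i)%N],
   y <- [seq z <- [seq (b, c) | b <- Dm i, c <- Dm i] | deg z.1 == deg z.2]].
(* The point ((a, d), (b, c)) goes to ((a b, a c), (c d, b d)), that is, to ((G1, G1'), (G2, G2')).
   By [mon_rect] every solution is reached. *)
pose psi (z : ({poly K} * {poly K}) * ({poly K} * {poly K})) :=
  ((z.1.1 * z.2.1, z.1.1 * z.2.2), (z.2.2 * z.1.2, z.2.1 * z.1.2)).
pose g (z : ({poly K} * {poly K}) * ({poly K} * {poly K})) : R :=
  (q ^+ deg z.1.1 * q ^+ deg z.2.1)^-1.
pose h (z : ({poly K} * {poly K}) * ({poly K} * {poly K})) : R :=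
  ((q ^+ deg z.1.1)^-1 * (q ^+ deg z.1.2)^-1) * (q ^+ deg z.2.1 * q ^+ deg z.2.2)^-1.
apply: (@le_trans _ _ (\sum_(z <- X) g z)).
  rewrite [leRHS]big_filter [leRHS]big_mkcond [leRHS]big_allpairs.
  by apply: ler_sum => x _; rewrite [leLHS]big_mkcond.
apply: (@le_trans _ _ (\sum_(z <- flatten [seq Y i | i <- index_iota 1 k.+1]) h z)); last first.
  rewrite big_flatten big_map; apply: ler_sum => i _.
  have -> : \sum_(z <- Y i) h z =
      (\sum_(a <- Dm (k - i)%N) (q ^+ deg a)^-1) ^+ 2 *
      \sum_(z <- [seq z <- [seq (b, c) | b <- Dm i, c <- Dm i] | deg z.1 == deg z.2])
        (q ^+ deg z.1 * q ^+ deg z.2)^-1.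
    rewrite [LHS]big_allpairs [LHS]big_allpairs expr2 big_distrlr big_distrl /=.
    apply: eq_bigr => a _; rewrite big_distrl /=; apply: eq_bigr => d _.
    by rewrite big_distrr.
  rewrite big_filter cumwtE [leLHS]mulrC [leRHS]mulrC ler_wpM2r ?sqr_ge0//.
  rewrite big_filter big_mkcond big_allpairs -sum_equal_deg big_filter.
  by apply: ler_sum => b _; rewrite big_filter big_mkcondr.
apply: (@sum_le_map _ _ _ _ _ psi).
- rewrite filter_uniq// allpairs_uniq ?sqf_pairs_uniq// => -[a b] [c d] _ _ /= [-> ->] //.
- by move=> z; rewrite /h !mulr_ge0 ?invr_ge0 ?mulr_ge0 ?(ltW (qX0 _)).
case=> -[G1 G1'] [G2 G2']; rewrite mem_filter /= => /andP[/andP[/eqP E N1]].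
case/allpairsP => -[[? ?] [? ?]] /= [+ + [? ? ? ?]]; subst.
rewrite !mem_sqf_pairs /= !mem_monle => /and5P[s1 s1' /eqP d1 /andP[m1 M1] /andP[m1' M1']].
move=> /and5P[s2 s2' /eqP d2 /andP[m2 M2] /andP[m2' M2']].
have [a [b [c [d [/and4P[ma mb mc md] E1 E1' E2 E2']]]]] := mon_rect m1 m1' m2 m2' E.
subst; move: M1 M1' M2 M2' d1 d2; rewrite !degM// => M1 M1' M2 M2' d1 d2.
have o1 := sqfM ma mb s1; have o2 := sqfM ma mc s1'; have o3 := sqfM mc md s2.
have bc : deg b = deg c := addnI d1.
have ob : omega b = omega c by apply: (@addnI (omega a)); rewrite o1 o2.
have oa : omega a = (k - omega b)%N by rewrite -o1 addnK.
have od : omega d = (k - omega b)%N by rewrite -o3 ob addKn.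
have aM := leq_trans (leq_addr _ _) M1; have bM := leq_trans (leq_addl _ _) M1.
have cM := leq_trans (leq_addr _ _) M2; have dM := leq_trans (leq_addl _ _) M2.
(* Otherwise b = c = 1 and G1 = G1', which is excluded; hence the outer sum starts at i = 1. *)
have i0 : (0 < omega b)%N.
  rewrite lt0n; apply: contra N1 => /eqP b0; apply/eqP; congr (_ * _).
  by rewrite (omega_eq0 mb b0) (omega_eq0 mc)// -ob.
exists ((a, d), (b, c)); last first.
  split => //; rewrite /g /h /= !degM// -!invfM lef_pV2 ?posrE ?mulr_gt0//.
  by rewrite le_eqVlt; apply/orP; left; apply/eqP; rewrite !exprD bc; ring.
apply/flatten_mapP; exists (omega b); first by rewrite mem_index_iota i0 ltnS -o1 leq_addl.
apply/allpairsP; exists ((a, d), (b, c)); split => //=.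
  by apply/allpairsP; exists (a, d); split => //=; rewrite mem_filter mem_monle ?oa ?od eqxx ?ma ?md.
rewrite mem_filter /= bc eqxx /=; apply/allpairsP; exists (b, c); split => //=.
  by rewrite mem_filter mem_monle eqxx mb.
by rewrite mem_filter mem_monle ob eqxx mc.
Qed.

End Quadruples.

(** * Expectation and independence *)

Section BoundedMeasurable.
Context (R : realType) (d : measure_display) (T : measurableType d).
Implicit Types X Y : T -> R.

Definition bounded_measurable X : Prop :=
  measurable_fun [set: T] X /\ exists M : R, forall w, `|X w| <= M.

Lemma bmP X : bounded_measurable X -> measurable_fun [set: T] X.
Proof. by case. Qed.

Lemma bm_cst (r : R) : bounded_measurable (cst r).
Proof. by split; [exact: measurable_cst|exists `|r|]. Qed.

Lemma bmD X Y : bounded_measurable X -> bounded_measurable Y ->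
  bounded_measurable (fun w => X w + Y w).
Proof.
move=> [mX [M hM]] [mY [M' hM']]; split; first exact: measurable_funD.
by exists (M + M') => w; rewrite (le_trans (ler_normD _ _)) ?lerD.
Qed.

Lemma bmM X Y : bounded_measurable X -> bounded_measurable Y ->
  bounded_measurable (fun w => X w * Y w).
Proof.
move=> [mX [M hM]] [mY [M' hM']]; split; first exact: measurable_funM.
by exists (M * M') => w; rewrite normrM ler_pM.
Qed.

Lemma bmZ (r : R) X : bounded_measurable X -> bounded_measurable (fun w => r * X w).
Proof. by move=> mX; apply: bmM => //; exact: bm_cst. Qed.

Lemma bmN X : bounded_measurable X -> bounded_measurable (fun w => - X w).
Proof.
by move=> [mX [M hM]]; split; [exact: measurable_funN|exists M => w; rewrite normrN].
Qed.

Lemma bmB X Y : bounded_measurable X -> bounded_measurable Y ->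
  bounded_measurable (fun w => X w - Y w).
Proof. by move=> mX mY; apply: bmD => //; exact: bmN. Qed.

Lemma bmX X n : bounded_measurable X -> bounded_measurable (fun w => X w ^+ n).
Proof.
move=> mX; elim: n => [|n IH]; first exact: bm_cst.
by under eq_fun do rewrite exprS; exact: bmM.
Qed.

Lemma bm_sum I (s : seq I) (h : I -> T -> R) :
  (forall i, bounded_measurable (h i)) ->
  bounded_measurable (fun w => \sum_(i <- s) h i w).
Proof.
move=> mh; elim: s => [|i s IH].
  by under eq_fun do rewrite big_nil; exact: bm_cst.
by under eq_fun do rewrite big_cons; exact: bmD.
Qed.

Lemma bm_abs X : bounded_measurable X -> bounded_measurable (fun w => `|X w|).
Proof.
move=> [mX [M hM]]; split; last by exists M => w; rewrite normr_id.
exact: measurableT_comp.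
Qed.

End BoundedMeasurable.

Section Expectation.
Context (R : realType) (d : measure_display) (T : measurableType d).
Variable P : probability T R.
Implicit Types X Y : T -> R.

Definition Ex X : R := \int[P]_w X w.

Lemma bm_integrable X : bounded_measurable X -> P.-integrable [set: T] (EFin \o X).
Proof.
move=> [mX [M hM]]; apply: measurable_bounded_integrable => //=.
  by rewrite (le_lt_trans (probability_le1 P measurableT)) ?ltry.
by exists M; split; [exact: num_real|move=> x Mx w _; exact: le_trans (ltW Mx)].
Qed.

Lemma EFin_Ex X : bounded_measurable X -> (Ex X)%:E = (\int[P]_w (X w)%:E)%E.
Proof.
move=> /bm_integrable mX; rewrite /Ex /Rintegral fineK//.
exact: integrable_fin_num.
Qed.

Lemma Ex_cst (r : R) : Ex (cst r) = r.
Proof.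
rewrite /Ex Rintegral_cst// -[RHS]mulr1; congr (_ * _).
by rewrite (_ : 1 = fine 1%E)//; congr fine; exact: probability_setT.
Qed.

Lemma ExD X Y : bounded_measurable X -> bounded_measurable Y ->
  Ex (fun w => X w + Y w) = Ex X + Ex Y.
Proof. by move=> mX mY; rewrite /Ex RintegralD//; exact: bm_integrable. Qed.

Lemma ExB X Y : bounded_measurable X -> bounded_measurable Y ->
  Ex (fun w => X w - Y w) = Ex X - Ex Y.
Proof. by move=> mX mY; rewrite /Ex RintegralB//; exact: bm_integrable. Qed.

Lemma ExZ r X : bounded_measurable X -> Ex (fun w => r * X w) = r * Ex X.
Proof. by move=> mX; rewrite /Ex RintegralZl//; exact: bm_integrable. Qed.

Lemma Ex_sum I (s : seq I) (h : I -> T -> R) :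
  (forall i, bounded_measurable (h i)) ->
  Ex (fun w => \sum_(i <- s) h i w) = \sum_(i <- s) Ex (h i).
Proof.
move=> mh; elim: s => [|i s IH].
  by under eq_fun do rewrite big_nil; rewrite big_nil Ex_cst.
by under eq_fun do rewrite big_cons; rewrite big_cons ExD ?IH//; exact: bm_sum.
Qed.

Lemma le_Ex X Y : bounded_measurable X -> bounded_measurable Y ->
  (forall w, X w <= Y w) -> Ex X <= Ex Y.
Proof. by move=> mX mY XY; apply: le_Rintegral => //; exact: bm_integrable. Qed.

Lemma Ex_ge0 X : (forall w, 0 <= X w) -> 0 <= Ex X.
Proof. by move=> X0; apply: Rintegral_ge0. Qed.

Lemma le_norm_Ex X : bounded_measurable X -> `|Ex X| <= Ex (fun w => `|X w|).
Proof. by move=> mX; apply: le_normr_Rintegral => //; exact: bm_integrable. Qed.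

End Expectation.

Lemma bm_comp (R : realType) d d' (T : measurableType d) (T' : measurableType d')
    (X : T -> T') (phi : T' -> R) :
  measurable_fun [set: T] X -> bounded_measurable phi ->
  bounded_measurable (fun w => phi (X w)).
Proof.
move=> mX [mphi [M hM]]; split; last by exists M.
exact: measurableT_comp.
Qed.

Section ProductExpectation.
Context (R : realType) d1 d2 (T1 : measurableType d1) (T2 : measurableType d2).
Variables (P1 : probability T1 R) (P2 : probability T2 R).

Lemma Ex_fubini (f : T1 * T2 -> R) : bounded_measurable f ->
  Ex ((P1 \x P2)%E : probability _ R) f = Ex P1 (fun x => Ex P2 (fun y => f (x, y))).
Proof.
move=> mf; rewrite /Ex /Rintegral; congr fine.
rewrite -integral12_prod_meas1; last first.
  exact: (@bm_integrable R _ _ ((P1 \x P2)%E : probability _ R)).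
apply: eq_integral => x _; rewrite -/(Rintegral P2 setT (fun y => f (x, y))).
rewrite -/(Ex P2 (fun y => f (x, y))) EFin_Ex//.
by apply: (bm_comp _ mf); exact: pair1_measurable.
Qed.

End ProductExpectation.

Section Independence.
Context (R : realType) d (T : measurableType d) (P : probability T R).

Lemma Ex_distribution d' (T' : measurableType d') (X : {mfun T >-> T'}) (phi : T' -> R) :
  bounded_measurable phi -> Ex (distribution P X) phi = Ex P (fun w => phi (X w)).
Proof.
move=> mphi; rewrite /Ex /Rintegral; congr fine.
rewrite integral_distribution//.
  by apply/measurable_EFinP; case: mphi.
by apply: (@bm_integrable _ _ _ P (phi \o X)); exact: (bm_comp _ mphi).
Qed.

(** The joint law agrees with the product law on rectangles, hence everywhere; Fubini then splits
    the expectation. *)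
Lemma Ex_indep d1 d2 (T1 : measurableType d1) (T2 : measurableType d2)
    (X : T -> T1) (U : T -> T2) (phi : T1 -> R) (psi : T2 -> R) :
  measurable_fun [set: T] X -> measurable_fun [set: T] U ->
  (forall A B, measurable A -> measurable B ->
    P (X @^-1` A `&` U @^-1` B) = (P (X @^-1` A) * P (U @^-1` B))%E) ->
  bounded_measurable phi -> bounded_measurable psi ->
  Ex P (fun w => phi (X w) * psi (U w)) =
    Ex P (fun w => phi (X w)) * Ex P (fun w => psi (U w)).
Proof.
move=> mX mU XU mphi mpsi.
pose X' : {mfun T >-> T1} := HB.pack X (isMeasurableFun.Build _ _ _ _ _ mX).
pose U' : {mfun T >-> T2} := HB.pack U (isMeasurableFun.Build _ _ _ _ _ mU).
have mXU : measurable_fun [set: T] (fun w => (X w, U w)).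
  exact: measurable_fun_pair.
pose XU' : {mfun T >-> (T1 * T2)%type} :=
  HB.pack (fun w => (X w, U w)) (isMeasurableFun.Build _ _ _ _ _ mXU).
have m12 : bounded_measurable (fun z : T1 * T2 => phi z.1 * psi z.2).
  by apply: bmM; [exact: (bm_comp _ mphi)|exact: (bm_comp _ mpsi)].
rewrite -(Ex_distribution X' mphi) -(Ex_distribution U' mpsi).
rewrite -(Ex_distribution XU' m12).
transitivity (Ex ((distribution P X' \x distribution P U')%E : probability _ R)
    (fun z : T1 * T2 => phi z.1 * psi z.2)).
  rewrite /Ex /Rintegral; congr fine; apply: eq_measure_integral => A mA _.
  apply/esym; apply: product_measure_unique => // A1 A2 mA1 mA2.
rewrite Ex_fubini//=.
under eq_fun do rewrite ExZ//.
under eq_fun do rewrite mulrC.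
by rewrite ExZ// mulrC.
Qed.

End Independence.

(** * Independence of one variable from functions of finitely many others *)

Section GeneratedSigmaAlgebra.
Context (R : realType) d (T : measurableType d) (P : probability T R).
Variables (I : eqType) (J : pred I) (u : I -> T -> R[i]).
Hypothesis u_RV : forall i, J i -> complex_RV (u i).
Hypothesis u_indep : mutually_independent P J u.
Implicit Type s : seq I.

Definition cylinder s : set (set T) :=
  [set A | exists2 B : I -> set (plane R), (forall i, measurable (B i)) &
    A = \big[setI/setT]_(i <- s) ((@toR2 R \o u i) @^-1` B i)].

(** A copy of T with the sigma-algebra generated by the u i for i in s; measurability on this copy
    expresses dependence on these variables alone. *)
Definition sigma_of s : measurableType _ := g_sigma_algebraType (cylinder s).

Lemma mem_big_setI (A : I -> set T) s w :
  (\big[setI/setT]_(i <- s) A i) w <-> (forall i, i \in s -> A i w).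
Proof.
elim: s => [|i s IH]; first by rewrite big_nil; split.
rewrite big_cons; split => [[Ai /IH h] j|h].
  by rewrite inE => /orP[/eqP->//|]; exact: h.
split; first by apply: h; rewrite mem_head.
by apply/IH => j js; apply: h; rewrite inE js orbT.
Qed.

Lemma measurable_preimage i (B : set (plane R)) : J i -> measurable B ->
  measurable ((@toR2 R \o u i) @^-1` B).
Proof. by move=> Ji mB; rewrite -[X in measurable X]setTI; exact: u_RV. Qed.

Lemma cylinder_setI s : setI_closed (cylinder s).
Proof.
move=> _ _ [B mB ->] [C mC ->]; exists (fun i => B i `&` C i).
  by move=> i; exact: measurableI.
by rewrite -big_split/=; apply: eq_bigr => i _; rewrite preimage_setI.
Qed.

Lemma cylinder_setT s : cylinder s [set: T].
Proof.
exists (fun=> setT) => //; apply/seteqP; split => // w _.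
by apply/mem_big_setI.
Qed.

Lemma cylinder_measurable s A : all J s -> cylinder s A -> measurable A.
Proof.
move=> Js [B mB ->]; elim: s Js => [|i s IH] /=; first by rewrite big_nil.
case/andP => Ji Js; rewrite big_cons; apply: measurableI; last exact: IH.
exact: measurable_preimage.
Qed.

Lemma measurable_id_sigma_of s : all J s ->
  measurable_fun [set: T] (idfun : T -> sigma_of s).
Proof.
move=> Js; apply: (@measurability _ _ T (sigma_of s) _ _ (cylinder s)) => //.
move=> _ [A cA <-]; rewrite setTI preimage_id.
exact: cylinder_measurable cA.
Qed.

Lemma sub_cylinder s s' A : {subset s <= s'} -> cylinder s A -> cylinder s' A.
Proof.
move=> ss' [B mB ->]; exists (fun i => if i \in s then B i else setT).
  by move=> i; case: ifP.
apply/seteqP; split => w /mem_big_setI h; apply/mem_big_setI => i.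
  by move=> _; case: ifPn => // /h.
by move=> is_; have := h i (ss' _ is_); rewrite is_.
Qed.

Lemma measurable_sigma_of_sub s s' : {subset s <= s'} ->
  measurable_fun [set: sigma_of s'] (idfun : sigma_of s' -> sigma_of s).
Proof.
move=> ss'; apply: (@measurability _ _ (sigma_of s') (sigma_of s) _ _ (cylinder s)) => //.
move=> _ [A cA <-]; rewrite setTI preimage_id.
by apply: sub_sigma_algebra; exact: sub_cylinder cA.
Qed.

Lemma measurable_sigma_of_coord s i : i \in s ->
  measurable_fun [set: sigma_of s] (@toR2 R \o u i : sigma_of s -> plane R).
Proof.
move=> si _ B mB; rewrite setTI; apply: sub_sigma_algebra.
exists (fun j => if j == i then B else setT).
  by move=> j; case: ifP.
apply/seteqP; split => w.
  by move=> h; apply/mem_big_setI => j js; case: ifP => // /eqP ->.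
by move=> /mem_big_setI/(_ i si); rewrite eqxx.
Qed.

(** Both sides are finite measures in B, one a restriction and the other a multiple of P. They agree
    on the cylinders, which are stable under intersection and generate. *)
Lemma indep_sigma_of i s (A : set (plane R)) (B : set (sigma_of s)) :
  uniq (i :: s) -> all J (i :: s) -> measurable A -> measurable B ->
  P ((@toR2 R \o u i) @^-1` A `&` B) = (P ((@toR2 R \o u i) @^-1` A) * P B)%E.
Proof.
move=> /andP[is_ us] /andP[Ji Js] mA mB.
set X := (@toR2 R \o u i) @^-1` A.
have mX : measurable X by exact: measurable_preimage.
have idm := measurable_id_sigma_of Js.
have PX : (0 <= fine (P X))%R by apply: fine_ge0.
pose m1 := mrestr P mX.
pose m2 := mscale (NngNum PX) P.
rewrite setIC -[LHS]/(m1 B).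
have m2E C : m2 C = (P X * P C)%E.
  by rewrite -[P X in RHS]fineK// fin_num_measure.
rewrite -m2E.
have sB : <<s cylinder s >> B by [].
apply: (@g_sigma_algebra_measure_unique _ _ _ (cylinder s) _ (fun=> setT)) sB.
- by move=> C cC; exact: cylinder_measurable cC.
- by move=> _; exact: cylinder_setT.
- by apply/seteqP; split => // w _; exists 0%N.
- exact: cylinder_setI.
- move=> _ [C mC ->]; apply: (etrans _ (esym (m2E _))); rewrite /m1 /= /mrestr.
  (* As i is not in s, the condition at i may be set to A, so that a single family of sets serves
     for i :: s. *)
  pose C' j := if j == i then A else C j.
  have CE : \big[setI/setT]_(j <- s) ((@toR2 R \o u j) @^-1` C j) =
            \big[setI/setT]_(j <- s) ((@toR2 R \o u j) @^-1` C' j).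
    rewrite big_seq [RHS]big_seq; apply: eq_bigr => j js; rewrite /C'.
    by case: eqP => // ji; rewrite -ji js in is_.
  have mC' j : measurable (C' j) by rewrite /C'; case: ifP.
  have us' : uniq (i :: s) by rewrite /= is_.
  have Js' : all J (i :: s) by rewrite /= Ji.
  have XE : X = (@toR2 R \o u i) @^-1` C' i by rewrite /C' eqxx.
  rewrite CE setIC.
  have := u_indep us' Js' mC'; rewrite !big_cons -XE => ->; congr (_ * _)%E.
  by rewrite (u_indep us Js mC').
- move=> _; rewrite /m1 /= /mrestr setTI.
  by rewrite (le_lt_trans (probability_le1 P mX)) ?ltry.
Qed.

Definition depends_on s (Y : T -> R) : Prop :=
  @bounded_measurable R _ (sigma_of s) Y.

Lemma depends_on_sub s s' Y : {subset s <= s'} -> depends_on s Y -> depends_on s' Y.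
Proof. by move=> ss'; exact: (bm_comp (measurable_sigma_of_sub ss')). Qed.

Lemma depends_on_bm s Y : all J s -> depends_on s Y -> bounded_measurable Y.
Proof. by move=> Js; exact: (bm_comp (measurable_id_sigma_of Js)). Qed.

Lemma Ex_indep_depends_on i s (phi : plane R -> R) Y :
  uniq (i :: s) -> all J (i :: s) -> bounded_measurable phi -> depends_on s Y ->
  Ex P (fun w => phi (toR2 (u i w)) * Y w) =
    Ex P (fun w => phi (toR2 (u i w))) * Ex P Y.
Proof.
move=> us Js mphi mY; have /andP[Ji Js'] := Js.
apply: (@Ex_indep _ _ _ P _ _ _ (sigma_of s) (@toR2 R \o u i) idfun) => //.
- exact: u_RV.
- exact: measurable_id_sigma_of.
- by move=> A B mA mB; exact: (indep_sigma_of us Js mA mB).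
Qed.

End GeneratedSigmaAlgebra.

(** * The heat kernel of the plane *)

Section ExponentialBounds.
Variable R : realType.
Implicit Types (f df : R -> R) (x p a e : R).

(** Differentiation lowers the order of a Taylor remainder, so the bounds below are deduced one from
    another. *)
Lemma ge0_of_derive f df : (forall x, is_derive x 1 f (df x)) ->
  (forall x, 0 <= x -> 0 <= df x) -> f 0 = 0 -> forall x, 0 <= x -> 0 <= f x.
Proof.
move=> fdf df0 f0 x; rewrite le_eqVlt => /predU1P[<-|x0]; first by rewrite f0.
have cf : {within `[0, x], continuous f}.
  apply: continuous_subspaceT => y.
  by apply: differentiable_continuous; apply/derivable1_diffP; apply: ex_derive.
have [c /[!in_itv]/= /andP[c0 _]] := MVT x0 (fun y _ => fdf y) cf.
by rewrite f0 !subr0 => ->; rewrite mulr_ge0 ?df0 ?ltW.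
Qed.

Lemma expR_ge2 x : 0 <= x -> 1 + x + x ^+ 2 / 2 <= expR x.
Proof.
move=> x0; rewrite -subr_ge0; move: x x0.
apply: (@ge0_of_derive _ (fun x => expR x - (1 + x))).
- move=> x; apply: is_derive_eq; rewrite /GRing.scale/=; lra.
- by move=> x _; rewrite subr_ge0 expR_ge1Dx.
- by rewrite expR0; lra.
Qed.

Lemma expR_le1 x : 0 <= x -> expR x - 1 <= x * expR x.
Proof.
move=> x0; have := expR_ge1Dx (- x); rewrite expRN => h.
have := ler_wpM2r (expR_ge0 x) h; rewrite mulVf ?gt_eqF ?expR_gt0//; lra.
Qed.

Lemma expR_le2 x : 0 <= x -> expR x - 1 - x <= x ^+ 2 * expR x.
Proof. by move=> x0; have := expR_le1 x0; have := expR_ge1Dx x; nra. Qed.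

Lemma expR_le3 x : 0 <= x -> expR x <= 1 + x + x ^+ 2 / 2 + x ^+ 3 * expR x.
Proof.
move=> x0; rewrite -subr_ge0; move: x x0.
apply: (@ge0_of_derive _ (fun x => 1 + x + 3 * x ^+ 2 * expR x + x ^+ 3 * expR x - expR x)).
- move=> x; apply: is_derive_eq; rewrite /GRing.scale/=; lra.
- move=> x x0; have := expR_le2 x0.
  have := mulr_ge0 (exprn_ge0 2 x0) (expR_ge0 x).
  by have := mulr_ge0 (exprn_ge0 3 x0) (expR_ge0 x); lra.
- by rewrite expR0; lra.
Qed.

Lemma expRN_le2 x : 0 <= x -> expR (- x) <= 1 - x + x ^+ 2 / 2.
Proof.
move=> x0; rewrite -subr_ge0; move: x x0.
apply: (@ge0_of_derive _ (fun x => expR (- x) - (1 - x))).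
- move=> x; apply: is_derive_eq; rewrite /GRing.scale/=; lra.
- by move=> x _; rewrite subr_ge0 expR_ge1Dx.
- by rewrite oppr0 expR0; lra.
Qed.

Lemma expRN_ge3 x : 0 <= x -> 1 - x + x ^+ 2 / 2 - x ^+ 3 <= expR (- x).
Proof.
move=> x0; rewrite -subr_ge0; move: x x0.
apply: (@ge0_of_derive _ (fun x => 1 - x + 3 * x ^+ 2 - expR (- x))).
- move=> x; apply: is_derive_eq; rewrite /GRing.scale/=; lra.
- by move=> x x0; have := expRN_le2 x0; have := sqr_ge0 x; lra.
- by rewrite oppr0 expR0; lra.
Qed.

Lemma expR_taylor2 p :
  `|expR p - (1 + p + p ^+ 2 / 2)| <= `|p| ^+ 3 * expR `|p|.
Proof.
have [p0|/ltW p0] := leP 0 p.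
  rewrite (ger0_norm p0) ler_norml; apply/andP; split.
    by have := expR_ge2 p0; have := mulr_ge0 (exprn_ge0 3 p0) (expR_ge0 p); lra.
  by have := expR_le3 p0; lra.
rewrite (ler0_norm p0).
have : 0 <= - p by rewrite oppr_ge0.
set x := - p => x0; have -> : p = - x by rewrite opprK.
have E1 : x ^+ 3 <= x ^+ 3 * expR x.
  rewrite ler_peMr ?exprn_ge0//; apply: le_trans (expR_ge1Dx x); lra.
rewrite ler_norml; apply/andP; split; first by have := expRN_ge3 x0; lra.
by have := expRN_le2 x0; have := exprn_ge0 3 x0; lra.
Qed.

Lemma expRN_moment0 a : 0 <= a -> expR (- a) * a <= 1.
Proof.
move=> a0; rewrite expRN mulrC ler_pdivrMr ?expR_gt0// mul1r.
by have := expR_ge1Dx a; lra.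
Qed.

(** Half of the Gaussian decay absorbs the polynomial factor; the other half is left for the
    exponential in the Taylor remainder. *)
Lemma expRN_moment2 a : 0 <= a -> expR (- (a / 2)) * (1 + a + a ^+ 2) <= 8.
Proof.
move=> a0; rewrite expRN mulrC ler_pdivrMr ?expR_gt0//.
have a20 : 0 <= a / 2 by lra.
by have := expR_ge2 a20; nra.
Qed.

Lemma expRN_lip a a' : 0 <= a -> a <= a' -> expR (- a) - expR (- a') <= expR (- a) * (a' - a).
Proof.
move=> a0 aa'.
have -> : expR (- a') = expR (- a) * expR (- (a' - a)).
  by rewrite -expRD; congr expR; lra.
have := expR_ge1Dx (- (a' - a)); have := expR_gt0 (- a); nra.
Qed.

End ExponentialBounds.

(** * Expansion of the heat kernel under a small displacement, in real variables *)

Section HeatStep.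
Variable R : realType.
Implicit Types (b h r : R).

Let moment1 b : 0 <= b -> expR (- b ^+ 2) * b <= 1.
Proof.
move=> b0; rewrite expRN mulrC ler_pdivrMr ?expR_gt0// mul1r.
by have := expR_ge1Dx (b ^+ 2); nra.
Qed.

Let quadratic_le b h r : 0 <= b -> 0 <= h -> `|r| <= b * h ->
  `|2 * r ^+ 2 - b ^+ 2 * h ^+ 2| <= b ^+ 2 * h ^+ 2.
Proof.
move=> b0 h0 rbh.
have r2 : r ^+ 2 <= b ^+ 2 * h ^+ 2.
  by rewrite -exprMn -(real_normK (num_real r)) lerXn2r// nnegrE mulr_ge0.
by have := sqr_ge0 r; rewrite ler_norml; lra.
Qed.

Lemma heat_step_large b h r : 0 <= b -> 1 <= h -> `|r| <= b * h ->
  `|expR (2 * r - b ^+ 2 - h ^+ 2)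
    - expR (- (b ^+ 2 / (1 + h ^+ 2))) / (1 + h ^+ 2)
    - expR (- b ^+ 2) * (2 * r + (2 * r ^+ 2 - b ^+ 2 * h ^+ 2))| <= 6 * h ^+ 3.
Proof.
move=> b0 h1 rbh; have h0 : 0 <= h by lra.
have X1 : expR (2 * r - b ^+ 2 - h ^+ 2) <= 1.
  rewrite -[leRHS]expR0 ler_expR; have := ler_norm r; have := sqr_ge0 (b - h); lra.
have X0 := expR_ge0 (2 * r - b ^+ 2 - h ^+ 2).
have h2 : 0 <= h ^+ 2 := sqr_ge0 h.
have Y1 : expR (- (b ^+ 2 / (1 + h ^+ 2))) / (1 + h ^+ 2) <= 1.
  rewrite ler_pdivrMr ?mul1r; last lra.
  apply: (@le_trans _ _ 1); last lra.
  by rewrite -[leRHS]expR0 ler_expR oppr_le0 divr_ge0 ?sqr_ge0//; lra.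
have Y0 : 0 <= expR (- (b ^+ 2 / (1 + h ^+ 2))) / (1 + h ^+ 2).
  by rewrite divr_ge0 ?expR_ge0//; lra.
have Z : `|expR (- b ^+ 2) * (2 * r + (2 * r ^+ 2 - b ^+ 2 * h ^+ 2))| <= 2 * h + h ^+ 2.
  rewrite normrM (ger0_norm (expR_ge0 _)).
  apply: (@le_trans _ _ (expR (- b ^+ 2) * (2 * (b * h) + b ^+ 2 * h ^+ 2))).
    apply: ler_wpM2l; first exact: expR_ge0.
    apply: le_trans (ler_normD _ _) _; apply: lerD; last exact: quadratic_le.
    by rewrite normrM ger0_norm// ler_wpM2l.
  have := ler_wpM2r h0 (moment1 b0).
  have := ler_wpM2r h2 (expRN_moment0 (sqr_ge0 b)); lra.
have h3 : h <= h ^+ 3 /\ h ^+ 2 <= h ^+ 3 /\ 1 <= h ^+ 3.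
  have h12 : 1 <= h ^+ 2 by rewrite exprn_ege1.
  by split; [|split]; rewrite ?exprn_ege1//; rewrite exprS ?exprS; nra.
by move: Z; rewrite !ler_norml => /andP[Z1 Z2]; lra.
Qed.

(** With a = b^2, e = h^2 and p = 2 r - e, the difference splits into the Taylor remainder of exp p
    ([D1]), the part of p^2 / 2 of order h^3 ([D2]), and the error in expanding the kernel at the
    later time to first order in e ([D3]). *)
Lemma heat_step_small b h r : 0 <= b -> 0 <= h -> h <= 1 -> `|r| <= b * h ->
  `|expR (2 * r - b ^+ 2 - h ^+ 2)
    - expR (- (b ^+ 2 / (1 + h ^+ 2))) / (1 + h ^+ 2)
    - expR (- b ^+ 2) * (2 * r + (2 * r ^+ 2 - b ^+ 2 * h ^+ 2))|
  <= (152 * expR 3 + 16) * h ^+ 3.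
Proof.
move=> b0 h0 h1 rbh; set a := b ^+ 2; set e := h ^+ 2.
have a0 : 0 <= a := sqr_ge0 b; have e0 : 0 <= e := sqr_ge0 h.
have e1 : e <= 1 by rewrite /e expr_le1.
have eh : e ^+ 2 <= h ^+ 3.
  by rewrite /e -exprM ler_wiXn2l.
have E0 := expR_ge0 (- a).
set p := 2 * r - e.
have XE : expR (2 * r - a - e) = expR (- a) * expR p.
  by rewrite -expRD; congr expR; rewrite /p; lra.
have D1 : `|expR (- a) * (expR p - (1 + p + p ^+ 2 / 2))| <= 152 * expR 3 * h ^+ 3.
  rewrite normrM (ger0_norm E0).
  apply: le_trans (ler_wpM2l E0 (expR_taylor2 p)) _.
  have ple : `|p| <= h * (2 * b + 1).
    rewrite /p; apply: le_trans (ler_normB _ _) _.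
    rewrite normrM (ger0_norm e0) ger0_norm//.
    have eh1 : e <= h by rewrite /e expr2 ler_piMl.
    by lra.
  (* From 2 b h <= b^2 / 2 + 2 h^2, so that exp |p| uses up only half of the decay exp(- a). *)
  have ple2 : `|p| <= a / 2 + 3.
    rewrite /p; apply: le_trans (ler_normB _ _) _.
    rewrite normrM (ger0_norm e0) ger0_norm// /a /e.
    have := sqr_ge0 (b - 2 * h); have : h ^+ 2 <= 1 by []; lra.
  have p3 : `|p| ^+ 3 <= h ^+ 3 * (19 * (1 + a + a ^+ 2)).
    apply: (@le_trans _ _ ((h * (2 * b + 1)) ^+ 3)).
      by rewrite lerXn2r// nnegrE ?normr_ge0//; apply: mulr_ge0 => //; lra.
    rewrite exprMn ler_wpM2l ?exprn_ge0// /a.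
    have := sqr_ge0 (b ^+ 2 - b); have := sqr_ge0 (b - 1); have := sqr_ge0 (b ^+ 2).
    by nra.
  have ep : expR `|p| <= expR (a / 2) * expR 3 by rewrite -expRD ler_expR.
  have Ea : expR (- a) * expR (a / 2) = expR (- (a / 2)).
    by rewrite -expRD; congr expR; lra.
  apply: (@le_trans _ _ (expR (- a) * (h ^+ 3 * (19 * (1 + a + a ^+ 2)) * (expR (a / 2) * expR 3)))).
    by apply: ler_wpM2l => //; apply: ler_pM => //; rewrite ?exprn_ge0 ?expR_ge0.
  have -> : expR (- a) * (h ^+ 3 * (19 * (1 + a + a ^+ 2)) * (expR (a / 2) * expR 3)) =
     (expR (- (a / 2)) * (1 + a + a ^+ 2)) * (19 * expR 3 * h ^+ 3).
    by rewrite -Ea; ring.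
  have -> : 152 * expR 3 * h ^+ 3 = 8 * (19 * expR 3 * h ^+ 3) by ring.
  apply: ler_wpM2r; last exact: expRN_moment2.
  by rewrite mulr_ge0 ?exprn_ge0// mulr_ge0// expR_ge0.
have D2 : `|expR (- a) * (- 2 * r * e + e ^+ 2 / 2)| <= 3 * h ^+ 3.
  rewrite normrM (ger0_norm E0).
  apply: (@le_trans _ _ (expR (- a) * (2 * b * h ^+ 3 + h ^+ 3))).
    apply: ler_wpM2l => //; apply: le_trans (ler_normD _ _) _; apply: lerD.
      have e20 : 0 <= 2 * e by lra.
      have -> : - 2 * r * e = - (r * (2 * e)) by ring.
      rewrite normrN normrM (ger0_norm e20).
      have -> : 2 * b * h ^+ 3 = b * h * (2 * e) by rewrite /e; ring.
      exact: ler_wpM2r.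
    rewrite ger0_norm; last by have := sqr_ge0 e; lra.
    by have := sqr_ge0 e; lra.
  have h3 : 0 <= h ^+ 3 by exact: exprn_ge0.
  have := ler_wpM2r h3 (moment1 b0).
  have : expR (- a) <= 1 by rewrite -[leRHS]expR0 ler_expR; lra.
  move/(ler_wpM2r h3); rewrite -/a; lra.
have D3 : `|expR (- (a / (1 + e))) / (1 + e) - expR (- a) * (1 - e + a * e)| <= 13 * h ^+ 3.
  set x := a * e / (1 + e).
  have e1_gt0 : 0 < 1 + e by lra.
  have YE : expR (- (a / (1 + e))) = expR (- a) * expR x.
    rewrite -expRD; congr expR; rewrite /x; field; lra.
  have x0 : 0 <= x by rewrite divr_ge0 ?mulr_ge0//; lra.
  have ae : a * e <= a by rewrite ler_piMr.
  have ae0 : 0 <= a * e by exact: mulr_ge0.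
  have aee0 : 0 <= a * e * e by exact: mulr_ge0.
  have xa : x <= a / 2 by rewrite /x ler_pdivrMr//; lra.
  have xae : x <= a * e by rewrite /x ler_pdivrMr//; lra.
  have T1 : `|expR (- a) * (expR x - (1 + x)) / (1 + e)| <= 8 * e ^+ 2.
    have t0 : 0 <= expR x - (1 + x) by rewrite subr_ge0 expR_ge1Dx.
    rewrite ger0_norm; last by rewrite divr_ge0 ?mulr_ge0//; lra.
    have q0 : 0 <= expR (- a) * (x ^+ 2 * expR x).
      exact: mulr_ge0 E0 (mulr_ge0 (sqr_ge0 x) (expR_ge0 x)).
    apply: (@le_trans _ _ (expR (- a) * (x ^+ 2 * expR x))).
      rewrite ler_pdivrMr//; apply: (@le_trans _ _ (expR (- a) * (x ^+ 2 * expR x))).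
        by apply: ler_wpM2l => //; have := expR_le2 x0; lra.
      by rewrite ler_peMr//; lra.
    have -> : expR (- a) * (x ^+ 2 * expR x) = x ^+ 2 * expR (x - a).
      by rewrite expRD; ring.
    apply: (@le_trans _ _ ((a * e) ^+ 2 * expR (- (a / 2)))).
      apply: ler_pM; rewrite ?sqr_ge0 ?expR_ge0//.
        by rewrite lerXn2r// nnegrE mulr_ge0.
      by rewrite ler_expR; lra.
    have -> : (a * e) ^+ 2 * expR (- (a / 2)) = (expR (- (a / 2)) * a ^+ 2) * e ^+ 2 by ring.
    apply: ler_wpM2r; first exact: sqr_ge0.
    apply: le_trans (expRN_moment2 a0).
    by apply: ler_wpM2l; [exact: expR_ge0|lra].
  have T2 : `|expR (- a) * ((1 + x) / (1 + e) - (1 - e + a * e))| <= 5 * e ^+ 2.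
    rewrite normrM (ger0_norm E0).
    have -> : (1 + x) / (1 + e) - (1 - e + a * e) =
        e ^+ 2 * ((1 + e - 2 * a - a * e) / (1 + e) ^+ 2).
      by rewrite /x; field; lra.
    rewrite normrM (ger0_norm (sqr_ge0 e)) mulrCA mulrC.
    apply: ler_wpM2r; first exact: sqr_ge0.
    apply: (@le_trans _ _ (expR (- a) * (2 + 3 * a))).
      apply: ler_wpM2l => //.
      rewrite normrM normfV (ger0_norm (sqr_ge0 (1 + e))) ler_pdivrMr ?exprn_gt0//.
      apply: (@le_trans _ _ (2 + 3 * a)); first by rewrite ler_norml; lra.
      by rewrite ler_peMr ?exprn_ege1//; lra.
    have := expRN_moment0 a0.
    have : expR (- a) <= 1 by rewrite -[leRHS]expR0 ler_expR; lra.
    lra.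
  have -> : expR (- (a / (1 + e))) / (1 + e) - expR (- a) * (1 - e + a * e) =
     expR (- a) * (expR x - (1 + x)) / (1 + e) +
     expR (- a) * ((1 + x) / (1 + e) - (1 - e + a * e)).
    by rewrite YE; field; lra.
  apply: le_trans (ler_normD _ _) _; lra.
rewrite XE.
have -> : expR (- a) * expR p - expR (- (a / (1 + e))) / (1 + e) -
    expR (- a) * (2 * r + (2 * r ^+ 2 - a * e)) =
  expR (- a) * (expR p - (1 + p + p ^+ 2 / 2)) +
  (expR (- a) * (- 2 * r * e + e ^+ 2 / 2) -
   (expR (- (a / (1 + e))) / (1 + e) - expR (- a) * (1 - e + a * e))).
  by rewrite /p; lra.
apply: le_trans (ler_normD _ _) _; rewrite mulrDl; apply: lerD => //.
by apply: le_trans (ler_normB _ _) _; lra.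
Qed.

Definition heat_const : R := 152 * expR 3 + 16.

Lemma heat_step_real b h r : 0 <= b -> 0 <= h -> `|r| <= b * h ->
  `|expR (2 * r - b ^+ 2 - h ^+ 2)
    - expR (- (b ^+ 2 / (1 + h ^+ 2))) / (1 + h ^+ 2)
    - expR (- b ^+ 2) * (2 * r + (2 * r ^+ 2 - b ^+ 2 * h ^+ 2))|
  <= heat_const * h ^+ 3.
Proof.
move=> b0 h0 rbh; have [h1|/ltW h1] := leP h 1; first exact: heat_step_small.
apply: le_trans (heat_step_large b0 h1 rbh) _.
by apply: ler_wpM2r; [exact: exprn_ge0|rewrite /heat_const; have := expR_ge0 (3 : R); lra].
Qed.

End HeatStep.

Section Normsq.
Variable R : realType.
Implicit Types z w : R[i].

Definition normsq z : R := complex.Re z ^+ 2 + complex.Im z ^+ 2.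

Lemma normsq_ge0 z : 0 <= normsq z.
Proof. by rewrite addr_ge0 ?sqr_ge0. Qed.

Lemma normsqM z w : normsq (z * w) = normsq z * normsq w.
Proof. by case: z w => [a b] [c d]; rewrite /normsq/=; ring. Qed.

Lemma normsq_conj z : normsq z^*%C = normsq z.
Proof. by case: z => [a b]; rewrite /normsq/=; ring. Qed.

Lemma mul_conjc z : z * z^*%C = (normsq z)%:C%C.
Proof. by case: z => [a b]; apply/eqP; rewrite eq_complex /normsq/=; apply/andP; split; apply/eqP; ring. Qed.

Lemma Re_sqr z : complex.Re (z ^+ 2) = 2 * complex.Re z ^+ 2 - normsq z.
Proof. by case: z => [a b]; rewrite /normsq/=; ring. Qed.

Lemma normsqB z w : normsq (z - w) = normsq z - 2 * complex.Re (z^*%C * w) + normsq w.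
Proof. by case: z w => [a b] [c d]; rewrite /normsq/=; ring. Qed.

Lemma Re_sqr_le z : complex.Re z ^+ 2 <= normsq z.
Proof. by rewrite lerDl sqr_ge0. Qed.

Lemma normsqZ (r : R) z : normsq (r%:C%C * z) = r ^+ 2 * normsq z.
Proof. by case: z => [a b]; rewrite /normsq/=; ring. Qed.

End Normsq.

Section Heat.
Variable R : realType.
Implicit Types (z c f : R[i]) (s t : R).

Definition heat s z : R := expR (- (normsq z / s)) / s.

Lemma heat_ge0 s z : 0 < s -> 0 <= heat s z.
Proof. by move=> s0; rewrite divr_ge0 ?expR_ge0// ltW. Qed.

(* The subtracted terms have mean 0 when [f] is uniform on the circle, so that
   averaging over [f] advances the heat flow by the time [normsq c]. *)
Lemma heat_step s z c f : 0 < s -> normsq f = 1 ->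
  `|heat s (z - c * f) - heat (s + normsq c) z
    - heat s z * (2 * complex.Re (z^*%C * c * f) / s + complex.Re ((z^*%C * c * f) ^+ 2) / s ^+ 2)|
  <= heat_const R * Num.sqrt (normsq c / s) ^+ 3 / s.
Proof.
move=> s0 f1; set b := Num.sqrt (normsq z / s); set h := Num.sqrt (normsq c / s).
have s_neq0 : s != 0 by rewrite gt_eqF.
have zs0 : 0 <= normsq z / s by rewrite divr_ge0 ?normsq_ge0// ltW.
have cs0 : 0 <= normsq c / s by rewrite divr_ge0 ?normsq_ge0// ltW.
have b2 : b ^+ 2 = normsq z / s by rewrite sqr_sqrtr.
have h2 : h ^+ 2 = normsq c / s by rewrite sqr_sqrtr.
set y := z^*%C * c * f; set r := complex.Re y / s.
have y2 : normsq y = normsq z * normsq c by rewrite !normsqM normsq_conj f1 mulr1.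
have bh0 : 0 <= b * h by rewrite mulr_ge0 ?sqrtr_ge0.
have rbh : `|r| <= b * h.
  rewrite -(ger0_norm bh0) -ler_sqr ?nnegrE ?normr_ge0// !real_normK ?num_real//.
  rewrite [(b * h) ^+ 2]exprMn b2 h2 /r expr_div_n.
  have -> : normsq z / s * (normsq c / s) = normsq y / s ^+ 2 by rewrite y2; field.
  by rewrite ler_pM2r ?Re_sqr_le// invr_gt0 exprn_gt0.
have := heat_step_real (sqrtr_ge0 _ : 0 <= b) (sqrtr_ge0 _ : 0 <= h) rbh.
rewrite !b2 h2.
have -> : heat s (z - c * f) = expR (2 * r - normsq z / s - normsq c / s) / s.
  rewrite /heat normsqB normsqM f1 mulr1 mulrA -/y /r; congr (expR _ / s); field => //.
have scE : s * (1 + normsq c / s) = s + normsq c by field.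
have sc0 : 0 < 1 + normsq c / s by lra.
have -> : heat (s + normsq c) z =
    expR (- (normsq z / s / (1 + normsq c / s))) / (1 + normsq c / s) / s.
  rewrite /heat -scE -mulrA; congr (expR (- _) * _).
    by rewrite invfM mulrA.
  by rewrite invfM mulrC.
have -> : heat s z * (2 * complex.Re y / s + complex.Re (y ^+ 2) / s ^+ 2) =
  expR (- (normsq z / s)) * (2 * r + (2 * r ^+ 2 - normsq z / s * (normsq c / s))) / s.
  rewrite /heat Re_sqr y2 /r; field => //.
rewrite -!mulrBl normrM normfV (gtr0_norm s0) => H.
by rewrite ler_wpM2r// invr_ge0 ltW.
Qed.

(** In the variable x = 1/s the kernel is x exp(- n x) with n = |z|^2, whose derivative is at most 1
    in absolute value for all n >= 0; hence uniformity in z. *)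
Lemma heat_lip_time s t z : 0 < s -> 0 < t ->
  `|heat s z - heat t z| <= `|s^-1 - t^-1|.
Proof.
have H s' t' : 0 < s' -> s' <= t' -> `|heat s' z - heat t' z| <= `|s'^-1 - t'^-1|.
  move=> s0 st; have t0 : 0 < t' := lt_le_trans s0 st.
  set x := s'^-1; set y := t'^-1; set n := normsq z.
  have yx : y <= x by rewrite /x /y lef_pV2.
  have y0 : 0 <= y by rewrite /y invr_ge0 ltW.
  have n0 : 0 <= n := normsq_ge0 z.
  rewrite [leRHS]ger0_norm ?subr_ge0// /heat -/x -/y -/n.
  have ny0 : 0 <= n * y by exact: mulr_ge0.
  have nyx : n * y <= n * x by exact: ler_wpM2l.
  have E1 : expR (- (n * x)) <= 1 by rewrite -[leRHS]expR0 ler_expR; lra.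
  have E0 := expR_ge0 (- (n * x)).
  have L : expR (- (n * x)) <= expR (- (n * y)) by rewrite ler_expR lerN2.
  have L2 := expRN_lip ny0 nyx.
  have M := expRN_moment0 ny0.
  rewrite ler_norml; apply/andP; split.
    have : expR (- (n * y)) * y - expR (- (n * x)) * y <= (x - y) * (expR (- (n * y)) * (n * y)).
      have := ler_wpM2r y0 L2; lra.
    have xy0 : 0 <= x - y by lra.
    have := ler_wpM2l xy0 M. 
    have := ler_wpM2l E0 yx; lra.
  have xy0 : 0 <= x - y by lra.
  have := ler_wpM2r xy0 E1; have := ler_wpM2r y0 L; lra.
move=> s0 t0; have [st|/ltW ts] := leP s t; first exact: H.
by rewrite distrC [leRHS]distrC; exact: H.
Qed.

(** The bound is quadratic in z - w, at the price of a free parameter t, so that averaging it takes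
    a second moment only. *)
Lemma heat_lip_space s z w t : 0 < s -> 0 < t ->
  `|heat s z - heat s w| <= (t + (1 + t^-1) * (normsq (z - w) / s)) / s.
Proof.
move=> s0 t0.
have t_neq0 : t != 0 by rewrite gt_eqF.
have H z' w' : normsq z' <= normsq w' ->
    `|heat s z' - heat s w'| <= (t + (1 + t^-1) * (normsq (z' - w') / s)) / s.
  move=> zw; rewrite /heat -mulrBl normrM normfV (gtr0_norm s0) ler_wpM2r ?invr_ge0 ?(ltW s0)//.
  have a0 : 0 <= normsq z' / s by rewrite divr_ge0 ?normsq_ge0// ltW.
  have aa : normsq z' / s <= normsq w' / s by rewrite ler_wpM2r// invr_ge0 ltW.
  have E0 := expR_ge0 (- (normsq z' / s)).
  rewrite ger0_norm; last by rewrite subr_ge0 ler_expR lerN2.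
  apply: le_trans (expRN_lip a0 aa) _.
  have dE : normsq w' / s - normsq z' / s <=
      t * (normsq z' / s) + (1 + t^-1) * (normsq (z' - w') / s).
    have -> : (1 + t^-1) * (normsq (z' - w') / s) = ((1 + t^-1) * normsq (z' - w')) / s by ring.
    rewrite -mulrBl mulrA -mulrDl ler_wpM2r ?invr_ge0 ?(ltW s0)//.
    case: z' w' {zw aa a0 E0} => [p q] [p' q']; rewrite /normsq/=.
    have young (x y : R) : 2 * x * y <= t * x ^+ 2 + t^-1 * y ^+ 2.
      rewrite -subr_ge0.
      have -> : t * x ^+ 2 + t^-1 * y ^+ 2 - 2 * x * y = t^-1 * (t * x - y) ^+ 2 by field.
      by rewrite mulr_ge0 ?sqr_ge0// invr_ge0 ltW.
    have := young p (p' - p); have := young q (q' - q).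
    have -> : (p - p') ^+ 2 + (q - q') ^+ 2 = (p' - p) ^+ 2 + (q' - q) ^+ 2 by ring.
    rewrite mulrDl mul1r mulrDr; lra.
  apply: le_trans (ler_wpM2l E0 dE) _; rewrite mulrDr; apply: lerD.
    by rewrite mulrCA ler_piMr ?(ltW t0)// expRN_moment0.
  have u0 : 0 <= (1 + t^-1) * (normsq (z' - w') / s).
    by rewrite mulr_ge0 ?divr_ge0 ?normsq_ge0 ?(ltW s0)// addr_ge0// invr_ge0 ltW.
  by apply: ler_piMl => //; rewrite -[leRHS]expR0 ler_expR oppr_le0.
have [zw|/ltW zw] := leP (normsq z) (normsq w); first exact: H.
rewrite distrC (_ : normsq (z - w) = normsq (w - z)); first exact: H.
by case: z w {zw} => [a b] [c d]; rewrite /normsq/=; ring.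
Qed.

End Heat.

(** * Lindeberg replacement for unimodular variables *)

Section BoundedMeasurableFunctions.
Context (R : realType) (d : measure_display) (T : measurableType d).
Implicit Types (X Y : T -> R) (Z W : T -> R[i]).

Lemma bm_expR X : bounded_measurable X -> bounded_measurable (fun w => expR (X w)).
Proof.
move=> [mX [M hM]]; split; first exact: measurableT_comp.
exists (expR M) => w; rewrite ger0_norm ?expR_ge0// ler_expR.
exact: le_trans (ler_norm _) (hM w).
Qed.

Lemma bm_inv X e : 0 < e -> (forall w, e <= X w) -> bounded_measurable X ->
  bounded_measurable (fun w => (X w)^-1).
Proof.
move=> e0 eX [mX [M hM]].
have inve : measurable_fun [set: R] (fun x : R => (e + `|x|)^-1).
  apply: continuous_measurable_fun => x.
  apply: cvgV; first by rewrite gt_eqF// ltr_wpDr.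
  by apply: cvgD; [exact: cvg_cst|apply: cvg_norm; exact: cvg_id].
have XE w : X w = e + `|X w - e| by rewrite ger0_norm ?subr_ge0//; ring.
split.
  under eq_fun do rewrite XE.
  apply: (measurableT_comp inve).
  by apply: measurable_funB => //.
exists e^-1 => w; have Xw0 : 0 < X w := lt_le_trans e0 (eX w).
by rewrite ger0_norm ?invr_ge0 ?(ltW Xw0)// lef_pV2.
Qed.

Definition cbm Z : Prop := bounded_measurable (fun w => complex.Re (Z w)) /\
  bounded_measurable (fun w => complex.Im (Z w)).

Lemma cbm_cst (z : R[i]) : cbm (fun=> z).
Proof. by split; exact: bm_cst. Qed.

Lemma cbm_real X : bounded_measurable X -> cbm (fun w => (X w)%:C%C).
Proof. by move=> mX; split => //; exact: bm_cst. Qed.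

Lemma ReD (z w : R[i]) : complex.Re (z + w) = complex.Re z + complex.Re w.
Proof. by case: z w => [? ?] []. Qed.
Lemma ImD (z w : R[i]) : complex.Im (z + w) = complex.Im z + complex.Im w.
Proof. by case: z w => [? ?] []. Qed.
Lemma ReM (z w : R[i]) : complex.Re (z * w) =
  complex.Re z * complex.Re w - complex.Im z * complex.Im w.
Proof. by case: z w => [? ?] []. Qed.
Lemma ImM (z w : R[i]) : complex.Im (z * w) =
  complex.Re z * complex.Im w + complex.Im z * complex.Re w.
Proof. by case: z w => [? ?] []. Qed.
Lemma ReJ (z : R[i]) : complex.Re z^*%C = complex.Re z.
Proof. by case: z. Qed.
Lemma ImJ (z : R[i]) : complex.Im z^*%C = - complex.Im z.
Proof. by case: z. Qed.

Lemma cbmD Z W : cbm Z -> cbm W -> cbm (fun w => Z w + W w).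
Proof.
move=> [Z1 Z2] [W1 W2]; split.
  by under eq_fun do rewrite ReD; exact: bmD.
by under eq_fun do rewrite ImD; exact: bmD.
Qed.

Lemma cbmM Z W : cbm Z -> cbm W -> cbm (fun w => Z w * W w).
Proof.
move=> [Z1 Z2] [W1 W2]; split.
  by under eq_fun do rewrite ReM; apply: bmB; exact: bmM.
by under eq_fun do rewrite ImM; apply: bmD; exact: bmM.
Qed.

Lemma cbmJ Z : cbm Z -> cbm (fun w => (Z w)^*%C).
Proof.
move=> [Z1 Z2]; split; first by under eq_fun do rewrite ReJ.
by under eq_fun do rewrite ImJ; exact: bmN.
Qed.

Lemma cbmB Z W : cbm Z -> cbm W -> cbm (fun w => Z w - W w).
Proof.
move=> mZ mW; have := cbmD mZ (cbmM (cbm_cst (-1)) mW).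
by under eq_fun do rewrite mulN1r.
Qed.

Lemma cbmX Z n : cbm Z -> cbm (fun w => Z w ^+ n).
Proof.
move=> mZ; elim: n => [|n IH]; first by under eq_fun do rewrite expr0; exact: cbm_cst.
by under eq_fun do rewrite exprS; exact: cbmM.
Qed.

Lemma cbm_sum (I : eqType) (s : seq I) (Q : pred I) (h : I -> T -> R[i]) :
  (forall i, i \in s -> Q i -> cbm (h i)) -> cbm (fun w => \sum_(i <- s | Q i) h i w).
Proof.
elim: s => [|i s IH] mh; first by under eq_fun do rewrite big_nil; exact: cbm_cst.
have IH' : cbm (fun w => \sum_(i <- s | Q i) h i w).
  by apply: IH => j js; apply: mh; rewrite inE js orbT.
have [Qi|Qi] := boolP (Q i); last by under eq_fun do rewrite big_cons (negbTE Qi).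
under eq_fun do rewrite big_cons Qi.
by apply: cbmD => //; apply: mh; rewrite ?mem_head.
Qed.

Lemma cbm_prod (I : eqType) (s : seq I) (Q : pred I) (h : I -> T -> R[i]) :
  (forall i, i \in s -> Q i -> cbm (h i)) -> cbm (fun w => \prod_(i <- s | Q i) h i w).
Proof.
elim: s => [|i s IH] mh; first by under eq_fun do rewrite big_nil; exact: cbm_cst.
have IH' : cbm (fun w => \prod_(i <- s | Q i) h i w).
  by apply: IH => j js; apply: mh; rewrite inE js orbT.
have [Qi|Qi] := boolP (Q i); last by under eq_fun do rewrite big_cons (negbTE Qi).
under eq_fun do rewrite big_cons Qi.
by apply: cbmM => //; apply: mh; rewrite ?mem_head.
Qed.

Lemma bm_normsq Z : cbm Z -> bounded_measurable (fun w => normsq (Z w)).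
Proof. by move=> [Z1 Z2]; apply: bmD; exact: bmX. Qed.

Lemma bm_heat X Z e : 0 < e -> (forall w, e <= X w) -> bounded_measurable X ->
  cbm Z -> bounded_measurable (fun w => heat (X w) (Z w)).
Proof.
move=> e0 eX mX mZ; have iX := bm_inv e0 eX mX.
apply: bmM => //; apply: bm_expR; apply: bmN; apply: bmM => //.
exact: bm_normsq.
Qed.

End BoundedMeasurableFunctions.

(** * Orthogonality for independent variables on the unit circle *)

Section Unimodular.
Context (R : realType) d (T : measurableType d) (P : probability T R).
Variables (I : eqType) (J : pred I) (u : I -> T -> R[i]).
Hypothesis u_RV : forall i, J i -> complex_RV (u i).
Hypothesis u_indep : mutually_independent P J u.
Hypothesis u_unit : forall i w, J i -> normsq (u i w) = 1.
Hypothesis u_moment : forall i n, J i -> (0 < n)%N ->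
  Ex P (fun w => complex.Re (u i w ^+ n)) = 0 /\
  Ex P (fun w => complex.Im (u i w ^+ n)) = 0.
Implicit Type s : seq I.

Definition cdepends_on s (Z : T -> R[i]) : Prop := @cbm R _ (sigma_of u s) Z.

Lemma cdepends_on_sub s s' Z : {subset s <= s'} -> cdepends_on s Z -> cdepends_on s' Z.
Proof. by move=> ss' [Z1 Z2]; split; [exact: (depends_on_sub ss' Z1)|exact: (depends_on_sub ss' Z2)]. Qed.

Lemma cdepends_on_bm s Z : all J s -> cdepends_on s Z -> cbm Z.
Proof. by move=> Js [Z1 Z2]; split; [exact: (depends_on_bm u_RV Js Z1)|exact: (depends_on_bm u_RV Js Z2)]. Qed.

Lemma Re_norm_le (z : R[i]) : normsq z = 1 -> `|complex.Re z| <= 1.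
Proof.
move=> z1; rewrite -(@ler_pXn2r _ 2)// ?nnegrE// expr1n real_normK ?num_real//.
by rewrite -z1 Re_sqr_le.
Qed.

Lemma Im_norm_le (z : R[i]) : normsq z = 1 -> `|complex.Im z| <= 1.
Proof.
move=> z1; rewrite -(@ler_pXn2r _ 2)// ?nnegrE// expr1n real_normK ?num_real//.
by rewrite -z1 lerDr sqr_ge0.
Qed.

Lemma cdepends_on_coord s i : i \in s -> J i -> cdepends_on s (u i).
Proof.
move=> si Ji; have mu := @measurable_sigma_of_coord R d T I u s i si.
split; split.
- exact: (measurableT_comp (@measurable_fst _ _ _ _) mu).
- by exists 1 => w; apply: Re_norm_le; exact: u_unit.
- exact: (measurableT_comp (@measurable_snd _ _ _ _) mu).
- by exists 1 => w; apply: Im_norm_le; exact: u_unit.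
Qed.

Lemma cbm_coord i : J i -> cbm (u i).
Proof.
move=> Ji; apply: (@cdepends_on_bm [:: i]); first by rewrite /= Ji.
by apply: cdepends_on_coord => //; rewrite mem_head.
Qed.

Lemma Ex_Re_orthogonal i s n Z : uniq (i :: s) -> all J (i :: s) -> (0 < n)%N ->
  cdepends_on s Z -> Ex P (fun w => complex.Re (u i w ^+ n * Z w)) = 0.
Proof.
move=> us Js n0 [Z1 Z2]; have /andP[Ji Js'] := Js.
(* Independence applies to bounded functions on the whole plane; truncating both coordinates to
   [-1, 1] changes nothing on the unit circle. *)
pose clip (x : R) : R := Num.max (-1) (Num.min x 1).
have mclip : bounded_measurable (clip : measurableTypeR R -> R).
  split; last first.
    by exists 1 => x; rewrite /clip ler_norml le_max lexx/= ge_max ge_min lexx orbT andbT; lra.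
  apply: measurable_maxr; first exact: measurable_cst.
  by apply: measurable_minr; [exact: measurable_id|exact: measurable_cst].
have clipE x : `|x| <= 1 -> clip x = x.
  by rewrite ler_norml /clip => /andP[x1 x2]; rewrite min_l// max_r.
pose clipp (x : plane R) : R[i] := Complex (clip x.1) (clip x.2).
have mclipp : cbm clipp.
  by split; [exact: (bm_comp (@measurable_fst _ _ _ _) mclip)|
            exact: (bm_comp (@measurable_snd _ _ _ _) mclip)].
have clippE w : clipp (toR2 (u i w)) = u i w.
  rewrite /clipp /toR2/= !clipE; first by case: (u i w).
    by apply: Im_norm_le; exact: u_unit.
  by apply: Re_norm_le; exact: u_unit.
have [p1 p2] : cbm (fun x => clipp x ^+ n) by exact: cbmX.
have [b1 b2] : cbm (fun w => u i w ^+ n) by apply: cbmX; exact: cbm_coord.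
have Z1' := depends_on_bm u_RV Js' Z1; have Z2' := depends_on_bm u_RV Js' Z2.
under eq_fun do rewrite ReM.
rewrite ExB; [|exact: bmM|exact: bmM].
have := Ex_indep_depends_on u_RV u_indep us Js p1 Z1.
have := Ex_indep_depends_on u_RV u_indep us Js p2 Z2.
under eq_fun do rewrite clippE.
under [in X in _ = X]eq_fun do rewrite clippE.
move=> ->.
under eq_fun do rewrite clippE.
under [in X in _ = X]eq_fun do rewrite clippE.
move=> ->.
by have [-> ->] := u_moment Ji n0; rewrite !mul0r subrr.
Qed.

End Unimodular.

Section Lindeberg.
Context (R : realType) d (T : measurableType d) (P : probability T R).
Variables (I : eqType) (J : pred I) (u : I -> T -> R[i]).
Hypothesis u_RV : forall i, J i -> complex_RV (u i).
Hypothesis u_indep : mutually_independent P J u.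
Hypothesis u_unit : forall i w, J i -> normsq (u i w) = 1.
Hypothesis u_moment : forall i n, J i -> (0 < n)%N ->
  Ex P (fun w => complex.Re (u i w ^+ n)) = 0 /\
  Ex P (fun w => complex.Im (u i w ^+ n)) = 0.
Implicit Type s : seq I.

Let Ex_Re_orth := Ex_Re_orthogonal u_RV u_indep u_unit u_moment.

Lemma normsqX (z : R[i]) n : normsq z = 1 -> normsq (z ^+ n) = 1.
Proof.
move=> z1; elim: n => [|n IH]; first by rewrite expr0 /normsq/= expr1n expr0n addr0.
by rewrite exprS normsqM z1 IH mulr1.
Qed.

Definition monomial s (a : I -> nat) (w : T) : R[i] := \prod_(i <- s) u i w ^+ a i.

Lemma normsq_monomial s a w : all J s -> normsq (monomial s a w) = 1.
Proof.
rewrite /monomial; elim: s => [_|i s IH /= /andP[Ji Js]].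
  by rewrite big_nil /normsq/= expr1n expr0n addr0.
by rewrite big_cons normsqM normsqX ?u_unit// IH// mulr1.
Qed.

Lemma cdepends_on_monomial s s' a : {subset s <= s'} -> all J s ->
  cdepends_on u s' (monomial s a).
Proof.
move=> ss' Js; apply: cbm_prod => i si _; apply: cbmX.
by apply: (cdepends_on_coord u_unit); [exact: ss'|exact: (allP Js)].
Qed.

(** Isolating the index i leaves u i to the positive power a i - b i, times a factor that depends on
    the other variables only. *)
Let monomial_orth_lt s a b i : uniq s -> all J s -> i \in s -> (b i < a i)%N ->
  Ex P (fun w => complex.Re (monomial s a w * (monomial s b w)^*%C)) = 0.
Proof.
move=> us Js si ba; have Ji := allP Js _ si.
have ps : perm_eq s (i :: rem i s) := perm_to_rem si.
have us' : uniq (i :: rem i s) by rewrite -(perm_uniq ps).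
have Js' : all J (i :: rem i s) by rewrite -(perm_all _ ps).
have /andP[_ Jr] := Js'.
pose Z w := monomial (rem i s) a w * (monomial (rem i s) b w)^*%C.
have Zd : cdepends_on u (rem i s) Z.
  by apply: cbmM; [|apply: cbmJ]; exact: cdepends_on_monomial.
have ba0 : (0 < a i - b i)%N by rewrite subn_gt0.
rewrite -[RHS](Ex_Re_orth us' Js' ba0 Zd); congr Ex; apply/funext => w; congr complex.Re.
rewrite /Z /monomial (big_rem i si)/= [in X in _ * X^*%C](big_rem i si)/= rmorphM rmorphXn/=.
have uu : u i w * (u i w)^*%C = 1 by rewrite mul_conjc u_unit.
rewrite -{1}(subnK (ltnW ba)) exprD.
set A := \prod_(j <- _) _; set B := (\prod_(j <- _) _)^*%C.
transitivity (u i w ^+ (a i - b i) * (u i w * (u i w)^*%C) ^+ b i * (A * B)).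
  by rewrite exprMn; ring.
by rewrite uu expr1n mulr1.
Qed.

Lemma monomial_orth s a b : uniq s -> all J s ->
  Ex P (fun w => complex.Re (monomial s a w * (monomial s b w)^*%C)) =
    (all (fun i => a i == b i) s)%:R.
Proof.
move=> us Js; case: allP => [ab|/allP].
  rewrite -[RHS](Ex_cst P); congr Ex; apply/funext => w.
  have -> : monomial s b w = monomial s a w.
    by rewrite /monomial; apply: eq_big_seq => i /ab /eqP ->.
  by rewrite mul_conjc normsq_monomial.
rewrite -has_predC => /hasP[i si /=]; rewrite neq_ltn => /orP[ab|ba].
  rewrite -[RHS](monomial_orth_lt us Js si ab); congr Ex; apply/funext => w.
  by rewrite -[RHS]ReJ rmorphM/= conjcK mulrC.
exact: (monomial_orth_lt us Js si ba).
Qed.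

Let step_error (e t : R) (x : R) := heat_const R * (t * (x / e) + (x / e) ^+ 2 / t) / e.

(** Trades third moments of the coefficients for second moments, whose sum will be 1, and fourth
    moments, whose sum will be small. *)
Lemma young3 (h t : R) : 0 <= h -> 0 < t -> h ^+ 3 <= t * h ^+ 2 + h ^+ 2 ^+ 2 / t.
Proof.
move=> h0 t0; rewrite -subr_ge0.
have -> : t * h ^+ 2 + h ^+ 2 ^+ 2 / t - h ^+ 3 =
    t^-1 * h ^+ 2 * ((t - h) ^+ 2 + t * h) by field; rewrite gt_eqF.
by rewrite !mulr_ge0 ?invr_ge0 ?addr_ge0 ?sqr_ge0 ?mulr_ge0 ?(ltW t0).
Qed.

Lemma heat_const_ge0 : 0 <= heat_const R.
Proof. by rewrite /heat_const addr_ge0// mulr_ge0// expR_ge0. Qed.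

(** The corrections [Y1] and [Y2] multiply u i and its square by quantities that depend on s only,
    so they average to 0. The time S is itself random and only bounded below. *)
Lemma Ex_heat_step s i e t S z c : uniq (i :: s) -> all J (i :: s) -> 0 < e -> 0 < t ->
  (forall w, e <= S w) -> depends_on u s S -> cdepends_on u s z -> cdepends_on u s c ->
  `|Ex P (fun w => heat (S w) (z w - c w * u i w))
    - Ex P (fun w => heat (S w + normsq (c w)) (z w))|
  <= Ex P (fun w => step_error e t (normsq (c w))).
Proof.
move=> us Js e0 t0 eS dS dz dc; have /andP[Ji Js'] := Js.
have bS := depends_on_bm u_RV Js' dS.
have bz := cdepends_on_bm u_RV Js' dz; have bc := cdepends_on_bm u_RV Js' dc.
have bu : cbm (u i) := cbm_coord u_RV u_unit Ji.
have eSc w : e <= S w + normsq (c w) by rewrite (le_trans (eS w))// lerDl normsq_ge0.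
have bA : bounded_measurable (fun w => heat (S w) (z w - c w * u i w)).
  by apply: (bm_heat e0) => //; apply: cbmB => //; exact: cbmM.
have bB : bounded_measurable (fun w => heat (S w + normsq (c w)) (z w)).
  by apply: (bm_heat e0) => //; apply: bmD => //; exact: bm_normsq.
have dH : depends_on u s (fun w => heat (S w) (z w)) by exact: (bm_heat e0).
have dI : depends_on u s (fun w => (S w)^-1) by exact: (bm_inv e0).
pose Y1 w := (2 * heat (S w) (z w) * (S w)^-1)%:C%C * ((z w)^*%C * c w).
pose Y2 w := (heat (S w) (z w) * (S w)^-1 ^+ 2)%:C%C * ((z w)^*%C * c w) ^+ 2.
have dzc : cdepends_on u s (fun w => (z w)^*%C * c w).
  by apply: cbmM => //; exact: cbmJ.
have dY1 : cdepends_on u s Y1.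
  apply: cbmM => //; apply: cbm_real; apply: bmM => //; apply: bmM => //; exact: bm_cst.
have dY2 : cdepends_on u s Y2.
  apply: cbmM; last exact: cbmX.
  by apply: cbm_real; apply: bmM => //; exact: bmX.
have bY1 : bounded_measurable (fun w => complex.Re (u i w ^+ 1 * Y1 w)).
  have : cbm (fun w => u i w ^+ 1 * Y1 w) by apply: cbmM; [exact: cbmX|exact: (cdepends_on_bm u_RV Js' dY1)].
  by case.
have bY2 : bounded_measurable (fun w => complex.Re (u i w ^+ 2 * Y2 w)).
  have : cbm (fun w => u i w ^+ 2 * Y2 w) by apply: cbmM; [exact: cbmX|exact: (cdepends_on_bm u_RV Js' dY2)].
  by case.
have E1 : Ex P (fun w => complex.Re (u i w ^+ 1 * Y1 w)) = 0.
  exact: (Ex_Re_orth us Js (isT : (0 < 1)%N) dY1).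
have E2 : Ex P (fun w => complex.Re (u i w ^+ 2 * Y2 w)) = 0.
  exact: (Ex_Re_orth us Js (isT : (0 < 2)%N) dY2).
have bn := bm_normsq bc.
have bE : bounded_measurable (fun w => step_error e t (normsq (c w))).
  have bx : bounded_measurable (fun w => normsq (c w) / e) by apply: bmM => //; exact: bm_cst.
  rewrite /step_error; apply: bmM; last exact: bm_cst.
  by apply: bmZ; apply: bmD; [exact: bmZ|apply: bmM; [exact: bmX|exact: bm_cst]].
have -> : Ex P (fun w => heat (S w) (z w - c w * u i w))
    - Ex P (fun w => heat (S w + normsq (c w)) (z w)) =
    Ex P (fun w => heat (S w) (z w - c w * u i w) - heat (S w + normsq (c w)) (z w)
      - (complex.Re (u i w ^+ 1 * Y1 w) + complex.Re (u i w ^+ 2 * Y2 w))).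
  rewrite ExB; [|exact: bmB|exact: bmD].
  by rewrite (ExD _ bY1 bY2) E1 E2 addr0 subr0 ExB.
have bD : bounded_measurable (fun w => heat (S w) (z w - c w * u i w)
   - heat (S w + normsq (c w)) (z w)
   - (complex.Re (u i w ^+ 1 * Y1 w) + complex.Re (u i w ^+ 2 * Y2 w))).
  by apply: bmB; [exact: bmB|exact: bmD].
apply: le_trans (le_norm_Ex P bD) _; apply: le_Ex => //; first exact: bm_abs.
move=> w; have S0 : 0 < S w := lt_le_trans e0 (eS w).
have -> : complex.Re (u i w ^+ 1 * Y1 w) + complex.Re (u i w ^+ 2 * Y2 w) =
   heat (S w) (z w) * (2 * complex.Re ((z w)^*%C * c w * u i w) / S w
     + complex.Re (((z w)^*%C * c w * u i w) ^+ 2) / S w ^+ 2).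
  have RZ (r : R) (y : R[i]) : complex.Re (r%:C%C * y) = r * complex.Re y.
    by case: y => p q /=; ring.
  have -> : u i w ^+ 1 * Y1 w =
      (2 * heat (S w) (z w) * (S w)^-1)%:C%C * ((z w)^*%C * c w * u i w).
    by rewrite /Y1; ring.
  have -> : u i w ^+ 2 * Y2 w =
      (heat (S w) (z w) * (S w)^-1 ^+ 2)%:C%C * ((z w)^*%C * c w * u i w) ^+ 2.
    by rewrite /Y2; ring.
  by rewrite !RZ -exprVn; ring.
apply: le_trans (heat_step _ _ S0 (u_unit w Ji)) _.
rewrite /step_error.
set h := Num.sqrt _.
have h2 : h ^+ 2 = normsq (c w) / S w.
  by rewrite sqr_sqrtr// divr_ge0 ?normsq_ge0 ?ltW.
have hle : h ^+ 2 <= normsq (c w) / e.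
  by rewrite h2 ler_wpM2l ?normsq_ge0// lef_pV2// posrE.
have h0 : 0 <= h by exact: sqrtr_ge0.
have h3 := young3 h0 t0.
apply: ler_pM; rewrite ?invr_ge0 ?(ltW S0) ?mulr_ge0 ?heat_const_ge0 ?exprn_ge0//; last first.
  by rewrite lef_pV2// posrE.
apply: ler_wpM2l; first exact: heat_const_ge0.
apply: le_trans h3 _; apply: lerD.
  by rewrite ler_wpM2l// ltW.
rewrite ler_wpM2r ?invr_ge0 ?(ltW t0)//.
by rewrite lerXn2r// nnegrE ?sqr_ge0// divr_ge0 ?normsq_ge0 ?ltW.
Qed.

(** The coefficients depend on s only, never on the variables of L. In the induction the head term
    is first absorbed into z and counted as known while the tail is replaced; it is then averaged
    itself, at a time that already includes the |c|^2 of the tail. *)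
Lemma lindeberg (L s : seq I) (c : I -> T -> R[i]) z e t S :
  uniq (L ++ s) -> all J (L ++ s) -> 0 < e -> 0 < t ->
  (forall w, e <= S w) -> depends_on u s S -> cdepends_on u s z ->
  (forall i, cdepends_on u s (c i)) ->
  `|Ex P (fun w => heat (S w) (z w - \sum_(i <- L) c i w * u i w))
    - Ex P (fun w => heat (S w + \sum_(i <- L) normsq (c i w)) (z w))|
  <= \sum_(i <- L) Ex P (fun w => step_error e t (normsq (c i w))).
Proof.
elim: L s z S => [|i L IH] s z S us Js e0 t0 eS dS dz dc.
  rewrite big_nil; under eq_fun do rewrite big_nil subr0.
  by under [in X in _ - X]eq_fun do rewrite big_nil addr0; rewrite subrr normr0.
have pLs : perm_eq ((i :: L) ++ s) (L ++ i :: s) := permEl (perm_catCA [:: i] L s).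
have us' : uniq (L ++ i :: s) by rewrite -(perm_uniq pLs).
have Js' : all J (L ++ i :: s) by rewrite -(perm_all _ pLs).
have us2 : uniq (i :: s) by move: us'; rewrite cat_uniq => /and3P[].
have Js2 : all J (i :: s) by move: Js'; rewrite all_cat => /andP[].
have Ji : J i by case/andP: Js2.
have sis : {subset s <= i :: s} by move=> j js; rewrite inE js orbT.
have dS' : depends_on u (i :: s) S := depends_on_sub sis dS.
have dc' j : cdepends_on u (i :: s) (c j) := cdepends_on_sub sis (dc j).
have dz' : cdepends_on u (i :: s) (fun w => z w - c i w * u i w).
  apply: cbmB; first exact: (cdepends_on_sub sis dz).
  apply: cbmM; first exact: dc'.
  by apply: (cdepends_on_coord u_unit) => //; rewrite mem_head.
have H1 := IH (i :: s) (fun w => z w - c i w * u i w) S us' Js' e0 t0 eS dS' dz' dc'.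
pose S' w := S w + \sum_(j <- L) normsq (c j w).
have S'e w : e <= S' w.
  by rewrite (le_trans (eS w))// lerDl sumr_ge0// => j _; exact: normsq_ge0.
have dS'' : depends_on u s S'.
  by apply: bmD => //; apply: bm_sum => j; exact: (bm_normsq (dc j)).
have H2 := Ex_heat_step us2 Js2 e0 t0 S'e dS'' dz (dc i).
rewrite big_cons.
under eq_fun do rewrite big_cons opprD addrA.
under [in X in _ - X]eq_fun do rewrite big_cons (addrC (normsq _)) addrA.
apply: le_trans (ler_distD (Ex P (fun w => heat (S' w) (z w - c i w * u i w))) _ _) _.
by rewrite addrC; apply: lerD.
Qed.

End Lindeberg.

(** * Weak convergence from heat kernels *)

Lemma bm_Ex_fubini (R : realType) d1 d2 (T1 : measurableType d1) (T2 : measurableType d2)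
    (P1 : probability T1 R) (P2 : probability T2 R) (f : T1 * T2 -> R) :
  bounded_measurable f -> bounded_measurable (fun x => Ex P2 (fun y => f (x, y))).
Proof.
move=> bf; have bf1 x : bounded_measurable (fun y => f (x, y)).
  by apply: (bm_comp _ bf); exact: pair1_measurable.
split.
  apply/measurable_EFinP.
  have := measurable_fubini_F (bm_integrable ((P1 \x P2)%E : probability _ R) bf).
  by congr (measurable_fun _ _); apply/funext => x /=; rewrite EFin_Ex.
have [_ [M hM]] := bf; exists M => x.
apply: le_trans (le_norm_Ex _ (bf1 x)) _.
rewrite -[leRHS](Ex_cst P2); apply: le_Ex; [exact: bm_abs|exact: bm_cst|by []].
Qed.

(** * Densities of the normal laws on the line and in the plane *)

Section GaussianDensity.
Variable R : realType.
Local Notation mu := (@lebesgue_measure R).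

(** The normal density coincides almost everywhere with the Radon-Nikodym derivative, both having
    the same integral over every measurable set. *)
Lemma integral_normal_prob m s (f : measurableTypeR R -> R) : bounded_measurable f ->
  (\int[normal_prob m s]_x (f x)%:E = \int[mu]_x (f x * normal_pdf m s x)%:E)%E.
Proof.
move=> bf; have mf := bmP bf.
have intf := bm_integrable (normal_prob m s : probability _ R) bf.
rewrite -(Radon_Nikodym_change_of_variables (normal_prob_dominates m s))//=.
apply: ae_eq_integral => //.
- apply: emeasurable_funM; first exact/measurable_EFinP.
  apply: (measurable_int mu).
  by apply: Radon_Nikodym_integrable; exact: normal_prob_dominates.
- apply/measurable_EFinP; apply: measurable_funM => //.
  exact: measurable_normal_pdf.
- under [X in ae_eq _ _ _ X]eq_fun do rewrite EFinM.
  apply: ae_eqe_mul2l => /=.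
  rewrite Radon_NikodymE//=; first exact: normal_prob_dominates.
  move=> dom; case: cid => /= h [h1 h2 h3].
  apply: integral_ae_eq => //=.
  + by apply/measurable_EFinP; exact: measurable_normal_pdf.
  + by move=> E E01 mE; rewrite -h3.
Qed.

Definition heat_density (s : R) (z : R[i]) (y : plane R) : R :=
  pi^-1 * heat s (Complex y.1 y.2 - z).

Lemma heat_density_ge0 s z y : 0 < s -> 0 <= heat_density s z y.
Proof. by move=> s0; rewrite mulr_ge0 ?invr_ge0 ?pi_ge0 ?heat_ge0. Qed.

(** A complex normal law of variance s has variance s/2 in each coordinate. *)
Lemma normal_pdf_heat s z (x y : R) : 0 < s ->
  normal_pdf (complex.Re z) (Num.sqrt (s / 2)) x * normal_pdf (complex.Im z) (Num.sqrt (s / 2)) y =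
  heat_density s z (x, y).
Proof.
move=> s0; have s20 : 0 < s / 2 by lra.
have sd : Num.sqrt (s / 2) != 0 by rewrite gt_eqF// sqrtr_gt0.
have sE : Num.sqrt (s / 2) ^+ 2 = s / 2 by rewrite sqr_sqrtr// ltW.
have p0 := @pi_gt0 R.
rewrite /normal_pdf (negbTE sd) /normal_peak /normal_fun sE.
have -> : s / 2 * pi *+ 2 = s * pi by field.
have -> : (s / 2) *+ 2 = s by field.
rewrite mulrACA -expRD -invfM -expr2 sqr_sqrtr; last by rewrite mulr_ge0// ltW.
rewrite /heat_density /heat /normsq; case: z => a b /=.
rewrite (_ : - (x - a) ^+ 2 / s + - (y - b) ^+ 2 / s =
  - (((x - a) ^+ 2 + (y - b) ^+ 2) / s)); last by field; rewrite gt_eqF.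
by rewrite invfM [s^-1 * _]mulrC -mulrA [s^-1 * _]mulrC.
Qed.

Definition plane_measure : {measure set (plane R) -> \bar R} := (mu \x mu)%E.

Lemma plane_measure_sigma_finite : sigma_finite [set: plane R] plane_measure.
Proof.
pose F (n : nat) : set (measurableTypeR R) := `[- n%:R, n%:R]%classic.
have mF n : measurable (F n) by exact: measurable_itv.
exists (fun n => F n `*` F n).
  apply/seteqP; split => // -[x y] _.
  exists (Num.truncn (`|x| + `|y|)).+1 => //.
  have := truncnS_gt (`|x| + `|y|); set N := _.+1 => h.
  split; rewrite /F/= in_itv/= -ler_norml.
    by rewrite (le_trans _ (ltW h))// lerDl.
  by rewrite (le_trans _ (ltW h))// lerDr.
have Foo n : (mu (F n) < +oo)%E.
  rewrite /F; have := @lebesgue_measure_itv R `[- n%:R, n%:R]; rewrite /= => ->.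
  by case: ifPn => _; rewrite ?ltry.
move=> n; split; first exact: measurableX.
rewrite /plane_measure/= product_measure1E//; apply: lte_mul_pinfty => //; last exact: Foo.
by apply/fin_numPlt; rewrite (lt_le_trans _ (measure_ge0 _ _)) ?ltNyr//; exact: Foo.
Qed.

Definition mu2 : {sigma_finite_measure set (plane R) -> \bar R} :=
  HB.pack (plane_measure : set (plane R) -> \bar R) (Measure.on plane_measure) (Measure_isSigmaFinite.Build _ _ _ plane_measure plane_measure_sigma_finite).

Definition heat_normal (s : R) (z : R[i]) : probability (plane R) R :=
  (normal_prob (complex.Re z) (Num.sqrt (s / 2)) \x normal_prob (complex.Im z) (Num.sqrt (s / 2)))%E.

Lemma measurable_heat_density s z : measurable_fun [set: plane R] (heat_density s z).
Proof.
apply: measurable_funM => //.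
apply: measurable_funM => //; apply: measurableT_comp => //.
apply: measurableT_comp => //; apply: measurable_funM => //.
rewrite /normsq; case: z => a b /=; apply: measurable_funD; apply: measurable_funX.
  by apply: measurable_funB => //; exact: measurable_fst.
by apply: measurable_funB => //; exact: measurable_snd.
Qed.

Lemma Ex_heat_normal s z (f : plane R -> R) : 0 < s -> bounded_measurable f ->
  (forall y, 0 <= f y) ->
  ((Ex (heat_normal s z) f)%:E = \int[mu2]_y (f y * heat_density s z y)%:E)%E.
Proof.
move=> s0 bf f0.
pose P1 : probability (measurableTypeR R) R := normal_prob (complex.Re z) (Num.sqrt (s / 2)).
pose P2 : probability (measurableTypeR R) R := normal_prob (complex.Im z) (Num.sqrt (s / 2)).
rewrite (@Ex_fubini R _ _ _ _ P1 P2 f bf).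
have bf1 x : bounded_measurable (fun y => f (x, y)).
  by apply: (bm_comp _ bf); exact: pair1_measurable.
have mF : measurable_fun [set: plane R] (fun y => (f y * heat_density s z y)%:E).
  apply/measurable_EFinP; apply: measurable_funM; first exact: bmP.
  exact: measurable_heat_density.
have F0 (y : plane R) : (0 <= (f y * heat_density s z y)%:E)%E.
  by rewrite lee_fin mulr_ge0// heat_density_ge0.
rewrite /mu2 fubini_tonelli1//.
have bE : bounded_measurable (fun x => Ex P2 (fun y => f (x, y))).
  exact: bm_Ex_fubini.
rewrite EFin_Ex// integral_normal_prob//; apply: eq_integral => x _.
rewrite /fubini_F EFinM EFin_Ex// integral_normal_prob//.
rewrite -ge0_integralZr//.
- by apply: eq_integral => y _; rewrite -EFinM -normal_pdf_heat// mulrA mulrAC.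
- apply/measurable_EFinP; apply: measurable_funM; last exact: measurable_normal_pdf.
  exact: bmP.
- by move=> y _; rewrite lee_fin mulr_ge0 ?normal_pdf_ge0.
- by rewrite lee_fin normal_pdf_ge0.
Qed.

End GaussianDensity.

(** * From pointwise convergence of densities to convergence of integrals *)

Section Scheffe.
Context (R : realType) d (T : measurableType d) (mu : {measure set T -> \bar R}).
Variables (p : nat -> T -> R) (p0 : T -> R).
Hypothesis mp : forall n, measurable_fun [set: T] (p n).
Hypothesis mp0 : measurable_fun [set: T] p0.
Hypothesis p_ge0 : forall n x, 0 <= p n x.
Hypothesis p0_ge0 : forall x, 0 <= p0 x.
Hypothesis cvgp : forall x, p n x @[n --> \oo] --> p0 x.

Lemma near_lt_limn_einf (b : nat -> R) (l e : R) : 0 < e ->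
  (l%:E <= limn_einf (fun n => (b n)%:E))%E -> \forall n \near \oo, l - e < b n.
Proof.
move=> e0; rewrite limn_einf_lim.
have -> : limn (einfs (fun n => (b n)%:E)) = ereal_sup (range (einfs (fun n => (b n)%:E))).
  by apply/cvg_lim => //; exact: cvg_einfs_sup.
move=> ll.
have : ((l - e)%:E < ereal_sup (range (einfs (fun n => (b n)%:E))))%E.
  by apply: lt_le_trans ll; rewrite lte_fin; lra.
move/ereal_sup_gt => [_ [N _ <-] lN].
exists N => // n /= Nn; rewrite -lte_fin; apply: lt_le_trans lN _.
by apply: ereal_inf_lbound; exists n.
Qed.

Lemma fatou_density (h : T -> R) (b : nat -> R) (l e : R) : 0 < e ->
  measurable_fun [set: T] h -> (forall x, 0 <= h x) ->
  (forall n, (\int[mu]_x (h x * p n x)%:E = (b n)%:E)%E) ->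
  (\int[mu]_x (h x * p0 x)%:E = l%:E)%E ->
  \forall n \near \oo, l - e < b n.
Proof.
move=> e0 mh h0 hb hl; apply: near_lt_limn_einf => //.
rewrite -hl (_ : (fun n => (b n)%:E) = (fun n => \int[mu]_x (h x * p n x)%:E)%E).
  2: by apply/funext => n; rewrite hb.
have mf n : measurable_fun [set: T] (fun x => (h x * p n x)%:E).
  by apply/measurable_EFinP; exact: measurable_funM.
have f0 n x : [set: T] x -> (0 <= (h x * p n x)%:E)%E.
  by move=> _; rewrite lee_fin mulr_ge0.
apply: le_trans (fatou mu measurableT mf f0).
rewrite (eq_integral (fun x => limn_einf (fun n => (h x * p n x)%:E)))// => x _.
have cv : (h x * p n x)%:E @[n --> \oo] --> (h x * p0 x)%:E.
  by apply: cvg_EFin; [exact: nearW|apply: cvgM; [exact: cvg_cst|exact: cvgp]].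
rewrite is_cvg_limn_einfE; last by apply/cvg_ex; eexists; exact: cv.
by apply/esym/cvg_lim.
Qed.

(** Fatou's lemma for g bounds the integrals from below. Applied to M - g, it bounds them from
    above, since all the densities have mass 1. *)
Lemma scheffe (g : T -> R) (M a : R) (an : nat -> R) :
  measurable_fun [set: T] g -> (forall x, 0 <= g x <= M) ->
  (forall n, \int[mu]_x (p n x)%:E = 1)%E -> (\int[mu]_x (p0 x)%:E = 1)%E ->
  (forall n, \int[mu]_x (g x * p n x)%:E = (an n)%:E)%E ->
  (\int[mu]_x (g x * p0 x)%:E = a%:E)%E ->
  an n @[n --> \oo] --> a.
Proof.
move=> mg gM intp intp0 gp gp0.
have compl (r : T -> R) (b : R) : measurable_fun [set: T] r -> (forall x, 0 <= r x) ->
    (\int[mu]_x (r x)%:E = 1)%E -> (\int[mu]_x (g x * r x)%:E = b%:E)%E ->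
    (\int[mu]_x ((M - g x) * r x)%:E = (M - b)%:E)%E.
  move=> mr r0 r1 gr.
  have ir : mu.-integrable [set: T] (EFin \o r).
    apply/integrableP; split; first exact/measurable_EFinP.
    by under eq_integral do rewrite /= ger0_norm//; rewrite r1 ltry.
  have igr : mu.-integrable [set: T] (EFin \o (fun x => g x * r x)).
    apply/integrableP; split; first by apply/measurable_EFinP; exact: measurable_funM.
    under eq_integral => x _.
      rewrite /= ger0_norm; last by rewrite mulr_ge0//; case/andP: (gM x).
      over.
    by rewrite gr ltry.
  under eq_integral do rewrite mulrBl EFinB EFinM.
  rewrite integralB//=; last exact: integrableZl.
  by rewrite integralZl// r1 gr mule1 -EFinB.
apply/cvgrPdist_lt => e e0.
have g0 x : 0 <= g x by case/andP: (gM x).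
have Mg0 x : 0 <= M - g x by rewrite subr_ge0; case/andP: (gM x).
have lo := fatou_density e0 mg g0 gp gp0.
have mMg : measurable_fun [set: T] (fun x => M - g x).
  by apply: measurable_funB => //; exact: measurable_cst.
have hi := fatou_density e0 mMg Mg0 (fun n => compl _ _ (mp n) (p_ge0 n) (intp n) (gp n))
  (compl _ _ mp0 p0_ge0 intp0 gp0).
near=> n.
have h1 : a - e < an n by near: n.
have h2 : M - a - e < M - an n by near: n.
by rewrite ltr_norml; apply/andP; split; lra.
Unshelve. all: by end_near. Qed.

End Scheffe.

(** * Smoothing of a random variable by an independent normal one *)

Section Mixture.
Context (R : realType) d (T : measurableType d) (P : probability T R).
Variables (Z : T -> R[i]) (s : R).
Hypotheses (bZ : cbm Z) (s0 : 0 < s).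

(** The density of Z plus an independent complex normal variable of variance s. *)
Definition mixture (y : plane R) : R := Ex P (fun w => heat_density s (Z w) y).

Lemma bm_heat_density y : bounded_measurable (fun w => heat_density s (Z w) y).
Proof.
apply: bmZ; apply: (bm_heat s0) => //; first exact: bm_cst.
by apply: cbmB => //; exact: cbm_cst.
Qed.

Lemma mixture_ge0 y : 0 <= mixture y.
Proof. by apply: Ex_ge0 => w; exact: heat_density_ge0. Qed.

Lemma measurable_joint (f : plane R -> R) : measurable_fun [set: plane R] f ->
  measurable_fun [set: T * plane R] (fun wy => (f wy.2 * heat_density s (Z wy.1) wy.2)%:E).
Proof.
move=> mf; apply/measurable_EFinP; apply: measurable_funM.
  exact: (measurableT_comp mf).
have [Z1 Z2] := bZ.
apply: measurable_funM => //.
apply: measurable_funM => //; apply: measurableT_comp => //.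
apply: measurableT_comp => //; apply: measurable_funM => //.
have -> : (fun x : T * plane R => normsq (Complex x.2.1 x.2.2 - Z x.1)) =
  (fun x => (x.2.1 - complex.Re (Z x.1)) ^+ 2 + (x.2.2 - complex.Im (Z x.1)) ^+ 2).
  by apply/funext => x; rewrite /normsq; case: (Z x.1).
have m2 : measurable_fun [set: T * plane R] snd by exact: measurable_snd.
apply: measurable_funD; apply: measurable_funX; apply: measurable_funB.
- exact: (measurableT_comp (@measurable_fst _ _ _ _) m2).
- exact: (measurableT_comp (bmP Z1)).
- exact: (measurableT_comp (@measurable_snd _ _ _ _) m2).
- exact: (measurableT_comp (bmP Z2)).
Qed.

Lemma bm_Ex_heat_normal (f : plane R -> R) : bounded_measurable f -> (forall y, 0 <= f y) ->
  bounded_measurable (fun w => Ex (heat_normal s (Z w)) f).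
Proof.
move=> bf f0; split.
  apply/measurable_EFinP.
  have := @measurable_fun_fubini_tonelli_F _ _ T (plane R) R (@mu2 R)
    _ (measurable_joint (bmP bf)).
  rewrite (_ : fubini_F _ _ = EFin \o (fun w => Ex (heat_normal s (Z w)) f)).
    by apply => wy; rewrite lee_fin mulr_ge0 ?heat_density_ge0.
  by apply/funext => w /=; rewrite Ex_heat_normal.
have [_ [M hM]] := bf; exists M => w.
apply: le_trans (le_norm_Ex _ bf) _.
rewrite -[leRHS](Ex_cst (heat_normal s (Z w))).
by apply: le_Ex; [exact: bm_abs|exact: bm_cst|].
Qed.

Lemma Ex_Ex_heat_normal (f : plane R -> R) : bounded_measurable f -> (forall y, 0 <= f y) ->
  ((Ex P (fun w => Ex (heat_normal s (Z w)) f))%:E =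
   \int[@mu2 R]_y (f y * mixture y)%:E)%E.
Proof.
move=> bf f0; rewrite EFin_Ex; last exact: bm_Ex_heat_normal.
under eq_integral do rewrite Ex_heat_normal//.
have F0 (wy : T * plane R) : (0 <= (f wy.2 * heat_density s (Z wy.1) wy.2)%:E)%E.
  by rewrite lee_fin mulr_ge0 ?heat_density_ge0.
apply: (etrans (@fubini_tonelli _ _ T (plane R) R P (@mu2 R) _ (measurable_joint (bmP bf)) F0)).
apply: eq_integral => y _ /=.
rewrite EFinM /mixture EFin_Ex; last exact: bm_heat_density.
rewrite -ge0_integralZl//.
- by apply/measurable_EFinP; exact: bmP (bm_heat_density y).
- by move=> w _; rewrite lee_fin heat_density_ge0.
- by rewrite lee_fin.
Qed.

Lemma measurable_mixture : measurable_fun [set: plane R] mixture.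
Proof.
apply/measurable_EFinP.
have mc : measurable_fun [set: plane R] (fun=> 1 : R) by exact: measurable_cst.
have := @measurable_fun_fubini_tonelli_G _ _ T (plane R) R P _ (measurable_joint mc).
rewrite (_ : fubini_G _ _ = EFin \o mixture).
  by apply => wy; rewrite lee_fin mulr_ge0 ?heat_density_ge0.
apply/funext => y /=; rewrite /fubini_G /mixture EFin_Ex; last exact: bm_heat_density.
by apply: eq_integral => w _; rewrite mul1r.
Qed.

Lemma integral_mixture : (\int[@mu2 R]_y (mixture y)%:E = 1)%E.
Proof.
have := Ex_Ex_heat_normal (@bm_cst R _ (plane R) 1) (fun=> ler01).
under eq_fun do rewrite Ex_cst.
rewrite Ex_cst => ->; apply: eq_integral => y _; by rewrite mul1r.
Qed.

End Mixture.

Section ContinuousPlane.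
Variable R : realType.

(** Every open set is the union of the countably many rational rectangles it contains, which
    reconciles the topology of the plane with its product sigma-algebra. *)
Lemma open_plane_measurable (U : set (R * R)) : open U ->
  measurable (U : set (plane R)).
Proof.
move=> oU.
pose rect (q : (rat * rat) * (rat * rat)) : set (plane R) :=
  `]ratr q.1.1, ratr q.1.2[%classic `*` `]ratr q.2.1, ratr q.2.2[%classic.
have -> : U = \bigcup_q (if `[< rect q `<=` U >] then rect q else set0).
  apply/seteqP; split => [[x y] Uxy|p [q _]]; last by case: asboolP => // + ; apply.
  have /nbhs_ballP[e /= e0 eU] := open_nbhs_nbhs (conj oU Uxy).
  have ha1 : x - e < x by lra.
  have [a1] := rat_in_itvoo ha1.
  rewrite in_itv/= => /andP[a11 a12].
  have hb1 : x < x + e by lra.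
  have [b1] := rat_in_itvoo hb1.
  rewrite in_itv/= => /andP[b11 b12].
  have ha2 : y - e < y by lra.
  have [a2] := rat_in_itvoo ha2.
  rewrite in_itv/= => /andP[a21 a22].
  have hb2 : y < y + e by lra.
  have [b2] := rat_in_itvoo hb2.
  rewrite in_itv/= => /andP[b21 b22].
  exists ((a1, b1), (a2, b2)) => //; case: asboolP => [_|[]].
    by split; rewrite /= in_itv/=; apply/andP; split.
  move=> [x' y'] [/=]; rewrite !in_itv/= => /andP[h1 h2] /andP[h3 h4].
  by apply: eU; split; rewrite /ball/= ltr_norml; apply/andP; split; lra.
apply: countable_bigcupT_measurable => [|q]; first exact: countableP.
by case: asboolP => // _; apply: measurableX.
Qed.

Lemma continuous_plane_measurable (g : R * R -> R) : continuous g ->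
  measurable_fun [set: plane R] (g : plane R -> R).
Proof.
move=> cg; apply: (measurability _ (RGenOInfty.measurableE R)) => //.
move=> _ [_ [a ->] <-]; rewrite setTI; apply: open_plane_measurable.
apply: open_comp; last by rewrite set_itvE; exact: open_gt.
by move=> x _; exact: cg.
Qed.

(** Only x is confined to the compact square while y may leave it, so compactness is applied to the
    local property [Q], not to a restriction of g. *)
Lemma uniformly_continuous_plane (g : R * R -> R) (L e : R) : continuous g -> 0 < e ->
  exists2 r : R, 0 < r & forall x y : R * R, `|x.1| <= L -> `|x.2| <= L ->
    `|y.1 - x.1| < r -> `|y.2 - x.2| < r -> `|g y - g x| < e.
Proof.
move=> cg e0.
have cK : compact (`[- L, L]%classic `*` `[- L, L]%classic : set (R * R)).
  by apply: compact_setX; exact: segment_compact.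
move/compact_near_coveringP: cK => cK.
pose Q (r : R) (x : R * R) := forall y : R * R,
  `|y.1 - x.1| < r -> `|y.2 - x.2| < r -> `|g y - g x| < e.
have /cK : forall x, (`[- L, L]%classic `*` `[- L, L]%classic) x ->
    \forall x' \near x & r \near 0^'+, Q r x'.
  move=> x _.
  have e20 : 0 < e / 2 by lra.
  have /cvgrPdist_lt/(_ _ e20)/nbhs_ballP[d /= d0 dg] := cg x.
  have d20 : 0 < d / 2 by lra.
  exists (ball x (d / 2), [set r : R | 0 < r < d / 2]).
    split => /=; first exact: nbhsx_ballx.
    by near=> r; apply/andP; split; near: r; [exact: nbhs_right_gt|exact: nbhs_right_lt].
  move=> [x' r] [/= [b1 b2] /andP[r0 rd]] y h1 h2.
  have H1 : `|g x - g y| < e / 2.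
    apply: dg; split; rewrite /ball/=.
      have := b1; rewrite /ball/= => b1'.
      by rewrite (le_lt_trans (ler_distD x'.1 _ _))// (distrC x'.1); lra.
    have := b2; rewrite /ball/= => b2'.
    by rewrite (le_lt_trans (ler_distD x'.2 _ _))// (distrC x'.2); lra.
  have H2 : `|g x - g x'| < e / 2.
    by apply: dg; split; [apply: lt_le_trans b1 _|apply: lt_le_trans b2 _]; lra.
  by rewrite (le_lt_trans (ler_distD (g x) _ _))// (distrC (g y)); lra.
move=> H; have : \forall r \near 0^'+, 0 < r /\
    (`[- L, L]%classic `*` `[- L, L]%classic `<=` Q r).
  by near=> r; split; [near: r; exact: nbhs_right_gt|near: r; exact: H].
move/filter_ex => [r [r0 rQ]]; exists r => // x y x1 x2.
by apply: rQ; split; rewrite /= in_itv/= -ler_norml.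
Unshelve. all: by end_near. Qed.

End ContinuousPlane.

(** * Error made by Gaussian smoothing at a small time *)

Section HeatApproximation.
Variable R : realType.

Lemma integral_heat_density s (z : R[i]) : 0 < s ->
  (\int[@mu2 R]_y (heat_density s z y)%:E = 1)%E.
Proof.
move=> s0; have := Ex_heat_normal z s0 (@bm_cst R _ (plane R) 1) (fun=> ler01).
by rewrite Ex_cst => ->; apply: eq_integral => y _; rewrite mul1r.
Qed.

(** The exponential is a product of two equal halves: one is bounded at distance r, the other gives
    the density at time 2 s, whose total mass 1 then bounds the tail. *)
Lemma heat_density_tail s (z : R[i]) (y : plane R) r : 0 < s -> 0 <= r ->
  r ^+ 2 <= normsq (Complex y.1 y.2 - z) ->
  heat_density s z y <= 2 * expR (- (r ^+ 2 / (2 * s))) * heat_density (2 * s) z y.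
Proof.
move=> s0 r0 rn; rewrite /heat_density [leRHS]mulrCA ler_wpM2l ?invr_ge0 ?pi_ge0//.
rewrite /heat; set n := normsq _.
have s20 : 0 < 2 * s by lra.
have -> : 2 * expR (- (r ^+ 2 / (2 * s))) * (expR (- (n / (2 * s))) / (2 * s)) =
   expR (- (r ^+ 2 / (2 * s))) * expR (- (n / (2 * s))) / s.
  by field; rewrite gt_eqF.
rewrite ler_wpM2r ?invr_ge0 ?(ltW s0)// -expRD ler_expR.
have -> : n / s = n / (2 * s) + n / (2 * s) by field; rewrite gt_eqF.
by rewrite opprD lerD2r lerN2 ler_wpM2r// invr_ge0 ltW.
Qed.

(** The three terms come from the continuity of g near z, the Gaussian tail beyond r, and the points
    |z| > L, where the trivial bound B is below B |z|^2 / L^2. The last one turns into a second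
    moment after averaging over z. *)
Lemma Ex_heat_normal_approx (g : R * R -> R) (B L e r s : R) z :
  continuous g -> (forall x, 0 <= g x <= B) -> 0 < L -> 0 < e -> 0 < r -> 0 < s ->
  (forall x y : R * R, `|x.1| <= L -> `|x.2| <= L ->
    `|y.1 - x.1| < r -> `|y.2 - x.2| < r -> `|g y - g x| < e) ->
  `|Ex (heat_normal s z) g - g (toR2 z)| <=
    e + 4 * B * s / r ^+ 2 + B * normsq z / L ^+ 2.
Proof.
move=> cg gB L0 e0 r0 s0 unif.
have B0 : 0 <= B by case/andP: (gB 0) => [h1 h2]; exact: le_trans h1 h2.
have bg : @bounded_measurable R _ (plane R) g.
  split; first exact: continuous_plane_measurable.
  by exists B => x; case/andP: (gB x) => h1 h2; rewrite ger0_norm.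
pose D (y : plane R) := `|g y - g (toR2 z)|.
have DB y : D y <= B.
  by have := gB y; have := gB (toR2 z); rewrite /D ler_norml => /andP[? ?] /andP[? ?]; lra.
have bD : bounded_measurable D by apply: bm_abs; apply: bmB => //; exact: bm_cst.
have step1 : `|Ex (heat_normal s z) g - g (toR2 z)| <= Ex (heat_normal s z) D.
  have -> : Ex (heat_normal s z) g - g (toR2 z) =
      Ex (heat_normal s z) (fun y => g y - g (toR2 z)).
    by rewrite ExB ?Ex_cst//; exact: bm_cst.
  by apply: le_norm_Ex; apply: bmB => //; exact: bm_cst.
apply: le_trans step1 _.
have r20 : 0 < r ^+ 2 by exact: exprn_gt0.
have L20 : 0 < L ^+ 2 by exact: exprn_gt0.
have t0 : 0 <= 4 * B * s / r ^+ 2 by rewrite divr_ge0 ?(ltW r20)// mulr_ge0 ?(ltW s0)// mulr_ge0.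
have u0 : 0 <= B * normsq z / L ^+ 2 by rewrite divr_ge0 ?(ltW L20)// mulr_ge0 ?normsq_ge0.
have [zL|zL] := leP (normsq z) (L ^+ 2); last first.
  apply: (@le_trans _ _ B).
    rewrite -[leRHS](Ex_cst (heat_normal s z)).
    by apply: le_Ex => //; exact: bm_cst.
  have : B <= B * normsq z / L ^+ 2.
    by rewrite -mulrA ler_peMr// ler_pdivlMr// mul1r ltW.
  lra.
have z1 : `|complex.Re z| <= L.
  rewrite -(@ler_pXn2r _ 2)// ?nnegrE ?(ltW L0)// real_normK ?num_real//.
  exact: le_trans (Re_sqr_le z) zL.
have z2 : `|complex.Im z| <= L.
  rewrite -(@ler_pXn2r _ 2)// ?nnegrE ?(ltW L0)// real_normK ?num_real//.
  by apply: le_trans zL; rewrite lerDr sqr_ge0.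
pose q := 2 * expR (- (r ^+ 2 / (2 * s))).
have q0 : 0 <= q by rewrite mulr_ge0 ?expR_ge0.
have s20 : 0 < 2 * s by lra.
suff : Ex (heat_normal s z) D <= e + B * q.
  have : q <= 4 * s / r ^+ 2.
    have a0 : 0 < r ^+ 2 / (2 * s) by rewrite divr_gt0.
    have := expRN_moment0 (ltW a0); rewrite -ler_pdivlMr// mul1r invf_div /q => h.
    have -> : 4 * s / r ^+ 2 = 2 * (2 * s / r ^+ 2) by ring.
    by rewrite ler_wpM2l.
  move/(ler_wpM2l B0) => h1 h2.
  have -> : 4 * B * s / r ^+ 2 = B * (4 * s / r ^+ 2) by ring.
  lra.
rewrite -lee_fin Ex_heat_normal//; last by move=> y; exact: normr_ge0.
have md t : measurable_fun [set: plane R] (heat_density t z) by exact: measurable_heat_density.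
have mD : measurable_fun [set: plane R] D by case: bD.
apply: (@le_trans _ _ (\int[@mu2 R]_y
    (e * heat_density s z y + B * q * heat_density (2 * s) z y)%:E)%E).
  apply: ge0_le_integral => //.
  - by move=> y _; rewrite lee_fin mulr_ge0 ?normr_ge0 ?heat_density_ge0.
  - by apply/measurable_EFinP; exact: measurable_funM.
  - by apply/measurable_EFinP; apply: measurable_funD; apply: measurable_funM.
  move=> y _; rewrite lee_fin.
  have h0 := heat_density_ge0 z y s0; have h20 := heat_density_ge0 z y s20.
  have [/andP[c1 c2]|far] := boolP ((`|y.1 - complex.Re z| < r) && (`|y.2 - complex.Im z| < r)).
    have : D y <= e by apply/ltW/unif.
    move/(ler_wpM2r h0) => h; apply: (le_trans h).
    by rewrite lerDl; apply: mulr_ge0 h20; exact: mulr_ge0.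
  have : r ^+ 2 <= normsq (Complex y.1 y.2 - z).
    have yz : normsq (Complex y.1 y.2 - z) = (y.1 - complex.Re z) ^+ 2 + (y.2 - complex.Im z) ^+ 2.
      by rewrite /normsq; case: (z).
    have sq (a : R) : r <= `|a| -> r ^+ 2 <= a ^+ 2.
      by move=> ra; rewrite -(real_normK (num_real a)) lerXn2r ?nnegrE ?(ltW r0).
    move: far; rewrite yz negb_and -!leNgt => /orP[]/sq h.
      by rewrite (le_trans h)// lerDl sqr_ge0.
    by rewrite (le_trans h)// lerDr sqr_ge0.
  move/(heat_density_tail s0 (ltW r0)); rewrite -/q => h.
  have := ler_wpM2r h0 (DB y); have := ler_wpM2l B0 h.
  have := mulr_ge0 (ltW e0) h0; lra.
under eq_integral do rewrite EFinD (EFinM e) (EFinM (B * q)).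
have Bq0 : 0 <= B * q by exact: mulr_ge0.
have mE t : measurable_fun [set: plane R] (fun y => (heat_density t z y)%:E).
  exact/measurable_EFinP.
have mass c t : 0 <= c -> 0 < t -> (\int[@mu2 R]_y (c%:E * (heat_density t z y)%:E) = c%:E)%E.
  move=> c0 t1; rewrite ge0_integralZl ?integral_heat_density ?mule1//.
  by move=> y _; rewrite lee_fin heat_density_ge0.
rewrite ge0_integralD ?mass ?(ltW e0)//; do ?[exact: measurable_funeM].
- by move=> y _; rewrite -EFinM lee_fin mulr_ge0 ?heat_density_ge0// ltW.
- by move=> y _; rewrite -EFinM lee_fin mulr_ge0 ?heat_density_ge0.
Qed.

End HeatApproximation.

(** * Weak convergence from the heat kernel averages and a second moment bound *)

Section WeakConvergence.
Variable R : realType.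

Lemma heat_normal1 (g : plane R -> R) : Ex (heat_normal 1 0) g = Ex (complex_normal R) g.
Proof. by rewrite /heat_normal /= mul1r. Qed.

Lemma cvg_Ex_heat_normal (g : plane R -> R) (B : R) :
  bounded_measurable g -> (forall y, 0 <= g y <= B) ->
  Ex (heat_normal (1 + n.+1%:R^-1) 0) g @[n --> \oo] --> Ex (complex_normal R) g.
Proof.
move=> bg gB; rewrite -heat_normal1.
have s0 n : 0 < 1 + n.+1%:R^-1 :> R by rewrite addr_gt0.
have g0 y : 0 <= g y by case/andP: (gB y).
apply: (@scheffe R _ _ (@mu2 R) (fun n => heat_density (1 + n.+1%:R^-1) 0)
  (heat_density 1 0) _ _ _ _ _ g B).
- by move=> n; exact: measurable_heat_density.
- exact: measurable_heat_density.
- by move=> n y; exact: heat_density_ge0.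
- by move=> y; exact: heat_density_ge0.
- move=> y; apply: cvgM; first exact: cvg_cst.
  apply/cvgrPdist_le => e e0.
  near=> n.
  apply: le_trans (heat_lip_time _ ltr01 (s0 n)) _.
  rewrite invr1 ger0_norm; last first.
    by rewrite subr_ge0 invf_le1// lerDl.
  apply: (@le_trans _ _ n.+1%:R^-1).
    set x := n.+1%:R^-1; have x0 : 0 < x by rewrite /x.
    have : 1 - x <= (1 + x)^-1 by rewrite -[leRHS]mul1r ler_pdivlMr; [nra|exact: s0].
    lra.
  by apply/ltW; near: n; exact: (near_infty_natSinv_lt (PosNum e0)).
- exact: bmP.
- exact: gB.
- by move=> n; exact: integral_heat_density.
- exact: integral_heat_density.
- by move=> n; rewrite Ex_heat_normal.
- by rewrite Ex_heat_normal.
Unshelve. all: by end_near. Qed.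

Variables (d : nat -> measure_display) (T : forall n, measurableType (d n)).
Variables (P : forall n, probability (T n) R) (Z : forall n, T n -> R[i]).
Arguments Z : clear implicits.
Hypothesis bZ : forall n, cbm (Z n).
Hypothesis Z2 : forall n, Ex (P n) (fun w => normsq (Z n w)) <= 1.
Hypothesis cvgZ : forall s y, 0 < s ->
  Ex (P n) (fun w => heat s (y - Z n w)) @[n --> \oo] --> heat (1 + s) y.

Let cvg_mixture (g : plane R -> R) (B s : R) : 0 < s ->
  bounded_measurable g -> (forall y, 0 <= g y <= B) ->
  Ex (P n) (fun w => Ex (heat_normal s (Z n w)) g) @[n --> \oo] -->
  Ex (heat_normal (1 + s) 0) g.
Proof.
move=> s0 bg gB; have s10 : 0 < 1 + s by rewrite addr_gt0.
have g0 y : 0 <= g y by case/andP: (gB y).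
apply: (@scheffe R _ _ (@mu2 R) (fun n => mixture (P n) (Z n) s)
  (heat_density (1 + s) 0) _ _ _ _ _ g B).
- by move=> n; exact: measurable_mixture.
- exact: measurable_heat_density.
- by move=> n y; exact: mixture_ge0.
- by move=> y; exact: heat_density_ge0.
- move=> y; rewrite /heat_density subr0.
  have -> : (fun n => mixture (P n) (Z n) s y) =
      (fun n => pi^-1 * Ex (P n) (fun w => heat s (Complex y.1 y.2 - Z n w))).
    apply/funext => n; rewrite /mixture ExZ//.
    apply: (bm_heat s0) => //; first exact: bm_cst.
    by apply: cbmB => //; exact: cbm_cst.
  by apply: cvgM; [exact: cvg_cst|exact: cvgZ].
- exact: bmP.
- exact: gB.
- by move=> n; exact: integral_mixture.
- exact: integral_heat_density.
- by move=> n; rewrite (Ex_Ex_heat_normal _ (bZ n) s0 bg g0).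
- by rewrite Ex_heat_normal.
Qed.

Let bm_Z (g : plane R -> R) n : bounded_measurable g ->
  bounded_measurable (fun w => g (toR2 (Z n w))).
Proof.
move=> bg; have [Z1 Z2'] := bZ n.
apply: (bm_comp _ bg); exact: measurable_fun_pair (bmP Z1) (bmP Z2').
Qed.

Let weak_nonneg (g : R * R -> R) (B : R) : continuous g -> (forall x, 0 <= g x <= B) ->
  Ex (P n) (fun w => g (toR2 (Z n w))) @[n --> \oo] --> Ex (complex_normal R) g.
Proof.
move=> cg gB.
have g0 y : 0 <= g y by case/andP: (gB y).
have B0 : 0 <= B by case/andP: (gB 0) => [h1 h2]; exact: le_trans h1 h2.
have bg : @bounded_measurable R _ (plane R) g.
  split; first exact: continuous_plane_measurable.
  by exists B => x; case/andP: (gB x) => h1 h2; rewrite ger0_norm.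
apply/cvgrPdist_le.
suff H (e : R) : 0 < e -> \forall n \near \oo,
    `|Ex (complex_normal R) g - Ex (P n) (fun w => g (toR2 (Z n w)))| <= e.
  by move=> e; exact: H.
move=> e0.
(* One fifth each for: smoothing the limit law, convergence at fixed s, continuity of g, the
   Gaussian tail, and the mass of Z beyond L. *)
have e5 : 0 < e / 5 by lra.
pose L := Num.sqrt (B / (e / 5)) + 1.
have sq0 : 0 <= Num.sqrt (B / (e / 5)) by exact: sqrtr_ge0.
have L0 : 0 < L by rewrite /L; lra.
have BL : B / L ^+ 2 <= e / 5.
  rewrite ler_pdivrMr ?exprn_gt0// mulrC -ler_pdivrMr//.
  rewrite -[leLHS]sqr_sqrtr; last by rewrite divr_ge0// ltW.
  by rewrite lerXn2r// ?nnegrE ?(ltW L0)// /L lerDl.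
have [r r0 unif] := uniformly_continuous_plane L cg e5.
have r20 : 0 < r ^+ 2 by exact: exprn_gt0.
pose t := e / 5 * r ^+ 2 / (4 * B + 1).
have B41 : 0 < 4 * B + 1 by lra.
have t0 : 0 < t by rewrite divr_gt0// mulr_gt0.
have small_t (x : R) : 0 <= x -> x < t -> 4 * B * x / r ^+ 2 <= e / 5.
  by move=> x0; rewrite /t ltr_pdivlMr// ler_pdivrMr//; lra.
have : \forall j \near \oo, 4 * B * j.+1%:R^-1 / r ^+ 2 <= e / 5 /\
    `|Ex (complex_normal R) g - Ex (heat_normal (1 + j.+1%:R^-1) 0) g| <= e / 5.
  near=> j; split; last first.
    by near: j; move/cvgrPdist_le : (cvg_Ex_heat_normal bg gB); apply.
  apply: small_t; first by rewrite invr_ge0.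
  by near: j; exact: (near_infty_natSinv_lt (PosNum t0)).
(* The smoothing time s = 1/(j + 1) is fixed before n tends to infinity. *)
move/filter_ex => [j [j1 j2]].
set s := j.+1%:R^-1 in j1 j2.
have s0 : 0 < s by rewrite /s.
near=> n.
have h1 : `|Ex (heat_normal (1 + s) 0) g - Ex (P n) (fun w => Ex (heat_normal s (Z n w)) g)| <= e / 5.
  by near: n; move/cvgrPdist_le : (cvg_mixture s0 bg gB); apply.
have bEH := bm_Ex_heat_normal (bZ n) s0 bg g0.
have bgZ := bm_Z n bg.
have bN := bm_normsq (bZ n).
have h2 : `|Ex (P n) (fun w => Ex (heat_normal s (Z n w)) g) - Ex (P n) (fun w => g (toR2 (Z n w)))|
    <= 3 * (e / 5).
  rewrite -ExB//.
  apply: le_trans (le_norm_Ex _ (bmB bEH bgZ)) _.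
  have [k kE] : exists k : R, k = 2 * (e / 5) by exists (2 * (e / 5)).
  apply: (@le_trans _ _ (Ex (P n) (fun w => k + B / L ^+ 2 * normsq (Z n w)))).
    apply: le_Ex; first by apply: bm_abs; exact: bmB.
      by apply: bmD; [exact: bm_cst|exact: bmZ].
    move=> w; have := Ex_heat_normal_approx (Z n w) cg gB L0 e5 r0 s0 unif.
    rewrite kE; have -> : B * normsq (Z n w) / L ^+ 2 = B / L ^+ 2 * normsq (Z n w) by ring.
    lra.
  rewrite (ExD _ (bm_cst _ _) (bmZ _ bN)) Ex_cst ExZ//.
  have BL0 : 0 <= B / L ^+ 2 by rewrite divr_ge0// exprn_ge0// ltW.
  have := ler_wpM2l BL0 (Z2 n); rewrite mulr1.
  by move: BL; move: (B / L ^+ 2) (Ex _ _) => c m c5 cm; lra.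
apply: (@le_trans _ _ (e / 5 + e / 5 + 3 * (e / 5))); last lra.
apply: le_trans (ler_distD (Ex (P n) (fun w => Ex (heat_normal s (Z n w)) g)) _ _) _.
apply: lerD => //.
apply: le_trans (ler_distD (Ex (heat_normal (1 + s) 0) g) _ _) _.
exact: lerD.
Unshelve. all: by end_near. Qed.

Lemma heat_cvg_weak (g : R * R -> R) (M : R) : continuous g -> (forall x, `|g x| <= M) ->
  Ex (P n) (fun w => g (toR2 (Z n w))) @[n --> \oo] --> Ex (complex_normal R) g.
Proof.
move=> cg gM.
have bg : @bounded_measurable R _ (plane R) g.
  by split; [exact: continuous_plane_measurable|exists M].
have cgM : continuous (fun x => g x + M).
  by move=> x; apply: cvgD; [exact: cg|exact: cvg_cst].
have gM2 x : 0 <= g x + M <= M + M.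
  by have := gM x; rewrite ler_norml => /andP[? ?]; apply/andP; split; lra.
have := weak_nonneg cgM gM2.
have -> : Ex (complex_normal R) (fun x => g x + M) = Ex (complex_normal R) g + M.
  by rewrite ExD ?Ex_cst//; exact: bm_cst.
have -> : (fun n => Ex (P n) (fun w => g (toR2 (Z n w)) + M)) =
  (fun n => Ex (P n) (fun w => g (toR2 (Z n w))) + M).
  apply/funext => n; rewrite ExD ?Ex_cst//; [exact: bm_Z|exact: bm_cst].
move=> h.
rewrite (_ : (fun n => Ex (P n) (fun w => g (toR2 (Z n w)))) =
  (fun n => Ex (P n) (fun w => g (toR2 (Z n w))) + M - M)).
  by rewrite -[X in _ --> X](addrK M); apply: cvgB h _; exact: cvg_cst.
by apply/funext => n; rewrite addrK.
Qed.

End WeakConvergence.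

(** * The central limit theorem for multiplicative characters *)

Lemma prod_prime_divisors (K : finFieldType) (V : comNzRingType) (h : {poly K} -> nat -> V) n F :
  F \is monic -> (deg F <= n)%N -> (forall Q, h Q 0%N = 1) ->
  \prod_(Q <- prime_divisors F) h Q (multiplicity Q F) =
  \prod_(Q <- prs K n) h Q (multiplicity Q F).
Proof.
move=> mF Fn h0; rewrite [RHS](bigID (fun Q => Q %| F)) /=.
rewrite [X in _ = _ * X]big1_seq ?mulr1; last first.
  move=> Q /andP[QF]; rewrite mem_prs => /andP[pQ _].
  by move: QF; rewrite -multiplicity_gt0// lt0n negbK => /eqP ->.
rewrite -[RHS]big_filter; apply: perm_big; apply: uniq_perm.
- exact: prime_divisors_uniq.
- exact: filter_uniq (prs_uniq K n).
move=> Q; rewrite prime_divisorsP// mem_filter mem_prs andbC.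
case QF: (Q %| F) => //=; case pQ: (prime_poly Q) => //=.
by rewrite (leq_trans _ Fn)// prime_dvd_deg.
Qed.

Lemma prod_prs (K : finFieldType) n F : F \is monic -> (deg F <= n)%N ->
  F = \prod_(Q <- prs K n) Q ^+ multiplicity Q F.
Proof.
by move=> mF Fn; rewrite {1}(prod_multiplicity mF); exact: (prod_prime_divisors (h := fun Q e => Q ^+ e)).
Qed.

Section NormSum.
Variable R : realType.

Lemma Re_sum (I : Type) (s : seq I) (Q : pred I) (z : I -> R[i]) :
  complex.Re (\sum_(i <- s | Q i) z i) = \sum_(i <- s | Q i) complex.Re (z i).
Proof. by elim/big_rec2: _ => // i x y _ <-; rewrite ReD. Qed.

Lemma Re_scale (r : R) (z : R[i]) : complex.Re (r%:C%C * z) = r * complex.Re z.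
Proof. by case: z => p q /=; ring. Qed.

Lemma conj_scale (r : R) (z : R[i]) : (r%:C%C * z)^*%C = r%:C%C * z^*%C.
Proof. by case: z => p q; apply/eqP; rewrite eq_complex /=; apply/andP; split; apply/eqP; ring. Qed.

Lemma conj_sum (I : Type) (s : seq I) (Q : pred I) (z : I -> R[i]) :
  (\sum_(i <- s | Q i) z i)^*%C = \sum_(i <- s | Q i) (z i)^*%C.
Proof. exact: rmorph_sum. Qed.

Lemma normsq_sum (I : Type) (s : seq I) (a : I -> R) (z : I -> R[i]) :
  normsq (\sum_(i <- s) (a i)%:C%C * z i) =
  \sum_(i <- s) \sum_(j <- s) a i * a j * complex.Re (z i * (z j)^*%C).
Proof.
have -> (x : R[i]) : normsq x = complex.Re (x * x^*%C) by rewrite mul_conjc.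
rewrite conj_sum big_distrl Re_sum; apply: eq_bigr => i _ /=.
rewrite big_distrr Re_sum; apply: eq_bigr => j _ /=.
rewrite -Re_scale conj_scale rmorphM /=; congr complex.Re; ring.
Qed.

End NormSum.

Section Characters.
Context (R : realType) d (T : measurableType d) (P : probability T R).
Variables (K : finFieldType) (u : {poly K} -> T -> R[i]).
Hypothesis u_RV : forall Q, prime_poly Q -> complex_RV (u Q).
Hypothesis u_indep : mutually_independent P (@prime_poly K) u.
Hypothesis u_unit : forall Q w, prime_poly Q -> normsq (u Q w) = 1.
Hypothesis u_moment : forall Q n, prime_poly Q -> (0 < n)%N ->
  Ex P (fun w => complex.Re (u Q w ^+ n)) = 0 /\
  Ex P (fun w => complex.Im (u Q w ^+ n)) = 0.
Implicit Types (F G Q : {poly K}).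

(** The completely multiplicative extension of [u] from the primes to the monic polynomials. *)
Definition chi F w : R[i] := \prod_(Q <- prime_divisors F) u Q w ^+ multiplicity Q F.

Lemma all_prs n : all (@prime_poly K) (prs K n).
Proof. by apply/allP => Q; rewrite mem_prs => /andP[]. Qed.

Lemma chi_monomial F n w : F \is monic -> (deg F <= n)%N ->
  chi F w = monomial u (prs K n) (fun Q => multiplicity Q F) w.
Proof.
by move=> mF Fn; exact: (prod_prime_divisors (h := fun Q e => u Q w ^+ e)).
Qed.

Lemma chiM F G w : F \is monic -> G \is monic -> chi (F * G) w = chi F w * chi G w.
Proof.
move=> mF mG; have mFG : F * G \is monic by rewrite monicMl.
rewrite !(@chi_monomial _ (deg F + deg G)) ?degM ?leq_addr ?leq_addl//.
rewrite -big_split; apply: eq_big_seq => Q; rewrite mem_prs => /andP[pQ _].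
by rewrite multiplicityM// exprD.
Qed.

Lemma chi_prime Q w : prime_poly Q -> chi Q w = u Q w.
Proof.
move=> pQ; have mQ := prime_monic pQ.
have mem : Q \in prs K (deg Q) by rewrite mem_prs pQ leqnn.
rewrite (chi_monomial w mQ (leqnn _)) /monomial (bigD1_seq Q) ?prs_uniq//=.
rewrite multiplicity_prime// eqxx big1_seq ?mulr1// => Q' /andP[QQ'].
by rewrite mem_prs => /andP[pQ' _]; rewrite multiplicity_prime// (negbTE QQ').
Qed.

Lemma cdepends_on_chi F n : F \is monic -> (deg F <= n)%N -> cdepends_on u (prs K n) (chi F).
Proof.
move=> mF Fn; have -> : chi F = monomial u (prs K n) (fun Q => multiplicity Q F).
  by apply/funext => w; exact: chi_monomial.
exact: (cdepends_on_monomial u_unit _ (fun x h => h) (all_prs n)).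
Qed.

Lemma cbm_chi F : F \is monic -> cbm (chi F).
Proof.
by move=> mF; apply: (cdepends_on_bm u_RV (all_prs (deg F))); exact: cdepends_on_chi.
Qed.

Lemma chi_orth F G : F \is monic -> G \is monic ->
  Ex P (fun w => complex.Re (chi F w * (chi G w)^*%C)) = (F == G)%:R.
Proof.
move=> mF mG; set n := maxn (deg F) (deg G).
have Fn : (deg F <= n)%N by rewrite leq_maxl.
have Gn : (deg G <= n)%N by rewrite leq_maxr.
rewrite (_ : (fun w => _) = (fun w => complex.Re (monomial u (prs K n) (fun Q => multiplicity Q F) w *
  (monomial u (prs K n) (fun Q => multiplicity Q G) w)^*%C))); last first.
  by apply/funext => w; rewrite -!chi_monomial.
rewrite (monomial_orth u_RV u_indep u_unit u_moment _ _ (prs_uniq K n) (all_prs n)).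
congr ((_ : bool)%:R); apply/allP/eqP => [h|-> //].
rewrite (prod_prs mF Fn) [RHS](prod_prs mG Gn); apply: eq_big_seq => Q Qn.
by rewrite (eqP (h Q Qn)).
Qed.

(** Parseval's identity for the orthonormal family of the [chi] F. *)
Lemma Ex_normsq_sum (s : seq {poly K}) (a : {poly K} -> R) : uniq s ->
  {in s, forall F, F \is monic} ->
  Ex P (fun w => normsq (\sum_(F <- s) (a F)%:C%C * chi F w)) = \sum_(F <- s) a F ^+ 2.
Proof.
move=> us ms; under eq_fun do rewrite normsq_sum.
pose z F w := if F \is monic then chi F w else 0.
have cz F : cbm (z F).
  by rewrite /z; have [mF|mF] := boolP (F \is monic); [exact: cbm_chi|exact: cbm_cst].
have bz F G : bounded_measurable (fun w => complex.Re (z F w * (z G w)^*%C)).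
  by have [] : cbm (fun w => z F w * (z G w)^*%C) by apply: cbmM => //; exact: cbmJ.
have -> : (fun w => \sum_(F <- s) \sum_(G <- s) a F * a G * complex.Re (chi F w * (chi G w)^*%C)) =
    (fun w => \sum_(F <- s) \sum_(G <- s) a F * a G * complex.Re (z F w * (z G w)^*%C)).
  apply/funext => w; apply: eq_big_seq => F Fs; apply: eq_big_seq => G Gs.
  by rewrite /z !ms.
rewrite Ex_sum; last by move=> F; apply: bm_sum => G; exact: bmZ.
apply: eq_big_seq => F Fs; rewrite Ex_sum; last by move=> G; exact: bmZ.
have zo G : G \in s -> Ex P (fun w => complex.Re (z F w * (z G w)^*%C)) = (F == G)%:R.
  by move=> Gs; rewrite /z !ms// chi_orth ?ms.
rewrite (bigD1_seq F)//= ExZ// zo// eqxx mulr1 expr2 big1_seq ?addr0//.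
by move=> G /andP[GF Gs]; rewrite ExZ// zo// eq_sym (negbTE GF) mulr0.
Qed.

End Characters.

Lemma large_deg_ge n N D : (2 * (2 * n) < N)%N -> (N - 2 * n <= D)%N ->
  (0 < D)%N /\ (N <= 2 * D)%N.
Proof. by move=> *; split; lia. Qed.

Lemma small_lt_large n N D : (2 * (2 * n) < N)%N -> (D <= 2 * n)%N -> (D < N - 2 * n)%N.
Proof. by move=> *; lia. Qed.

Lemma inv_dist (R : realFieldType) (s v : R) : 0 < s -> 0 <= v ->
  `|(s + v)^-1 - (1 + s)^-1| <= (s ^+ 2)^-1 * `|v - 1|.
Proof.
move=> s0 v0.
have -> : (s + v)^-1 - (1 + s)^-1 = ((s + v) * (1 + s))^-1 * (1 - v).
  by field; rewrite !gt_eqF//; lra.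
rewrite normrM distrC ler_wpM2r// ger0_norm; last by rewrite invr_ge0 mulr_ge0//; lra.
by rewrite lef_pV2 ?posrE ?exprn_gt0 ?mulr_gt0//; [nra|lra|lra].
Qed.

Lemma ratio_ge (R : realFieldType) (r c m : R) : 0 <= r -> r <= 2^-1 -> 0 <= c ->
  m <= (1 + 2 * r) * c -> (1 - 2 * r) * m <= c.
Proof.
move=> r0 r1 c0 mc; have r2 : 0 <= 1 - 2 * r by lra.
apply: le_trans (ler_wpM2l r2 mc) _; rewrite mulrA ler_piMl//.
by have := sqr_ge0 r; lra.
Qed.

Section Sums.
Variables (K : finFieldType) (k : nat).
Implicit Types (F G Q : {poly K}).

(** (Q, G) -> Q G is one-to-one because the large prime dividing F is unique, and G is prime to Q
    because its degree is smaller. *)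
Lemma sum_core (n N : nat) (V : nmodType) (phi : {poly K} -> V) : (2 * (2 * n) < N)%N ->
  \sum_(F <- core K n N k) phi F =
  \sum_(Q <- large_primes K N (2 * n)) \sum_(G <- mon K (N - deg Q) | sqf k G) phi (Q * G).
Proof.
move=> nN; pose phi' F := if (omega F == k.+1) && (Omega F == k.+1) then phi F else 0.
transitivity (\sum_(F <- mon K N) \sum_(Q <- large_primes K N (2 * n) | Q %| F) phi' F).
  rewrite /core big_filter big_mkcond; apply: eq_big_seq => F FN.
  rewrite (sum_large_prime_dvd nN phi' FN) /phi'.
  by case: (omega F == _); case: (Omega F == _); case: has.
rewrite sum_large_primes; apply: eq_big_seq => Q QL; rewrite [RHS]big_mkcond.
apply: eq_big_seq => G GN; have := GN; rewrite mem_mon => /andP[mG _].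
have := QL; rewrite mem_large_primes => /and3P[pQ _ _].
have ndv := large_prime_ndvd nN QL GN.
have := omega_primeM pQ mG ndv (isT : 0 < 1)%N; have := Omega_primeM pQ mG ndv (isT : 0 < 1)%N.
by rewrite /phi' expr1 => -> ->; rewrite add1n !eqSS.
Qed.

Lemma sum_sqf_pairs (M : nat) (V : nmodType) (phi : {poly K} -> {poly K} -> V) :
  \sum_(x <- sqf_pairs K k M) phi x.1 x.2 =
  \sum_(0 <= m < M.+1) \sum_(G <- mon K m | sqf k G) \sum_(G' <- mon K m | sqf k G') phi G G'.
Proof.
rewrite big_filter big_mkcond big_allpairs /=.
transitivity (\sum_(G <- monle K M | sqf k G) \sum_(G' <- mon K (deg G) | sqf k G') phi G G'); last first.
  rewrite sum_monle; apply: eq_bigr => m _; rewrite big_seq_cond [RHS]big_seq_cond.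
  by apply: eq_bigr => G; rewrite mem_mon => /andP[/andP[_ /eqP ->]].
rewrite [RHS]big_mkcond; apply: eq_big_seq => G; rewrite mem_monle => /andP[mG GM].
case: (sqf k G) => /=; last by rewrite big1.
rewrite -big_mkcond sum_monle (bigD1_seq (deg G)) ?mem_index_iota ?iota_uniq ?ltnS//=.
rewrite [X in _ + X]big1_seq ?addr0.
  rewrite big_seq_cond [RHS]big_seq_cond; apply: eq_bigl => G'; rewrite mem_mon.
  by case: (deg G' =P deg G) => [->|]; rewrite ?eqxx ?andbT ?andbF.
move=> m /andP[dm _]; rewrite big1_seq// => G' /andP[/andP[_ /eqP dG]].
by rewrite mem_mon => /andP[_ /eqP dG']; rewrite dG dG' eqxx in dm.
Qed.

End Sums.

(** * The normalised sum over the core and its conditional variance *)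

Section CoreSum.
Context (R : realType) d (T : measurableType d) (P : probability T R).
Variables (K : finFieldType) (u : {poly K} -> T -> R[i]).
Hypothesis u_RV : forall Q, prime_poly Q -> complex_RV (u Q).
Hypothesis u_indep : mutually_independent P (@prime_poly K) u.
Hypothesis u_unit : forall Q w, prime_poly Q -> normsq (u Q w) = 1.
Hypothesis u_moment : forall Q n, prime_poly Q -> (0 < n)%N ->
  Ex P (fun w => complex.Re (u Q w ^+ n)) = 0 /\
  Ex P (fun w => complex.Im (u Q w ^+ n)) = 0.
Implicit Types (F G Q : {poly K}).

Variables (n N k : nat) (eps : R).
Hypotheses (n_gt0 : (0 < n)%N) (nN : (2 * (2 * n) < N)%N) (Nn : (N <= 8 * n)%N).
Hypothesis Wh : 113 * k.+1%:R <= cumpdens R K n.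
Hypothesis epsE : eps = 4 * k.+1%:R / cumpdens R K n.
Hypothesis rho_le : 200 * eps + 1024 / N%:R <= 2^-1.

Local Notation q := (#|K|%:R : R).
Local Notation pdens := (@pdens R K).
Local Notation large := (large_primes K N (2 * n)).
Local Notation core := (core K n N k).
Local Notation C := ((size core)%:R : R).
Local Notation chi := (chi u).
Local Notation pairs := (sqf_pairs K k (2 * n)).

Let q2 : 2 <= q := q_ge2 R K.
Let qX0 m : 0 < q ^+ m := qX_gt0 R K m.

Let C_gt0 : 0 < C.
Proof.
have := expn_le_core n_gt0 nN Nn Wh epsE rho_le; move=> /(lt_le_trans (qX0 N)).
by rewrite pmulr_rgt0// mulr_gt0// ltr0n; apply: leq_trans nN.
Qed.

Definition core_coef Q w : R[i] :=
  ((Num.sqrt C)^-1)%:C%C * \sum_(G <- mon K (N - deg Q) | sqf k G) chi G w.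

Definition core_sum w : R[i] := ((Num.sqrt C)^-1)%:C%C * \sum_(F <- core) chi F w.

Definition core_var w : R := \sum_(Q <- large) normsq (core_coef Q w).

Let sqrtC2 : (Num.sqrt C)^-1 ^+ 2 = C^-1.
Proof. by rewrite exprVn sqr_sqrtr// ltW. Qed.

Lemma core_sumE w : core_sum w = \sum_(Q <- large) core_coef Q w * u Q w.
Proof.
rewrite /core_sum (sum_core k (fun F => chi F w) nN) big_distrr; apply: eq_big_seq => Q.
rewrite mem_large_primes => /and3P[pQ _ _] /=; rewrite /core_coef -mulrA; congr (_ * _).
rewrite big_distrl /= big_seq_cond [RHS]big_seq_cond; apply: eq_bigr => G.
rewrite mem_mon => /andP[/andP[mG _] _].
by rewrite (chiM _ _ (prime_monic pQ) mG) chi_prime// mulrC.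
Qed.

Lemma cdepends_on_core_coef Q : Q \in large ->
  cdepends_on u (prs K (2 * n)) (core_coef Q).
Proof.
rewrite mem_large_primes => /and3P[pQ Q1 Q2].
apply: cbmM; first exact: cbm_cst.
apply: cbm_sum => G; rewrite mem_mon => /andP[mG /eqP dG] _.
apply: cdepends_on_chi => //; rewrite dG.
by rewrite leq_subLR addnC -leq_subLR.
Qed.

Let bm_coef Q : Q \in large -> bounded_measurable (fun w => normsq (core_coef Q w)).
Proof.
move=> QL; apply: bm_normsq; apply: (cdepends_on_bm u_RV (all_prs K (2 * n))).
exact: cdepends_on_core_coef.
Qed.

Let r m : R := pdens (N - m) * q ^+ (N - m) / C.

Let Ssum m w : R[i] := \sum_(G <- mon K m | sqf k G) chi G w.

(** The coefficient of a large prime depends on the prime only through its degree. *)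
Lemma core_var_degree w : core_var w = \sum_(0 <= m < (2 * n).+1) r m * normsq (Ssum m w).
Proof.
rewrite /core_var.
rewrite (sum_large_primes_pdens K nN (fun m => normsq (((Num.sqrt C)^-1)%:C%C * Ssum m w))).
by apply: eq_bigr => m _; rewrite normsqZ sqrtC2 /r mulrA.
Qed.

Lemma core_varE w : (core_var w)%:C%C =
  \sum_(x <- pairs) (r (deg x.1))%:C%C * (chi x.1 w * (chi x.2 w)^*%C).
Proof.
rewrite core_var_degree.
rewrite (sum_sqf_pairs k (2 * n) (fun G G' => (r (deg G))%:C%C * (chi G w * (chi G' w)^*%C))).
rewrite (rmorph_sum (real_complex R)) /=; apply: eq_bigr => m _.
rewrite [LHS](rmorphM (real_complex R)) /= -mul_conjc /Ssum conj_sum big_distrl big_distrr /=.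
rewrite big_seq_cond [RHS]big_seq_cond; apply: eq_bigr => G.
rewrite mem_mon => /andP[/andP[mG /eqP ->] _].
by rewrite !big_distrr.
Qed.

Let pairs_monic x : x \in pairs -> (x.1 \is monic) && (x.2 \is monic).
Proof.
by rewrite mem_sqf_pairs !mem_monle => /and5P[_ _ _ /andP[-> _] /andP[-> _]].
Qed.

(* [chi] off the monic polynomials is not known to be bounded *)
Let z F w : R[i] := if F \is monic then chi F w else 0.

Let cz F : cbm (z F).
Proof. by rewrite /z; have [mF|mF] := boolP (F \is monic); [exact: (cbm_chi u_RV u_unit)|exact: cbm_cst]. Qed.

Let bz F G : bounded_measurable (fun w => complex.Re (z F w * (z G w)^*%C)).
Proof. by have [] : cbm (fun w => z F w * (z G w)^*%C) by apply: cbmM => //; exact: cbmJ. Qed.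

Let z_orth F G : F \is monic -> G \is monic ->
  Ex P (fun w => complex.Re (z F w * (z G w)^*%C)) = (F == G)%:R.
Proof. by move=> mF mG; rewrite /z mF mG; exact: (chi_orth u_RV u_indep u_unit u_moment). Qed.

Lemma core_var_ge0 w : 0 <= core_var w.
Proof. by apply: sumr_ge0 => Q _; exact: normsq_ge0. Qed.

Lemma bm_core_var : bounded_measurable core_var.
Proof.
have -> : core_var = (fun w => \sum_(Q <- large) (if Q \in large then normsq (core_coef Q w) else 0)).
  by apply/funext => w; apply: eq_big_seq => Q ->.
apply: bm_sum => Q; have [QL|QL] := boolP (Q \in large); [exact: bm_coef|exact: bm_cst].
Qed.

Lemma Ex_core_var_pairs : Ex P core_var = \sum_(x <- pairs) r (deg x.1) * (x.1 == x.2)%:R.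
Proof.
have -> : core_var = (fun w => \sum_(x <- pairs) r (deg x.1) * complex.Re (z x.1 w * (z x.2 w)^*%C)).
  apply/funext => w; rewrite -[LHS]/(complex.Re (core_var w)%:C%C) core_varE Re_sum.
  apply: eq_big_seq => x /pairs_monic/andP[m1 m2].
  by rewrite Re_scale /z m1 m2.
rewrite Ex_sum; last by move=> x; apply: bmZ; exact: bz.
apply: eq_big_seq => x /pairs_monic/andP[m1 m2].
by rewrite ExZ ?z_orth//; exact: bz.
Qed.

Lemma Ex_core_var : Ex P core_var = 1.
Proof.
have -> : core_var = (fun w => \sum_(Q <- large) (if Q \in large then normsq (core_coef Q w) else 0)).
  by apply/funext => w; apply: eq_big_seq => Q ->.
rewrite Ex_sum; last first.
  by move=> Q; have [QL|QL] := boolP (Q \in large); [exact: bm_coef|exact: bm_cst].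
transitivity (\sum_(Q <- large) C^-1 * \sum_(G <- mon K (N - deg Q) | sqf k G) 1).
  apply: eq_big_seq => Q ->.
  have us : uniq [seq G <- mon K (N - deg Q) | sqf k G] by rewrite filter_uniq// mon_uniq.
  have ms : {in [seq G <- mon K (N - deg Q) | sqf k G], forall G, G \is monic}.
    by move=> G; rewrite mem_filter mem_mon => /and3P[].
  have := Ex_normsq_sum u_RV u_indep u_unit u_moment (fun=> (Num.sqrt C)^-1) us ms.
  rewrite sqrtC2 big_filter => E.
  transitivity (\sum_(G <- mon K (N - deg Q) | sqf k G) C^-1); last first.
    by rewrite big_distrr; apply: eq_bigr => G _; rewrite /= mulr1.
  rewrite -E; congr Ex; apply/funext => w; congr normsq.
  by rewrite big_filter /core_coef big_distrr.
rewrite -big_distrr /= -(sum_core k (fun=> 1 : R) nN).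
by rewrite big_const_seq count_predT iter_addr_0 mulVf// gt_eqF.
Qed.

Let r_ge0 m : 0 <= r m.
Proof. by rewrite /r divr_ge0 ?(ltW C_gt0)// mulr_ge0 ?pdens_ge0// ltW. Qed.

Let N_gt0 : 0 < N%:R :> R.
Proof. by rewrite ltr0n; apply: leq_trans nN. Qed.

(** N <= 2 (N - m), and the density of the primes of degree N - m is at most 1/(N - m). *)
Let r_le m : (m <= 2 * n)%N -> r m <= 2 * q ^+ N / (N%:R * C) * (q ^+ m)^-1.
Proof.
move=> mn; have Nm : (0 < N - m)%N by lia.
have h : N%:R * pdens (N - m) <= 2.
  have := pdens_le R K Nm.
  have : N%:R * pdens (N - m) <= 2 * (N - m)%:R * pdens (N - m).
    by rewrite ler_wpM2r ?pdens_ge0// -natrM ler_nat; lia.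
  by lra.
have -> : q ^+ N = q ^+ (N - m) * q ^+ m by rewrite -exprD subnK//; lia.
have -> : 2 * (q ^+ (N - m) * q ^+ m) / (N%:R * C) / q ^+ m = (2 / N%:R) * q ^+ (N - m) / C.
  by field; rewrite !gt_eqF.
rewrite /r ler_wpM2r ?invr_ge0 ?(ltW C_gt0)// ler_wpM2r ?(ltW (qX0 _))//.
by rewrite ler_pdivlMr// mulrC.
Qed.

(** Orthogonality keeps the quadruples with x.1 y.1 = x.2 y.2. Those with x.1 = x.2 reproduce (E
    V)^2 = 1; the others are bounded by [sum_sqf_quadruples], and 18432 = 288 * 8^2. *)
Lemma Ex_core_var_sqr : 144 * eps ^+ 2 <= 2^-1 ->
  Ex P (fun w => core_var w ^+ 2) <= 1 + 18432 * eps ^+ 2.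
Proof.
move=> eps2.
have conjM (a b : R[i]) : (a * b)^*%C = a^*%C * b^*%C by rewrite rmorphM.
have realM (a b : R) : (a * b)%:C%C = a%:C%C * b%:C%C by rewrite rmorphM.
have VE w : core_var w ^+ 2 = \sum_(x <- pairs) \sum_(y <- pairs)
    r (deg x.1) * r (deg y.1) * complex.Re (z (x.1 * y.1) w * (z (x.2 * y.2) w)^*%C).
  have -> : core_var w ^+ 2 = complex.Re ((core_var w)%:C%C * (core_var w)%:C%C).
    by rewrite /=; ring.
  rewrite core_varE big_distrl Re_sum.
  apply: eq_big_seq => x /pairs_monic/andP[x1 x2] /=; rewrite big_distrr Re_sum.
  apply: eq_big_seq => y /pairs_monic/andP[y1 y2] /=.
  rewrite -Re_scale /z !monicMl// (chiM _ _ x1 y1) (chiM _ _ x2 y2); congr complex.Re.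
  by rewrite y1 y2 conjM realM; ring.
have -> : Ex P (fun w => core_var w ^+ 2) = \sum_(x <- pairs) \sum_(y <- pairs)
    r (deg x.1) * r (deg y.1) * (x.1 * y.1 == x.2 * y.2)%:R.
  under eq_fun do rewrite VE.
  rewrite Ex_sum; last by move=> x; apply: bm_sum => y; apply: bmZ; exact: bz.
  apply: eq_big_seq => x /pairs_monic/andP[x1 x2].
  rewrite Ex_sum; last by move=> y; apply: bmZ; exact: bz.
  apply: eq_big_seq => y /pairs_monic/andP[y1 y2].
  by rewrite ExZ ?z_orth ?monicMl//; exact: bz.
apply: (@le_trans _ _ (Ex P core_var * Ex P core_var + \sum_(x <- pairs)
   \sum_(y <- pairs | (x.1 * y.1 == x.2 * y.2) && (x.1 != x.2)) r (deg x.1) * r (deg y.1))).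
  rewrite Ex_core_var_pairs big_distrlr -big_split big_seq [leRHS]big_seq /=.
  apply: ler_sum => x xp; rewrite [X in _ <= _ + X]big_mkcond -big_split /=.
  rewrite big_seq [leRHS]big_seq; apply: ler_sum => y yp.
  have /andP[m1 _] := pairs_monic xp.
  have rr : 0 <= r (deg x.1) * r (deg y.1) by rewrite mulr_ge0.
  have [E|NE] := eqVneq x.1 x.2; last first.
    by rewrite andbT mulr0 mul0r add0r; case: eqP => _; rewrite ?mulr1 ?mulr0.
  rewrite andbF addr0 -E mulr1 mulrA (inj_eq (mulfI (monic_neq0 m1))).
  by rewrite lexx.
rewrite Ex_core_var mulr1 lerD2l.
pose A := 2 * q ^+ N / (N%:R * C).
have A0 : 0 <= A by rewrite divr_ge0 ?mulr_ge0 ?(ltW C_gt0) ?(ltW (qX0 _)).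
apply: (@le_trans _ _ (A ^+ 2 * \sum_(x <- pairs)
    \sum_(y <- pairs | (x.1 * y.1 == x.2 * y.2) && (x.1 != x.2)) (q ^+ deg x.1 * q ^+ deg y.1)^-1)).
  rewrite big_distrr big_seq [leRHS]big_seq; apply: ler_sum => x xp /=.
  rewrite big_distrr big_seq_cond [leRHS]big_seq_cond; apply: ler_sum => y /andP[yp _] /=.
  have dM v : v \in pairs -> (deg v.1 <= 2 * n)%N.
    by rewrite mem_sqf_pairs !mem_monle => /and5P[_ _ _ /andP[]].
  have -> : A ^+ 2 * (q ^+ deg x.1 * q ^+ deg y.1)^-1 =
     (A * (q ^+ deg x.1)^-1) * (A * (q ^+ deg y.1)^-1) by rewrite invfM expr2; ring.
  by apply: ler_pM => //; apply: r_le; exact: dM.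
apply: le_trans (ler_wpM2l (sqr_ge0 _) (sum_sqf_quadruples R K k (2 * n))) _.
have := sum_quadruple_weight (@wt_ge0 R K) (@wt0E R K) (@wtE0 R K) (@wt_recursion R K)
  n_gt0 (fun j => @cumwt_lower R K j n) Wh epsE eps2.
move=> /(ler_wpM2l (sqr_ge0 A)) h; apply: le_trans h _.
have := weight_le_core n_gt0 nN Nn Wh epsE rho_le.
set W := \sum_(0 <= i < (2 * n).+1) wt R K k i => hW.
have W0 : 0 <= W by apply: sumr_ge0 => i _; exact: wt_ge0.
have AW : A * W <= 8.
  rewrite /A mulrAC ler_pdivrMr ?mulr_gt0//.
  rewrite [leLHS](_ : _ = 2 * (W * q ^+ N)); last by ring.
  by move: hW; lra.
rewrite [leLHS](_ : _ = 288 * eps ^+ 2 * (A * W) ^+ 2); last by ring.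
have : (A * W) ^+ 2 <= 8 ^+ 2 by rewrite lerXn2r ?nnegrE ?mulr_ge0.
have e0 : 0 <= 288 * eps ^+ 2 := mulr_ge0 (ler0n _ _) (sqr_ge0 _).
move=> /(ler_wpM2l e0) h2; apply: le_trans h2 _.
by rewrite [leLHS](_ : _ = 18432 * eps ^+ 2)//; ring.
Qed.


Lemma prime_count_ge D : (0 < D)%N -> (N <= 2 * D)%N -> N%:R / 128 <= pdens D * q ^+ D.
Proof.
move=> D0 ND; have DR : 0 < D%:R :> R by rewrite ltr0n.
have h : 2^-1 / D%:R <= pdens D by rewrite ler_pdivrMr// mulrC; exact: pdens_ge.
apply: (@le_trans _ _ (2^-1 / D%:R * 2 ^+ D)); last first.
  apply: (@le_trans _ _ (pdens D * 2 ^+ D)); first by rewrite ler_wpM2r ?exprn_ge0.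
  by rewrite ler_wpM2l ?pdens_ge0// lerXn2r ?nnegrE//; move: q2; lra.
rewrite mulrAC ler_pdivlMr//.
have : (D ^ 4)%:R <= (32 * 2 ^ D)%:R :> R by rewrite ler_nat quartic_le_exp2.
have : (N * D)%:R <= (2 * D ^ 4)%:R :> R.
  rewrite ler_nat (leq_trans (leq_mul ND (leqnn D)))// -mulnA leq_mul2l /=.
  by rewrite -[(D * D)%N]/(D ^ 2)%N leq_pexp2l.
by rewrite !natrM !natrX; lra.
Qed.

(** At least N / 128 primes share the degree of Q and hence its coefficient, so a single one carries
    at most 128 / N of V. *)
Lemma core_coef_le Q w : Q \in large -> N%:R / 128 * normsq (core_coef Q w) <= core_var w.
Proof.
rewrite mem_large_primes => /and3P[pQ Q1 QN].
have Q0 : (N - deg Q < (2 * n).+1)%N by rewrite ltnS leq_subLR addnC -leq_subLR.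
apply: (@le_trans _ _ (r (N - deg Q) * normsq (Ssum (N - deg Q) w))); last first.
  rewrite core_var_degree big_mkord (bigD1 (Ordinal Q0)) //= lerDl.
  by apply: sumr_ge0 => i _; rewrite mulr_ge0 ?normsq_ge0.
rewrite /r subKn// /core_coef normsqZ sqrtC2 -/(Ssum _ _) mulrA.
rewrite ler_wpM2r ?normsq_ge0// ler_wpM2r ?invr_ge0 ?(ltW C_gt0)//.
have [N4 Q2] := large_deg_ge nN Q1; exact: prime_count_ge.
Qed.

Let coef Q w : R[i] := if Q \in large then core_coef Q w else 0.

Let cdepends_on_coef Q : cdepends_on u (prs K (2 * n)) (coef Q).
Proof.
rewrite /coef; have [QL|QL] := boolP (Q \in large); last exact: cbm_cst.
exact: cdepends_on_core_coef.
Qed.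

Let bm_coef' Q : bounded_measurable (fun w => normsq (coef Q w)).
Proof.
apply: bm_normsq; apply: (cdepends_on_bm u_RV (all_prs K (2 * n))).
exact: cdepends_on_coef.
Qed.

Let sum_coef w : \sum_(Q <- large) normsq (coef Q w) = core_var w.
Proof. by apply: eq_big_seq => Q QL; rewrite /coef QL. Qed.

Lemma sum_core_coef_sqr : 18432 * eps ^+ 2 <= 1 ->
  \sum_(Q <- large) Ex P (fun w => normsq (coef Q w) ^+ 2) <= 256 / N%:R.
Proof.
move=> eps2; rewrite -Ex_sum; last by move=> Q; exact: bmX.
apply: (@le_trans _ _ (Ex P (fun w => 128 / N%:R * core_var w ^+ 2))).
  apply: le_Ex; first by apply: bm_sum => Q; exact: bmX.
    by apply: bmZ; apply: bmX; exact: bm_core_var.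
  move=> w; rewrite expr2 -{1}sum_coef mulrA mulrAC big_distrr big_seq [leRHS]big_seq.
  apply: ler_sum => Q QL /=; rewrite /coef QL expr2.
  rewrite ler_wpM2r ?normsq_ge0//.
  have := core_coef_le w QL.
  move: (normsq _) (core_var w) => x v h.
  have -> : x = 128 / N%:R * (N%:R / 128 * x) by field; rewrite gt_eqF.
  by apply: ler_wpM2l => //; exact: divr_ge0 (ler0n _ _) (ler0n _ _).
rewrite ExZ; last by apply: bmX; exact: bm_core_var.
have e144 : 144 * eps ^+ 2 <= 2^-1 by lra.
have h := Ex_core_var_sqr e144.
have -> : 256 / N%:R = 128 / N%:R * 2 :> R by ring.
by apply: ler_wpM2l; [exact: divr_ge0 (ler0n _ _) (ler0n _ _)|lra].
Qed.

(** |x| <= t + x^2 / t with x = V - 1; since E V = 1, the second moment bounds the variance. *)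
Let cvar_dist t : 0 < t -> 144 * eps ^+ 2 <= 2^-1 ->
  Ex P (fun w => `|core_var w - 1|) <= t + 18432 * eps ^+ 2 / t.
Proof.
move=> t0 e144; have bV := bm_core_var.
have b1 : bounded_measurable (fun w => core_var w - 1) by apply: bmB => //; exact: bm_cst.
have b2 : bounded_measurable (fun w => core_var w ^+ 2) by exact: bmX.
have b3 : bounded_measurable (fun w => 2 * core_var w) by exact: bmZ.
have b4 : bounded_measurable (fun w => core_var w ^+ 2 - 2 * core_var w + 1).
  by apply: bmD; [exact: bmB|exact: bm_cst].
apply: (@le_trans _ _ (Ex P (fun w => t + t^-1 * (core_var w ^+ 2 - 2 * core_var w + 1)))).
  apply: le_Ex; first exact: bm_abs.
    by apply: bmD; [exact: bm_cst|exact: bmZ].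
  move=> w; have -> : core_var w ^+ 2 - 2 * core_var w + 1 = `|core_var w - 1| ^+ 2.
    by rewrite real_normK ?num_real//; ring.
  move: `|_| => x; rewrite -subr_ge0.
  have -> : t + t^-1 * x ^+ 2 - x = t^-1 * ((t - x / 2) ^+ 2 + 3 / 4 * x ^+ 2) by field; rewrite gt_eqF.
  by rewrite mulr_ge0 ?invr_ge0 ?(ltW t0)// addr_ge0 ?sqr_ge0// mulr_ge0 ?sqr_ge0//; lra.
rewrite (ExD _ (bm_cst _ _) (bmZ _ b4)) Ex_cst ExZ// (ExD _ (bmB b2 b3) (bm_cst _ _)) Ex_cst.
rewrite ExB// ExZ// Ex_core_var lerD2l mulrC ler_wpM2r ?invr_ge0 ?(ltW t0)//.
have := Ex_core_var_sqr e144; rewrite mulr1 -[X in _ - 2 + X]/(1 : R); lra.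
Qed.

Lemma core_heat s t y : 0 < s -> 0 < t -> 18432 * eps ^+ 2 <= 1 ->
  `|Ex P (fun w => heat s (y - core_sum w)) - heat (1 + s) y| <=
  heat_const R * (t * s^-1 + 256 / N%:R / s ^+ 2 / t) / s + (t + 18432 * eps ^+ 2 / t) / s ^+ 2.
Proof.
move=> s0 t0 eps2; have e144 : 144 * eps ^+ 2 <= 2^-1 by lra.
have us : uniq (large ++ prs K (2 * n)).
  rewrite cat_uniq large_primes_uniq prs_uniq andbT /=; apply/hasPn => Q.
  rewrite mem_prs => /andP[pQ Q1]; rewrite mem_large_primes pQ /= negb_and -!ltnNge.
  by rewrite (small_lt_large nN).
have Js : all (@prime_poly K) (large ++ prs K (2 * n)).
  rewrite all_cat all_prs andbT; apply/allP => Q.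
  by rewrite mem_large_primes => /andP[].
have h1 : `|Ex P (fun w => heat s (y - core_sum w)) - Ex P (fun w => heat (s + core_var w) y)| <=
    \sum_(Q <- large) Ex P (fun w => heat_const R *
       (t * (normsq (coef Q w) / s) + (normsq (coef Q w) / s) ^+ 2 / t) / s).
  have -> : (fun w => heat s (y - core_sum w)) =
      (fun w => heat s (y - \sum_(Q <- large) coef Q w * u Q w)).
    apply/funext => w; rewrite core_sumE; congr (heat _ (_ - _)).
    by apply: eq_big_seq => Q QL; rewrite /coef QL.
  have -> : (fun w => heat (s + core_var w) y) =
      (fun w => heat (s + \sum_(Q <- large) normsq (coef Q w)) y).
    by apply/funext => w; rewrite sum_coef.
  exact: (lindeberg u_RV u_indep u_unit u_moment us Js s0 t0 (fun=> lexx s)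
    (@bm_cst R _ (sigma_of u (prs K (2 * n))) s)
    (@cbm_cst R _ (sigma_of u (prs K (2 * n))) y) cdepends_on_coef).
have b1 Q : bounded_measurable (fun w => normsq (coef Q w) / s).
  by apply: bmM; [exact: bm_coef'|exact: bm_cst].
apply: le_trans (ler_distD (Ex P (fun w => heat (s + core_var w) y)) _ _) _; apply: lerD.
  apply: le_trans h1 _.
  have -> : \sum_(Q <- large) Ex P (fun w => heat_const R *
       (t * (normsq (coef Q w) / s) + (normsq (coef Q w) / s) ^+ 2 / t) / s) =
    heat_const R * (t * s^-1 * \sum_(Q <- large) Ex P (fun w => normsq (coef Q w)) +
       (\sum_(Q <- large) Ex P (fun w => normsq (coef Q w) ^+ 2)) / s ^+ 2 / t) / s.
    have bs Q := bmX 2 (bm_coef' Q).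
    transitivity (\sum_(Q <- large) (heat_const R * (t * s^-1) / s * Ex P (fun w => normsq (coef Q w)) +
        heat_const R / s ^+ 2 / t / s * Ex P (fun w => normsq (coef Q w) ^+ 2))).
      apply: eq_bigr => Q _; rewrite -!ExZ// -ExD; [|exact: bmZ|exact: bmZ].
      by congr Ex; apply/funext => w; field; rewrite !gt_eqF.
    by rewrite big_split -!big_distrr /=; field; rewrite !gt_eqF.
  rewrite -Ex_sum// (_ : (fun w => \sum_(i <- _) _) = core_var); last first.
    by apply/funext => w; rewrite sum_coef.
  rewrite Ex_core_var mulr1 ler_wpM2r ?invr_ge0 ?(ltW s0)// ler_wpM2l ?heat_const_ge0//.
  rewrite lerD2l ler_wpM2r ?invr_ge0 ?(ltW t0)// ler_wpM2r ?invr_ge0 ?exprn_ge0 ?(ltW s0)//.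
  exact: sum_core_coef_sqr.
have bV := bm_core_var.
have sV w : s <= s + core_var w by rewrite lerDl core_var_ge0.
have bH : bounded_measurable (fun w => heat (s + core_var w) y).
  apply: (bm_heat s0) => //; last exact: cbm_cst.
  by apply: bmD => //; exact: bm_cst.
rewrite -(Ex_cst P (heat (1 + s) y)) -ExB//; last exact: bm_cst.
have bD : bounded_measurable (fun w => heat (s + core_var w) y - cst (heat (1 + s) y) w).
  by apply: bmB => //; exact: bm_cst.
apply: le_trans (le_norm_Ex P bD) _.
have bA : bounded_measurable (fun w => `|core_var w - 1|).
  by apply: bm_abs; apply: bmB => //; exact: bm_cst.
apply: (@le_trans _ _ (Ex P (fun w => (s ^+ 2)^-1 * `|core_var w - 1|))); last first.
  by rewrite ExZ// mulrC ler_wpM2r ?invr_ge0 ?sqr_ge0// cvar_dist.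
apply: le_Ex; [exact: bm_abs|exact: bmZ|move=> w /=].
have V0 := core_var_ge0 w.
apply: le_trans (heat_lip_time _ (lt_le_trans s0 (sV w)) (ltr_wpDl ler01 s0)) _.
exact: inv_dist.
Qed.


(** * From the core to a family slightly larger than it *)

Section Transfer.
Variable A : seq {poly K}.
Hypotheses (A_uniq : uniq A) (coreA : {subset core <= A}).
Hypothesis A_sub : {subset A <= [seq F <- mon K N | (omega F == k.+1) || (Omega F == k.+1)]}.

Local Notation rho := (200 * eps + 1024 / N%:R).

Definition character_sum w : R[i] :=
  ((Num.sqrt ((size A)%:R : R))^-1)%:C%C * \sum_(F <- A) chi F w.

Let A_monic : {in A, forall F, F \is monic}.
Proof. by move=> F /A_sub; rewrite mem_filter mem_mon => /andP[_ /andP[]]. Qed.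

Let core_le_A : C <= (size A)%:R.
Proof. by rewrite ler_nat uniq_leq_size// filter_uniq// mon_uniq. Qed.

Let A_le : (size A)%:R <= (1 + 2 * rho) * C.
Proof.
apply: le_trans (card_le_core n_gt0 nN Nn Wh epsE rho_le).
rewrite -sum1_size natr_sum -[leRHS]big_filter; apply: sum_le_sub => //.
Qed.

Let sum_core_A (x : R) : \sum_(F <- A) (if F \in core then x else 0) = C * x.
Proof.
rewrite -big_mkcond -big_filter big_const_seq count_predT iter_addr_0 mulr_natl.
congr (_ *+ _); apply: perm_size; apply: uniq_perm; rewrite ?filter_uniq ?mon_uniq//.
by move=> F; rewrite [LHS]mem_filter andb_idr//; exact: coreA.
Qed.

(** By Parseval the left side is 2 - 2 sqrt(C / |A|). Here sqrt x >= x for x <= 1, and C / |A| >= 1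
    - 2 rho. *)
Lemma Ex_core_transfer :
  Ex P (fun w => normsq (core_sum w - character_sum w)) <= 4 * rho.
Proof.
have A_gt0 : 0 < (size A)%:R :> R := lt_le_trans C_gt0 core_le_A.
pose a := (Num.sqrt C)^-1; pose b := (Num.sqrt ((size A)%:R : R))^-1.
have b2 : b ^+ 2 = (size A)%:R^-1 by rewrite /b exprVn sqr_sqrtr// ltW.
have b0 : 0 <= b by rewrite invr_ge0 sqrtr_ge0.
have ba : b <= a by rewrite lef_pV2 ?posrE ?sqrtr_gt0// ler_sqrt.
pose e F := (if F \in core then a else 0) - b.
have -> : (fun w => normsq (core_sum w - character_sum w)) =
    (fun w => normsq (\sum_(F <- A) (e F)%:C%C * chi F w)).
  apply/funext => w; congr normsq.
  have realB (x y : R) : (x - y)%:C%C = x%:C%C - y%:C%C by rewrite rmorphB.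
  under eq_bigr do rewrite /e realB mulrBl.
  rewrite sumrB -[X in _ = _ - X]big_distrr /=; congr (_ - _).
  rewrite /core_sum big_distrr /=.
  have -> : \sum_(F <- A) (if F \in core then a else 0)%:C%C * chi F w =
      \sum_(F <- A | F \in core) a%:C%C * chi F w.
    rewrite [RHS]big_mkcond; apply: eq_bigr => F _; case: ifP => // _.
    by rewrite (_ : 0%:C%C = 0)// mul0r.
  rewrite -[RHS]big_filter; apply: perm_big; apply: uniq_perm; rewrite ?filter_uniq ?mon_uniq//.
  by move=> F; rewrite [RHS]mem_filter andb_idr//; exact: coreA.
rewrite (Ex_normsq_sum u_RV u_indep u_unit u_moment)//.
have -> : \sum_(F <- A) e F ^+ 2 = 2 - 2 * (C * a * b).
  transitivity (\sum_(F <- A) ((if F \in core then a ^+ 2 - 2 * a * b else 0) + b ^+ 2)).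
    by apply: eq_bigr => F _; rewrite /e; case: ifP => _; ring.
  rewrite big_split sum_core_A /= big_const_seq count_predT iter_addr_0 -[X in _ + X]mulr_natl b2.
  rewrite sqrtC2 mulfV ?gt_eqF// mulrBr mulfV ?gt_eqF//; ring.
have h1 : C / (size A)%:R <= C * a * b.
  by rewrite -b2 expr2 mulrA ler_wpM2r// ler_wpM2l.
have rho0 : 0 <= rho.
  apply: addr_ge0; first exact: mulr_ge0 (ler0n _ _) (eps_ge0 Wh epsE).
  exact: divr_ge0 (ler0n _ _) (ler0n _ _).
have h2 : 1 - 2 * rho <= C / (size A)%:R.
  by rewrite ler_pdivlMr//; apply: ratio_ge => //; exact: ltW.
by have := le_trans h2 h1; lra.
Qed.

Let cbm_character_sum : cbm character_sum.
Proof.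
apply: cbmM; first exact: cbm_cst.
by apply: cbm_sum => F FA _; apply: (cbm_chi u_RV u_unit); exact: A_monic.
Qed.

Let cbm_core_sum : cbm core_sum.
Proof.
apply: cbmM; first exact: cbm_cst.
by apply: cbm_sum => F FA _; apply: (cbm_chi u_RV u_unit); apply: A_monic; exact: coreA.
Qed.

Lemma character_sum_heat s t y : 0 < s -> 0 < t -> 18432 * eps ^+ 2 <= 1 ->
  `|Ex P (fun w => heat s (y - character_sum w)) - heat (1 + s) y| <=
  (t + (1 + t^-1) * (4 * rho / s)) / s +
  (heat_const R * (t * s^-1 + 256 / N%:R / s ^+ 2 / t) / s + (t + 18432 * eps ^+ 2 / t) / s ^+ 2).
Proof.
move=> s0 t0 eps2.
apply: le_trans (ler_distD (Ex P (fun w => heat s (y - core_sum w))) _ _) _.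
apply: lerD; last exact: core_heat.
have bh Z : cbm Z -> bounded_measurable (fun w => heat s (y - Z w)).
  move=> cZ; apply: (bm_heat s0 (fun=> lexx s)); first exact: bm_cst.
  by apply: cbmB => //; exact: cbm_cst.
have bd : bounded_measurable (fun w => normsq (core_sum w - character_sum w)).
  by apply: bm_normsq; exact: cbmB.
rewrite -ExB; [|exact: bh|exact: bh].
apply: le_trans (le_norm_Ex P _) _; first by apply: bmB; exact: bh.
apply: (@le_trans _ _ (Ex P (fun w => t / s + (1 + t^-1) / s ^+ 2 *
    normsq (core_sum w - character_sum w)))).
  apply: le_Ex; first by apply: bm_abs; apply: bmB; exact: bh.
    by apply: bmD; [exact: bm_cst|exact: bmZ].
  move=> w; apply: le_trans (heat_lip_space _ _ s0 t0) _.
  rewrite (_ : y - character_sum w - (y - core_sum w) = core_sum w - character_sum w); last by ring.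
  by rewrite le_eqVlt; apply/orP; left; apply/eqP; field; rewrite !gt_eqF.
rewrite (ExD _ (bm_cst _ _) (bmZ _ bd)) Ex_cst ExZ// [leRHS]mulrDl lerD2l.
have c0 : 0 <= (1 + t^-1) / s ^+ 2.
  by rewrite divr_ge0 ?sqr_ge0// addr_ge0// invr_ge0 ltW.
apply: le_trans (ler_wpM2l c0 Ex_core_transfer) _.
by rewrite le_eqVlt; apply/orP; left; apply/eqP; field; rewrite !gt_eqF.
Qed.

End Transfer.

End CoreSum.

(** * A logarithmic lower bound for the sum of the prime densities *)

Section Harmonic.
Variable R : realType.

Lemma ln_le_harmonic n : ln (n.+1%:R : R) <= \sum_(1 <= i < n.+1) i%:R^-1.
Proof.
elim: n => [|n IH]; first by rewrite ln1 big_geq.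
rewrite big_nat_recr//=.
have n0 : 0 < n.+1%:R :> R by rewrite ltr0n.
have -> : n.+2%:R = n.+1%:R * (1 + n.+1%:R^-1) :> R.
  by rewrite mulrDr mulr1 mulfV ?gt_eqF// -natr1.
rewrite lnM ?posrE ?addr_gt0 ?invr_gt0//; apply: lerD => //.
by apply: le_ln1Dx; apply: lt_trans (_ : 0 < _); rewrite ?invr_gt0 ?ltrN10.
Qed.

(** Densities of at least 1/(2 i) give half a harmonic sum. As N <= 4 (n + 1) and ln 4 <= ln N / 2
    for N >= 16, ln (n + 1) is at least ln N / 2. *)
Lemma ln_le_cumpdens (K : finFieldType) N : (16 <= N)%N ->
  ln (N%:R : R) / 4 <= cumpdens R K (N.-1 %/ 4).
Proof.
move=> N16; set n := (N.-1 %/ 4)%N.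
have nN : (N <= 4 * n.+1)%N by rewrite /n; lia.
have N0 : 0 < N%:R :> R by rewrite ltr0n; lia.
apply: (@le_trans _ _ (2^-1 * \sum_(1 <= i < n.+1) i%:R^-1)); last first.
  rewrite big_distrr /= big_nat [leRHS]big_nat; apply: ler_sum => i /andP[i0 _].
  by rewrite ler_pdivrMr ?ltr0n// mulrC; exact: pdens_ge.
apply: le_trans (ler_wpM2l _ (ln_le_harmonic n)); last by rewrite invr_ge0.
have h1 : ln (N%:R : R) <= ln (4%:R : R) + ln (n.+1%:R : R).
  by rewrite -lnM ?posrE ?ltr0n// -natrM ler_ln ?posrE ?ltr0n ?ler_nat//; lia.
have h2 : ln (4%:R : R) + ln (4%:R : R) <= ln (N%:R : R).
  by rewrite -lnM ?posrE ?ltr0n// -natrM ler_ln ?posrE ?ltr0n ?ler_nat//; lia.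
by move: h1 h2; move: (ln _) (ln _) (ln _) => x y v; lra.
Qed.

End Harmonic.

(** * Choice of the parameters and passage to the limit *)

Section Asymptotic.
Variable R : realType.

(** Separates what is small with t from what tends to 0 for fixed t; x stands for 1/N. *)
Lemma heat_error_le (s t eps x c : R) : 0 < s -> 0 < t -> 0 <= eps -> eps <= 1 -> 0 <= x -> 0 <= c ->
  (t + (1 + t^-1) * (4 * (200 * eps + 1024 * x) / s)) / s +
  (c * (t * s^-1 + 256 * x / s ^+ 2 / t) / s + (t + 18432 * eps ^+ 2 / t) / s ^+ 2) <=
  t * (s^-1 + c / s ^+ 2 + (s ^+ 2)^-1) +
  ((1 + t^-1) * 4096 / s ^+ 2 + c * 256 / s ^+ 3 / t + 18432 / t / s ^+ 2) * (eps + x).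
Proof.
move=> s0 t0 e0 e1 x0 c0.
have s2 : 0 <= (s ^+ 2)^-1 by rewrite invr_ge0 sqr_ge0.
have s3 : 0 <= (s ^+ 3)^-1 by rewrite invr_ge0 exprn_ge0// ltW.
have ti : 0 <= t^-1 by rewrite invr_ge0 ltW.
rewrite -subr_ge0.
have -> : t * (s^-1 + c / s ^+ 2 + (s ^+ 2)^-1) +
  ((1 + t^-1) * 4096 / s ^+ 2 + c * 256 / s ^+ 3 / t + 18432 / t / s ^+ 2) * (eps + x) -
  ((t + (1 + t^-1) * (4 * (200 * eps + 1024 * x) / s)) / s +
  (c * (t * s^-1 + 256 * x / s ^+ 2 / t) / s + (t + 18432 * eps ^+ 2 / t) / s ^+ 2)) =
  (1 + t^-1) * (s ^+ 2)^-1 * (3296 * eps) + c * 256 * (s ^+ 3)^-1 * t^-1 * eps +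
  18432 * t^-1 * (s ^+ 2)^-1 * (eps * (1 - eps) + x).
  by field; rewrite !gt_eqF.
have ee : 0 <= eps * (1 - eps) by rewrite mulr_ge0// subr_ge0.
apply: addr_ge0; first apply: addr_ge0.
- exact: mulr_ge0 (mulr_ge0 (addr_ge0 ler01 ti) s2) (mulr_ge0 (ler0n _ _) e0).
- exact: mulr_ge0 (mulr_ge0 (mulr_ge0 (mulr_ge0 c0 (ler0n _ _)) s3) ti) e0.
exact: mulr_ge0 (mulr_ge0 (mulr_ge0 (ler0n _ _) ti) s2) (addr_ge0 ee x0).
Qed.

(** The third conclusion is the threshold 113 of [W_doubling] expressed through [eps]. *)
Lemma small_parameters (eps x eta : R) : 0 <= eps -> eps <= eta -> x <= eta -> eta <= 1 / 4096 ->
  [/\ 200 * eps + 1024 * x <= 2^-1, 18432 * eps ^+ 2 <= 1, eps * 113 <= 4 & eps <= 1].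
Proof.
move=> e0 e1 x1 h; have e2 := le_trans e1 h.
by have := ler_wpM2l e0 e2; rewrite -expr2; split; lra.
Qed.

Lemma quarter_split m : (16 <= m)%N ->
  [/\ (0 < m.-1 %/ 4)%N, (2 * (2 * (m.-1 %/ 4)) < m)%N & (m <= 8 * (m.-1 %/ 4))%N].
Proof. by move=> m16; split; lia. Qed.

Lemma split_error (c2 eta e x : R) : 0 <= c2 -> 0 < eta -> eta <= e / 4 / (c2 + 1) -> x <= 2 * eta ->
  e / 2 + c2 * x <= e.
Proof.
move=> c0 eta0 etae xe.
have h1 : eta * (c2 + 1) <= e / 4 by rewrite -ler_pdivlMr//; lra.
have : c2 * x <= c2 * (2 * eta) by rewrite ler_wpM2l.
lra.
Qed.

Variables (K : nat -> finFieldType) (N k : nat -> nat).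
Variables (d : nat -> measure_display) (T : forall n, measurableType (d n)).
Variables (P : forall n, probability (T n) R) (u : forall n, {poly K n} -> T n -> R[i]).
Arguments u : clear implicits.
Hypothesis k_gt0 : forall n, (1 <= k n)%N.
Hypothesis N_oo : N @ \oo --> \oo.
Hypothesis kN : ((k n)%:R / ln ((N n)%:R : R)) @[n --> \oo] --> (0 : R).
Hypothesis u_RV : forall n Q, prime_poly Q -> complex_RV (u n Q).
Hypothesis u_indep : forall n, mutually_independent (P n) (@prime_poly (K n)) (u n).
Hypothesis u_unit : forall n Q w, prime_poly Q -> normsq (u n Q w) = 1.
Hypothesis u_moment : forall n Q m, prime_poly Q -> (0 < m)%N ->
  Ex (P n) (fun w => complex.Re (u n Q w ^+ m)) = 0 /\
  Ex (P n) (fun w => complex.Im (u n Q w ^+ m)) = 0.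

Variable a : forall n, {poly K n} -> bool.
Arguments a : clear implicits.
Hypothesis a_core : forall n F, omega F = k n -> Omega F = k n -> a n F.
Hypothesis a_sub : forall n F, a n F -> (omega F == k n) || (Omega F == k n).

Let A n := [seq F <- mon (K n) (N n) | a n F].

Let eps n : R := 4 * (k n)%:R / cumpdens R (K n) ((N n).-1 %/ 4).

Let N_large (m : nat) : \forall n \near \oo, (m <= N n)%N.
Proof. by have := N_oo (nbhs_infty_ge m). Qed.

Let eps_le : \forall n \near \oo, 0 <= eps n <= 16 * ((k n)%:R / ln ((N n)%:R : R)).
Proof.
near=> n.
have N16 : (16 <= N n)%N by near: n; exact: N_large.
have h := ln_le_cumpdens R (K n) N16.
have l0 : 0 < ln ((N n)%:R : R) by rewrite ln_gt0// ltr1n; lia.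
have c0 : 0 < cumpdens R (K n) ((N n).-1 %/ 4) by apply: lt_le_trans h; rewrite divr_gt0.
rewrite /eps divr_ge0 ?mulr_ge0 ?(ltW c0)//=.
rewrite ler_pdivrMr//.
have k0 : 0 <= (k n)%:R / ln ((N n)%:R : R) by rewrite divr_ge0// ltW.
have := ler_wpM2l k0 h.
have -> : (k n)%:R / ln ((N n)%:R : R) * (ln ((N n)%:R : R) / 4) = (k n)%:R / 4.
  by field; rewrite gt_eqF.
by lra.
Unshelve. all: by end_near. Qed.

Lemma character_sum_heat_cvg s y : 0 < s ->
  Ex (P n) (fun w => heat s (y - character_sum (u n) (A n) w)) @[n --> \oo] --> heat (1 + s) y.
Proof.
move=> s0; apply/cvgrPdist_le => e e0.
have c0 := heat_const_ge0 R; set c := heat_const R in c0.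
pose c1 := s^-1 + c / s ^+ 2 + (s ^+ 2)^-1.
have s2 : 0 <= (s ^+ 2)^-1 by rewrite invr_ge0 sqr_ge0.
have s3 : 0 <= (s ^+ 3)^-1 by rewrite invr_ge0 exprn_ge0// ltW.
have c1_gt0 : 0 < c1.
  by rewrite /c1 -addrA ltr_wpDr ?invr_gt0// addr_ge0// mulr_ge0.
(* t is fixed first and uses half of e; [eta] is chosen afterwards, small in terms of [c2], which
   contains 1/t. *)
pose t := e / 2 / c1.
have t0 : 0 < t by rewrite /t !divr_gt0.
pose c2 := (1 + t^-1) * 4096 / s ^+ 2 + c * 256 / s ^+ 3 / t + 18432 / t / s ^+ 2.
have ti : 0 < t^-1 by rewrite invr_gt0.
have c2_ge0 : 0 <= c2.
  apply: addr_ge0; first apply: addr_ge0.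
  - exact: mulr_ge0 (mulr_ge0 (addr_ge0 ler01 (ltW ti)) (ler0n _ _)) s2.
  - exact: mulr_ge0 (mulr_ge0 (mulr_ge0 c0 (ler0n _ _)) s3) (ltW ti).
  exact: mulr_ge0 (mulr_ge0 (ler0n _ _) (ltW ti)) s2.
pose eta := Num.min (1 / 4096) (e / 4 / (c2 + 1)).
have eta0 : 0 < eta.
  by rewrite /eta lt_min; rewrite !divr_gt0 ?ltr0n// ltr_wpDl.
have eta1 : eta <= 1 / 4096 by rewrite /eta ge_min lexx.
have eta2 : eta <= e / 4 / (c2 + 1) by rewrite /eta ge_min lexx orbT.
have kN' : \forall n \near \oo, (k n)%:R / ln ((N n)%:R : R) <= eta / 16.
  have /cvgrPdist_le /(_ (eta / 16)) : ((k n)%:R / ln ((N n)%:R : R)) @[n --> \oo] --> (0 : R) := kN.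
  move=> /(_ (divr_gt0 eta0 (ltr0n _ 16))) h; near=> n.
  have : `|0 - (k n)%:R / ln ((N n)%:R : R)| <= eta / 16 by near: n.
  by rewrite sub0r normrN; apply: le_trans; exact: ler_norm.
have [M etaM] : exists M : nat, eta^-1 <= M%:R.
  by exists (Num.truncn eta^-1).+1; apply: ltW; exact: truncnS_gt.
near=> n.
have N16 : (16 <= N n)%N by near: n; exact: N_large.
have NM : (M <= N n)%N by near: n; exact: N_large.
have NR : 0 < (N n)%:R :> R by rewrite ltr0n; apply: leq_trans N16.
have /andP[e0' e1'] : 0 <= eps n <= 16 * ((k n)%:R / ln ((N n)%:R : R)) by near: n; exact: eps_le.
have kE : (k n)%:R / ln ((N n)%:R : R) <= eta / 16 by near: n.
have e_eta : eps n <= eta.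
  by apply: le_trans e1' _; rewrite mulrC -ler_pdivlMr.
have N_eta : (N n)%:R^-1 <= eta.
  rewrite -[eta]invrK lef_pV2 ?posrE ?invr_gt0//; apply: le_trans etaM _.
  by rewrite ler_nat.
(* The core is indexed by the number of prime factors minus one. *)
have kk : (k n).-1.+1 = k n by rewrite prednK.
set m := ((N n).-1 %/ 4)%N.
have [m0 mN Nm] := quarter_split N16.
have [rho_le eps2 e113 e1] := small_parameters e0' e_eta N_eta eta1.
have cu : 0 < cumpdens R (K n) m.
  apply: lt_le_trans (ln_le_cumpdens R (K n) N16).
  by rewrite divr_gt0// ln_gt0// ltr1n; apply: leq_trans N16.
have epsE : eps n = 4 * (k n).-1.+1%:R / cumpdens R (K n) m by rewrite kk.
have Wh : 113 * (k n).-1.+1%:R <= cumpdens R (K n) m.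
  move: e113; rewrite epsE mulrAC ler_pdivrMr// -mulrA ler_pM2l ?ltr0n//.
  by rewrite mulrC.
have uA : uniq (A n) by rewrite filter_uniq// mon_uniq.
have cA : {subset core (K n) m (N n) (k n).-1 <= A n}.
  move=> F; rewrite !mem_filter kk => /andP[/and3P[/eqP o1 /eqP o2 _] ->].
  by rewrite a_core.
have sA : {subset A n <= [seq F <- mon (K n) (N n) | (omega F == (k n).-1.+1) || (Omega F == (k n).-1.+1)]}.
  by move=> F; rewrite !mem_filter kk => /andP[/a_sub -> ->].
have := character_sum_heat (u_RV (n := n)) (u_indep (n := n)) (u_unit (n := n)) (u_moment (n := n))
  m0 mN Nm Wh epsE rho_le uA cA sA y s0 t0 eps2.
rewrite distrC => h; apply: le_trans h _.
have Ni : 0 <= (N n)%:R^-1 :> R by rewrite invr_ge0 ltW.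
apply: le_trans (heat_error_le s0 t0 e0' e1 Ni c0) _.
rewrite -/c1 -/c2.
have -> : t * c1 = e / 2 by rewrite /t divfK// gt_eqF.
by apply: split_error eta2 _ => //; rewrite mulr2n mulrDl mul1r lerD.
Unshelve. all: by end_near. Qed.

End Asymptotic.

(** * Steinhaus variables *)

Section CircleMoments.
Variable R : realType.
Local Notation mu := (@lebesgue_measure R).

Let U : probability (measurableTypeR R) R := uniform_prob (twopi_gt0 R).

(** The mean over a period of the derivative of G vanishes by the fundamental theorem of calculus.
    The shift by M makes the integrand nonnegative, as the integral formula for the uniform law
    requires. *)
Lemma Ex_uniform_derivative (G g : R -> R) (M : R) : continuous g ->
  (forall t, is_derive t (1 : R) G (g t)) -> (forall t, `|g t| <= M) -> G (2 * pi) = G 0 ->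
  Ex U g = 0.
Proof.
move=> cg dG gM G0.
have mg : measurable_fun [set: measurableTypeR R] (g : measurableTypeR R -> R).
  exact: continuous_measurable_fun.
have bg : @bounded_measurable R _ (measurableTypeR R) g by split => //; exists M.
have g0 t : 0 <= g t + M by have := gM t; rewrite ler_norml => /andP[? ?]; lra.
have twopi := twopi_gt0 R.
suff : Ex U (fun t => g t + M) = M.
  by rewrite (ExD U bg (bm_cst _ _)) Ex_cst => /(canRL (addrK _)); rewrite subrr.
rewrite /Ex /Rintegral.
rewrite (integral_uniform twopi (f := fun t => (g t + M)%:E)); last 2 first.
- by apply/measurable_EFinP; apply: measurable_funD => //; exact: measurable_cst.
- by move=> t; rewrite lee_fin.
have dGM t : is_derive t (1 : R) (fun x => G x + x * M) (g t + M).
  have := dG t => h; apply: is_derive_eq.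
  by rewrite /GRing.scale /=; ring.
rewrite (@continuous_FTC2 _ _ (fun x => G x + x * M))//.
- rewrite mul0r addr0 G0 subr0 -EFinB /=.
  by rewrite addrAC subrr add0r mulrA mulVf ?mul1r// gt_eqF.
- apply: continuous_subspaceT => x; apply: cvgD; [exact: cg|exact: cvg_cst].
- have cG : continuous (fun x => G x + x * M).
    move=> x; apply: differentiable_continuous; apply/derivable1_diffP.
    by have [] := dGM x.
  split; first by move=> x _; have [] := dGM x.
    by apply: cvg_at_right_filter; exact: cG.
  by apply: cvg_at_left_filter; exact: cG.
- by move=> x _; rewrite derive1E; have [_ ->] := dGM x.
Qed.

Lemma de_Moivre (t : R) n :
  (Complex (cos t) (sin t)) ^+ n = Complex (cos (n%:R * t)) (sin (n%:R * t)).
Proof.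
elim: n => [|n IH]; first by rewrite expr0 mul0r cos0 sin0.
rewrite exprS IH -natr1 mulrDl mul1r cosD sinD.
by apply/eqP; rewrite eq_complex /=; apply/andP; split; apply/eqP; ring.
Qed.

Lemma Ex_cos_sin n : (0 < n)%N ->
  Ex U (fun t => cos (n%:R * t)) = 0 /\ Ex U (fun t => sin (n%:R * t)) = 0.
Proof.
move=> n0; have nR : n%:R != 0 :> R by rewrite pnatr_eq0 -lt0n.
have npi : n%:R * (2 * pi) = 0 + (pi *+ 2) *+ n :> R by rewrite add0r -mulrnA -[RHS]mulr_natl natrM; ring.
have sin2pi : sin (n%:R * (2 * pi)) = 0 :> R by rewrite npi periodicn ?sin0//; exact: sinD2pi.
have cos2pi : cos (n%:R * (2 * pi)) = 1 :> R by rewrite npi periodicn ?cos0//; exact: cosD2pi.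
have cn : continuous (fun t : R => n%:R * t) by move=> x; apply: cvgM; [exact: cvg_cst|exact: cvg_id].
split.
- apply: (@Ex_uniform_derivative (fun t => n%:R^-1 * sin (n%:R * t)) _ 1).
  + by move=> x; apply: continuous_comp; [exact: cn|exact: continuous_cos].
  + move=> t; apply: is_derive_eq.
    by rewrite /GRing.scale /=; field.
  + by move=> t; rewrite ler_norml cos_geN1 cos_le1.
  + by rewrite sin2pi !mulr0 sin0 mulr0.
- apply: (@Ex_uniform_derivative (fun t => - n%:R^-1 * cos (n%:R * t)) _ 1).
  + by move=> x; apply: continuous_comp; [exact: cn|exact: continuous_sin].
  + move=> t; apply: is_derive_eq.
    by rewrite /GRing.scale /=; field.
  + by move=> t; rewrite ler_norml sin_geN1 sin_le1.
  + by rewrite cos2pi mulr0 cos0.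
Qed.

End CircleMoments.

(** * Retraction of Steinhaus variables onto the unit circle *)

Section Projection.
Variable R : realType.

(* Retraction onto the circle: a Steinhaus variable lies on the circle only
   almost surely, its image under [retract] everywhere. *)
Definition retract (z : R[i]) : R[i] := if normsq z == 1 then z else 1.

Lemma normsq_retract z : normsq (retract z) = 1.
Proof. by rewrite /retract; case: eqP => // _; rewrite /normsq /= expr1n expr0n addr0. Qed.

Lemma retract_id z : normsq z = 1 -> retract z = z.
Proof. by rewrite /retract => ->; rewrite eqxx. Qed.

Let retract2 (x : plane R) : plane R := toR2 (retract (Complex x.1 x.2)).

Let toR2_retract z : toR2 (retract z) = retract2 (toR2 z).
Proof. by rewrite /retract2 /toR2 /=; case: z. Qed.

Lemma measurable_retract2 : measurable_fun [set: plane R] retract2.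
Proof.
have -> : retract2 = (fun x => if x.1 ^+ 2 + x.2 ^+ 2 == 1 then x else (1, 0)).
  by apply/funext => -[x y]; rewrite /retract2 /retract /normsq /=; case: eqP.
apply: measurable_fun_ifT; [|exact: measurable_id|exact: measurable_cst].
apply: measurable_fun_eqr; last exact: measurable_cst.
by apply: measurable_funD; apply: measurable_funX; [exact: measurable_fst|exact: measurable_snd].
Qed.

Context d (T : measurableType d) (P : probability T R).

Lemma retract_RV X : complex_RV X -> complex_RV (fun w : T => retract (X w)).
Proof.
move=> mX; rewrite /complex_RV; have -> : @toR2 R \o (fun w => retract (X w)) = retract2 \o (@toR2 R \o X).
  by apply/funext => w /=; rewrite toR2_retract.
exact: measurableT_comp measurable_retract2 mX.
Qed.

Lemma retract_preimage (X : T -> R[i]) (B : set (plane R)) :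
  (@toR2 R \o (fun w => retract (X w))) @^-1` B = (@toR2 R \o X) @^-1` (retract2 @^-1` B).
Proof. by apply/seteqP; split => w /=; rewrite toR2_retract. Qed.

Lemma retract_indep (I : eqType) (J : pred I) (X : I -> T -> R[i]) :
  mutually_independent P J X -> mutually_independent P J (fun i w => retract (X i w)).
Proof.
move=> h s B us Js mB.
have mB' i : measurable (retract2 @^-1` B i).
  by rewrite -[X in measurable X]setTI; exact: measurable_retract2.
under eq_bigr do rewrite retract_preimage.
rewrite h//; apply: eq_bigr => i _; by rewrite retract_preimage.
Qed.

Let U : probability (measurableTypeR R) R := uniform_prob (twopi_gt0 R).
Let angle (t : measurableTypeR R) : plane R := (cos t, sin t).

Let mangle : measurable_fun [set: measurableTypeR R] angle.
Proof.
apply/measurable_fun_pairP; split; apply: continuous_measurable_fun.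
  exact: continuous_cos.
exact: continuous_sin.
Qed.

Lemma Ex_uniform_on_circle X (phi : plane R -> R) : complex_RV X -> uniform_on_circle P X ->
  bounded_measurable phi -> Ex P (fun w => phi (toR2 (X w))) = Ex U (fun t => phi (angle t)).
Proof.
move=> mX uX bphi.
pose X' : {mfun T >-> plane R} := HB.pack (@toR2 R \o X) (isMeasurableFun.Build _ _ _ _ _ mX).
pose Y' : {mfun measurableTypeR R >-> plane R} := HB.pack angle (isMeasurableFun.Build _ _ _ _ _ mangle).
rewrite -[LHS](Ex_distribution P X' bphi) -[RHS](Ex_distribution U Y' bphi).
rewrite /Ex /Rintegral; congr fine; apply: eq_measure_integral => A mA _.
exact: uX.
Qed.

(** The circle is measurable and contains every (cos t, sin t), so it has probability 1 under the
    law of X. *)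
Lemma ae_unit X : complex_RV X -> uniform_on_circle P X -> {ae P, forall w, normsq (X w) = 1}.
Proof.
move=> mX uX.
pose B : set (plane R) := [set x | x.1 ^+ 2 + x.2 ^+ 2 = 1].
have mB : measurable B.
  have -> : B = (fun x : plane R => x.1 ^+ 2 + x.2 ^+ 2 == 1) @^-1` [set true].
    by apply/seteqP; split => x /=; [move=> ->; rewrite eqxx|move/eqP].
  have mb : measurable_fun [set: plane R] (fun x : plane R => x.1 ^+ 2 + x.2 ^+ 2 == 1).
    apply: measurable_fun_eqr; last exact: measurable_cst.
    by apply: measurable_funD; apply: measurable_funX; [exact: measurable_fst|exact: measurable_snd].
  by rewrite -[X in measurable X]setTI; exact: mb.
have mXB : measurable ((@toR2 R \o X) @^-1` B).
  by rewrite -[X in measurable X]setTI; exact: mX.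
have P1 : P ((@toR2 R \o X) @^-1` B) = 1%E.
  rewrite uX// /uniform_circle /pushforward (_ : _ @^-1` B = setT).
    exact: (probability_setT U).
  by apply/seteqP; split => t //= _; rewrite /B /= cos2Dsin2.
exists (~` ((@toR2 R \o X) @^-1` B)); split; first exact: measurableC.
  by rewrite probability_setC// P1 subee.
by apply: subsetC => w.
Qed.

Lemma retract_moment X n : complex_RV X -> uniform_on_circle P X -> (0 < n)%N ->
  Ex P (fun w => complex.Re (retract (X w) ^+ n)) = 0 /\
  Ex P (fun w => complex.Im (retract (X w) ^+ n)) = 0.
Proof.
move=> mX uX n0.
pose Z (x : plane R) : R[i] := retract (Complex x.1 x.2) ^+ n.
have mr := measurable_retract2.
have [b1 b2] : @cbm R _ (plane R) Z.
  apply: cbmX; split; split.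
  - exact: (measurableT_comp (@measurable_fst _ _ _ _) mr).
  - by exists 1 => x; apply: Re_norm_le; exact: normsq_retract.
  - exact: (measurableT_comp (@measurable_snd _ _ _ _) mr).
  - by exists 1 => x; apply: Im_norm_le; exact: normsq_retract.
have ZX w : Z (toR2 (X w)) = retract (X w) ^+ n by rewrite /Z /toR2 /=; case: (X w).
have Zangle t : Z (angle t) = Complex (cos (n%:R * t)) (sin (n%:R * t)).
  by rewrite /Z retract_id ?de_Moivre// /normsq /= cos2Dsin2.
have [c s] := Ex_cos_sin R n0.
split.
- have := Ex_uniform_on_circle mX uX b1; under eq_fun do rewrite ZX; move=> ->.
  by rewrite -[RHS]c; congr Ex; apply/funext => t; rewrite Zangle.
- have := Ex_uniform_on_circle mX uX b2; under eq_fun do rewrite ZX; move=> ->.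
  by rewrite -[RHS]s; congr Ex; apply/funext => t; rewrite Zangle.
Qed.

End Projection.

Section ComplexRV.
Context (R : realType) d (T : measurableType d).
Implicit Types X Y : T -> R[i].

Lemma complex_RVP X : complex_RV X <->
  measurable_fun [set: T] (fun w => complex.Re (X w)) /\
  measurable_fun [set: T] (fun w => complex.Im (X w)).
Proof.
split=> [mX|[m1 m2]]; last exact/measurable_fun_pairP.
split; first exact: (measurableT_comp (@measurable_fst _ _ _ _) mX).
exact: (measurableT_comp (@measurable_snd _ _ _ _) mX).
Qed.

Lemma complex_RV_cst (z : R[i]) : complex_RV (fun _ : T => z).
Proof. exact: measurable_cst. Qed.

Lemma complex_RVD X Y : complex_RV X -> complex_RV Y -> complex_RV (fun w => X w + Y w).
Proof.
move=> /complex_RVP[x1 x2] /complex_RVP[y1 y2]; apply/complex_RVP; split.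
  by under eq_fun do rewrite ReD; exact: measurable_funD.
by under eq_fun do rewrite ImD; exact: measurable_funD.
Qed.

Lemma complex_RVM X Y : complex_RV X -> complex_RV Y -> complex_RV (fun w => X w * Y w).
Proof.
move=> /complex_RVP[x1 x2] /complex_RVP[y1 y2]; apply/complex_RVP; split.
  by under eq_fun do rewrite ReM; apply: measurable_funB; exact: measurable_funM.
by under eq_fun do rewrite ImM; apply: measurable_funD; exact: measurable_funM.
Qed.

Lemma complex_RVX X n : complex_RV X -> complex_RV (fun w => X w ^+ n).
Proof.
move=> mX; elim: n => [|n IH]; first by under eq_fun do rewrite expr0; exact: complex_RV_cst.
by under eq_fun do rewrite exprS; exact: complex_RVM.
Qed.

Lemma complex_RV_sum (I : eqType) (s : seq I) (h : I -> T -> R[i]) :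
  (forall i, i \in s -> complex_RV (h i)) -> complex_RV (fun w => \sum_(i <- s) h i w).
Proof.
elim: s => [|i s IH] mh; first by under eq_fun do rewrite big_nil; exact: complex_RV_cst.
under eq_fun do rewrite big_cons; apply: complex_RVD; first by apply: mh; rewrite mem_head.
by apply: IH => j js; apply: mh; rewrite inE js orbT.
Qed.

Lemma complex_RV_prod (I : eqType) (s : seq I) (h : I -> T -> R[i]) :
  (forall i, i \in s -> complex_RV (h i)) -> complex_RV (fun w => \prod_(i <- s) h i w).
Proof.
elim: s => [|i s IH] mh; first by under eq_fun do rewrite big_nil; exact: complex_RV_cst.
under eq_fun do rewrite big_cons; apply: complex_RVM; first by apply: mh; rewrite mem_head.
by apply: IH => j js; apply: mh; rewrite inE js orbT.
Qed.

End ComplexRV.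

(** * Normalised sums expressed through lists and characters *)

Section NormalizedSum.
Context (R : realType) d (T : measurableType d) (P : probability T R).
Variables (K : finFieldType) (N : nat) (f : {poly K} -> T -> R[i]).
Hypothesis fS : steinhaus P f.
Variables (a : {poly K} -> bool) (A : {set {poly_N.+1 K}}).
Hypothesis AE : forall G, (G \in A) = (G \in monic_deg K N) && a (polyn G).
Let L := [seq F <- mon K N | a F].

Let L_monic F : F \in L -> F \is monic.
Proof. by rewrite mem_filter mem_mon => /and3P[]. Qed.

Lemma chi_steinhaus F w : F \is monic -> chi f F w = f F w.
Proof.
move=> mF; rewrite [in RHS](prod_multiplicity mF) (steinhaus_mul fS)//.
  exact: prime_divisors_uniq.
exact: all_prime_divisors.
Qed.

Lemma sum_set_list (V : nmodType) (phi : {poly K} -> V) :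
  \sum_(G in A) phi (polyn G) = \sum_(F <- L) phi F.
Proof.
rewrite /L big_filter /mon big_map big_enum_cond /=.
by apply: eq_bigl => G; rewrite AE.
Qed.

Lemma card_set_list : #|A| = size L.
Proof. by have := sum_set_list (fun=> 1%N); rewrite sum1_card sum1_size. Qed.

Lemma normalized_sumE w : normalized_sum A f w = character_sum f L w.
Proof.
rewrite /normalized_sum /character_sum card_set_list (sum_set_list (fun F => f F w)).
congr (_ * _); apply: eq_big_seq => F /L_monic mF.
by rewrite chi_steinhaus.
Qed.

Lemma normalized_sum_RV : complex_RV (normalized_sum A f).
Proof.
have -> : normalized_sum A f = character_sum f L by apply/funext => w; exact: normalized_sumE.
apply: complex_RVM; first exact: complex_RV_cst.
apply: complex_RV_sum => F /L_monic mF; apply: complex_RV_prod => Q.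
by rewrite prime_divisorsP// => /andP[pQ _]; apply: complex_RVX; exact: (steinhaus_RV fS).
Qed.

Let u Q w := retract (f Q w).

(** Only the finitely many primes of degree at most N occur, so their exceptional null sets have a
    null union. *)
Lemma normalized_sum_retract : {ae P, forall w, normalized_sum A f w = character_sum u L w}.
Proof.
have : {ae P, forall w, forall Q, Q \in prs K N -> normsq (f Q w) = 1}.
  have : all (@prime_poly K) (prs K N) := all_prs K N.
  elim: (prs K N) => [_|Q s IH /= /andP[pQ ps]]; first exact: aeW.
  apply: filterS2 (IH ps) (ae_unit (steinhaus_RV fS pQ) (steinhaus_uniform fS pQ)).
  by move=> w h1 h2 Q'; rewrite inE => /orP[/eqP ->//|]; exact: h1.
apply: filterS => w h; rewrite normalized_sumE; congr (_ * _); apply: eq_big_seq => F FL.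
have := FL; rewrite mem_filter mem_mon => /and3P[_ mF /eqP dF].
apply: eq_big_seq => Q; rewrite prime_divisorsP// => /andP[pQ QF].
by rewrite /u retract_id// h// mem_prs pQ -dF prime_dvd_deg.
Qed.

End NormalizedSum.

(** * The limit theorem for a family between the core and its upper bound *)

Section Convergence.
Variables (R : realType) (K : nat -> finFieldType) (N k : nat -> nat).
Variables (d : nat -> measure_display) (T : forall n, measurableType (d n)).
Variables (P : forall n, probability (T n) R) (f : forall n, {poly K n} -> T n -> R[i]).
Arguments f : clear implicits.
Hypothesis k_gt0 : forall n, (1 <= k n)%N.
Hypothesis N_oo : N @ \oo --> \oo.
Hypothesis kN : ((k n)%:R / ln ((N n)%:R : R)) @[n --> \oo] --> (0 : R).
Hypothesis fS : forall n, steinhaus (P n) (f n).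
Variable a : forall n, {poly K n} -> bool.
Arguments a : clear implicits.
Hypothesis a_core : forall n F, omega F = k n -> Omega F = k n -> a n F.
Hypothesis a_sub : forall n F, a n F -> (omega F == k n) || (Omega F == k n).
Variable A : forall n, {set {poly_(N n).+1 (K n)}}.
Hypothesis AE : forall n G, (G \in A n) = (G \in monic_deg (K n) (N n)) && a n (polyn G).

Lemma normalized_sum_cvg :
  cvg_in_distribution P (fun n => normalized_sum (A n) (f n)) (complex_normal R).
Proof.
split=> [n|g cg [M gM]]; first exact: (normalized_sum_RV (fS n) (@AE n)).
pose u n Q w := retract (f n Q w).
pose L n := [seq F <- mon (K n) (N n) | a n F].
have uRV n Q : prime_poly Q -> complex_RV (u n Q).
  by move=> pQ; apply: retract_RV; exact: (steinhaus_RV (fS n)).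
have uI n : mutually_independent (P n) (@prime_poly (K n)) (u n).
  by apply: retract_indep; exact: (steinhaus_indep (fS n)).
have uU n Q w : prime_poly Q -> normsq (u n Q w) = 1 by move=> _; exact: normsq_retract.
have uM n Q m : prime_poly Q -> (0 < m)%N ->
    Ex (P n) (fun w => complex.Re (u n Q w ^+ m)) = 0 /\
    Ex (P n) (fun w => complex.Im (u n Q w ^+ m)) = 0.
  move=> pQ m0; apply: retract_moment => //; first exact: (steinhaus_RV (fS n)).
  exact: (steinhaus_uniform (fS n)).
have Lm n : {in L n, forall F, F \is monic}.
  by move=> F; rewrite mem_filter mem_mon => /and3P[].
have uL n : uniq (L n) by rewrite filter_uniq// mon_uniq.
pose Z n := character_sum (u n) (L n).
have cZ n : cbm (Z n).
  apply: cbmM; first exact: cbm_cst.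
  by apply: cbm_sum => F FL _; apply: (cbm_chi (uRV n) (uU n)); exact: Lm FL.
have Z2 n : Ex (P n) (fun w => normsq (Z n w)) <= 1.
  have := Ex_normsq_sum (uRV n) (uI n) (uU n) (uM n)
    (fun=> (Num.sqrt ((size (L n))%:R : R))^-1) (uL n) (Lm n).
  rewrite (_ : (fun w => _) = (fun w => normsq (Z n w))); last first.
    by apply/funext => w; congr normsq; rewrite /Z /character_sum big_distrr.
  move=> ->; rewrite big_const_seq count_predT iter_addr_0 exprVn sqr_sqrtr// -[_ *+ _]mulr_natr.
  (* An empty family has second moment 0 instead of 1, so only the inequality holds for every n. *)
  by have [->|s0] := eqVneq (size (L n)) 0%N; [rewrite mulr0|rewrite mulVf// pnatr_eq0].
have hZ s y : 0 < s -> Ex (P n) (fun w => heat s (y - Z n w)) @[n --> \oo] --> heat (1 + s) y.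
  by move=> s0; exact: (character_sum_heat_cvg k_gt0 N_oo kN uRV uI uU uM a_core a_sub).
have W := heat_cvg_weak cZ Z2 hZ cg gM.
have mg : @bounded_measurable R _ (plane R) g.
  by split; [exact: continuous_plane_measurable|exists M].
rewrite -EFin_Ex//.
have bZ n : bounded_measurable (fun w => g (toR2 (Z n w))).
  apply: (bm_comp _ mg); apply/complex_RVP; have [z1 z2] := cZ n.
  by split; exact: bmP.
have E n : (\int[P n]_w (g (toR2 (normalized_sum (A n) (f n) w)))%:E)%E =
    (Ex (P n) (fun w => g (toR2 (Z n w))))%:E.
  rewrite EFin_Ex//; apply: ae_eq_integral => //.
  - apply/measurable_EFinP; apply: (measurableT_comp (bmP mg)).
    exact: (normalized_sum_RV (fS n) (@AE n)).
  - by apply/measurable_EFinP; exact: bmP.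
  - by apply: filterS (normalized_sum_retract (fS n) (@AE n)) => w -> _.
rewrite (_ : (fun n => _) = (fun n => (Ex (P n) (fun w => g (toR2 (Z n w))))%:E)).
  by apply: cvg_EFin => //; near=> n.
by apply/funext => n; exact: E.
Unshelve. all: by end_near. Qed.

End Convergence.

Theorem theorem2p2 (R : realType)
    (q : nat -> nat) (K : nat -> finFieldType) (N k : nat -> nat)
    (d : nat -> measure_display) (T : forall n, measurableType (d n))
    (P : forall n, probability (T n) R)
    (f : forall n, {poly K n} -> T n -> R[i]) :
  (forall n, #|K n| = q n) ->
  (forall n, (1 <= N n)%N) ->
  (forall n, (1 <= k n)%N) ->
  N @ \oo --> \oo ->
  ((k n)%:R / ln ((N n)%:R : R)) @[n --> \oo] --> (0 : R) ->
  (forall n, steinhaus (P n) (f n)) ->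
  [/\ cvg_in_distribution P
        (fun n => normalized_sum (calP (K n) (k n) (N n)) (f n))
        (complex_normal R),
      cvg_in_distribution P
        (fun n => normalized_sum (calS (K n) (k n) (N n)) (f n))
        (complex_normal R)
    & cvg_in_distribution P
        (fun n => normalized_sum (calD (K n) (k n) (N n)) (f n))
        (complex_normal R)].
Proof.
(* Each family contains all F with omega = Omega = k and only F with omega = k or Omega = k, as the
   general result asks. *)
move=> _ _ k1 N_oo kN fS; split.
- apply: (normalized_sum_cvg k1 N_oo kN fS (a := fun n F => Omega F == k n)).
  + by move=> n F _ ->.
  + by move=> n F ->; rewrite orbT.
  + by move=> n G; rewrite inE.
- apply: (normalized_sum_cvg k1 N_oo kN fS (a := fun n F => (Omega F == k n) && (omega F == k n))).
  + by move=> n F -> ->; rewrite eqxx.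
  + by move=> n F /andP[_ ->].
  + by move=> n G; rewrite inE.
- apply: (normalized_sum_cvg k1 N_oo kN fS (a := fun n F => omega F == k n)).
  + by move=> n F ->.
  + by move=> n F ->.
  + by move=> n G; rewrite inE.
Qed.
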